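(* Let $\mathbf{X}=(\mathbf{x}_1,\dots,\mathbf{x}_p)$ be a deterministic $n\times p$ real matrix, $\boldsymbol\beta\in\mathbb{R}^p$, $\boldsymbol\varepsilon\sim N(0,\sigma^2\mathbf{I}_n)$ with $\sigma>0$, and $\mathbf{y}=\mathbf{X}\boldsymbol\beta+\boldsymbol\varepsilon$. Suppose that $q\ge 1$ and: (Sparsity) there is an index set $A_0\subset\{1,\dots,p\}$ with $\#\{j\le p: j\notin A_0\}=q$ and $\sum_{j\in A_0}|\beta_j|\le\eta_1$; put $\eta_2=\max_{A\subset A_0}\|\sum_{j\in A}\beta_j\mathbf{x}_j\|$; (Sparse Riesz condition) for an integer $q^*$ with $1\le q^*\le p$ and constants $0<c_*<c^*<\infty$, one has $c_*\le \|\mathbf{X}_A\mathbf{v}\|^2/(n\|\mathbf{v}\|^2)\le c^*$ for all $A\subset\{1,\dots,p\}$ with $|A|=q^*$ and all nonzero $\mathbf{v}\in\mathbb{R}^{q^*}$. Let $c_0\ge 0$ and $a_n\ge 0$. With the quantities $\widehat{\boldsymbol\beta}(\lambda),\widehat A(\lambda),\widehat q(\lambda),\widehat{\mathbf{P}}(\lambda),\widetilde B(\lambda),\zeta_2(\lambda),M_1^*(\lambda),M_2^*(\lambda),M_3^*(\lambda),\lambda_*,\lambda_{n,p}$ defined in the context, there exists a (Borel) set $\Omega_0$ in the sample space $\mathbb{R}^{n\times p}\times\mathbb{R}^n$ of $(\mathbf{X},\boldsymbol\varepsilon/\sigma)$, depending on $\{\mathbf{X}\boldsymbol\beta,c_0,a_n\}$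 only, such that $$P\{(\mathbf{X},\boldsymbol\varepsilon/\sigma)\in\Omega_0\}\ \ge\ 2-\exp\Big(\frac{2p}{(p\vee a_n)^{1+c_0}}\Big)-\frac{2}{(p\vee a_n)^{1+c_0}}$$ (a lower bound which tends to $1$ whenever $p/(p\vee a_n)^{1+c_0}\to 0$), and in the event $(\mathbf{X},\boldsymbol\varepsilon/\sigma)\in\Omega_0$ the following three assertions hold for all $\lambda\ge\max(\lambda_*,\lambda_{n,p})$: $$\widehat q(\lambda)\ \le\ \widetilde q(\lambda):=\#\{j:\widehat\beta_j(\lambda)\ne 0\text{ or }j\notin A_0\}\ \le\ M_1^*(\lambda)\,q,$$ $$\widetilde B^2(\lambda)=\|(\mathbf{I}-\widehat{\mathbf{P}}(\lambda))\mathbf{X}\boldsymbol\beta\|^2\ \le\ M_2^*(\lambda)\frac{q\lambda^2}{c^*n},$$ $$\zeta_2^2(\lambda)=\sum_{j\notin A_0}|\beta_j|^2 I\{\widehat\beta_j(\lambda)=0\}\ \le\ M_3^*(\lambda)\frac{q\lambda^2}{c^*c_*n^2}.$$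
   Context: Notation: $\|\cdot\|$ is the Euclidean norm, $\|\cdot\|_1$ the $\ell_1$ norm, $a\vee b=\max(a,b)$, $\mathbf{X}_A=(\mathbf{x}_j,j\in A)$ is the submatrix of columns with index in $A$, and $I\{\cdot\}$ is an indicator. LASSO: for $\lambda>0$, $\widehat{\boldsymbol\beta}(\lambda)\in\arg\min_{\mathbf{b}\in\mathbb{R}^p}\{\|\mathbf{y}-\mathbf{X}\mathbf{b}\|^2/2+\lambda\|\mathbf{b}\|_1\}$. The selected model is $\widehat A(\lambda)=\{j\le p:\widehat\beta_j(\lambda)\neq0\}$, and $\widehat q(\lambda)=|\widehat A(\lambda)|$. $\widehat{\mathbf{P}}(\lambda)$ is the orthogonal projection of $\mathbb{R}^n$ onto the span of $\{\mathbf{x}_j:j\in\widehat A(\lambda)\}$. $\widetilde B(\lambda)=\|(\mathbf{I}-\widehat{\mathbf{P}}(\lambda))\mathbf{X}\boldsymbol\beta\|$, and $\zeta_2(\lambda)=(\sum_{j\notin A_0}|\beta_j|^2I\{\widehat\beta_j(\lambda)=0\})^{1/2}$. Constants: for $\lambda>0$ let $$r_1=r_1(\lambda)=\Big(\frac{c^*\eta_1n}{q\lambda}\Big)^{1/2},\quad r_2=r_2(\lambda)=\Big(\frac{c^*\eta_2^2n}{q\lambda^2}\Big)^{1/2},\quad C=\frac{c^*}{c_*},$$ $$M_1^*(\lambda)=2+4r_1^2+4\sqrt{C}\,r_2+4C,$$ $$M_2^*(\lambda)=\tfrac83\big\{\tfrac14+r_1^2+r_2\sqrt{2C}(1+\sqrt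 C)+C(\tfrac12+\tfrac43C)\big\},$$ $$M_3^*(\lambda)=\tfrac83\big\{\tfrac14+r_1^2+r_2\sqrt C(1+2\sqrt{1+C})+\tfrac{3r_2^2}{4}+C(\tfrac76+\tfrac23C)\big\}.$$ Penalty levels: $\lambda_*=\inf\{\lambda>0:M_1^*(\lambda)q+1\le q^*\}$ with $\inf\varnothing=\infty$, and $\lambda_{n,p}=2\sigma\sqrt{2(1+c_0)c^*n\log(p\vee a_n)}$. Only finite $\lambda>0$ are considered, so the conclusion is vacuous if $\lambda_*=\infty$. *)

(* Defs.v *)
From HB Require Import structures.
From mathcomp Require Import all_boot all_order all_algebra.
From mathcomp Require Import all_classical all_reals all_analysis.

Set Implicit Arguments.
Unset Strict Implicit.
Unset Printing Implicit Defensive.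

Import Order.TTheory GRing.Theory Num.Theory.
Import numFieldNormedType.Exports.

Local Open Scope classical_set_scope.
Local Open Scope ring_scope.

(* The norm carried by the library's matrices is the sup norm, hence the
   explicit Euclidean norm. *)
Definition enorm (R : realType) (n : nat) (v : 'cV[R]_n) : R :=
  Num.sqrt (\sum_i v i 0 ^+ 2).

Definition l1norm (R : realType) (n : nat) (v : 'cV[R]_n) : R :=
  \sum_i `|v i 0|.

Definition colsin (R : realType) (n p : nat) (X : 'M[R]_(n, p))
    (A : {set 'I_p}) : 'M[R]_(n, #|A|) :=
  colsub (fun k : 'I_#|A| => enum_val k) X.

(* Orthogonal projection onto the column span of B, acting on column vectors.
   [proj_mx] acts on rows: it projects onto the row space of B^T along
   [kermx B], the space of all u with u *m B = 0, that is, along its orthogonal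
   complement. *)
Definition orthproj (R : realType) (n m : nat) (B : 'M[R]_(n, m)) : 'M[R]_n :=
  (proj_mx <<B^T>>%MS (kermx B))^T.

Definition lasso_obj (R : realType) (n p : nat) (X : 'M[R]_(n, p))
    (y : 'cV[R]_n) (lambda : R) (b : 'cV[R]_p) : R :=
  enorm (y - X *m b) ^+ 2 / 2 + lambda * l1norm b.

Definition lasso_sol (R : realType) (n p : nat) (X : 'M[R]_(n, p))
    (y : 'cV[R]_n) (lambda : R) (b : 'cV[R]_p) : Prop :=
  forall b' : 'cV[R]_p, lasso_obj X y lambda b <= lasso_obj X y lambda b'.

Definition selected (R : realType) (p : nat) (b : 'cV[R]_p) : {set 'I_p} :=
  [set j | b j 0 != 0]%SET.

Definition qhat (R : realType) (p : nat) (b : 'cV[R]_p) : nat := #|selected b|.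

Definition qtilde (R : realType) (p : nat) (A0 : {set 'I_p})
    (b : 'cV[R]_p) : nat :=
  #|[set j | (b j 0 != 0) || (j \notin A0)]%SET|.

Definition Btilde (R : realType) (n p : nat) (X : 'M[R]_(n, p))
    (beta b : 'cV[R]_p) : R :=
  enorm ((1%:M - orthproj (colsin X (selected b))) *m (X *m beta)).

Definition zeta2 (R : realType) (p : nat) (A0 : {set 'I_p})
    (beta b : 'cV[R]_p) : R :=
  Num.sqrt (\sum_(j | j \notin A0) `|beta j 0| ^+ 2 * (b j 0 == 0)%:R).

(* The maximum may start at 0 because A = set0 contributes 0. *)
Definition eta2_of (R : realType) (n p : nat) (X : 'M[R]_(n, p))
    (beta : 'cV[R]_p) (A0 : {set 'I_p}) : R :=
  \big[Num.max/0]_(A : {set 'I_p} | A \subset A0)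
     enorm (\sum_(j in A) beta j 0 *: col j X).

(* Here and below [cl] and [cu] are the lower and upper sparse Riesz bounds
   $c_*$ and $c^*$, and [qs] is the sparse Riesz rank $q^*$. *)
Definition sparse_riesz (R : realType) (n p : nat) (X : 'M[R]_(n, p))
    (qs : nat) (cl cu : R) : Prop :=
  forall (A : {set 'I_p}) (v : 'cV[R]_#|A|), #|A| = qs -> v != 0 ->
    cl <= enorm (colsin X A *m v) ^+ 2 / (n%:R * enorm v ^+ 2) <= cu.

Section Constants.
Variables (R : realType) (n q : nat) (eta1 eta2 cl cu : R).

Definition r1 (lambda : R) : R :=
  Num.sqrt (cu * eta1 * n%:R / (q%:R * lambda)).

Definition r2 (lambda : R) : R :=
  Num.sqrt (cu * eta2 ^+ 2 * n%:R / (q%:R * lambda ^+ 2)).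

Let C : R := cu / cl.

Definition M1 (lambda : R) : R :=
  2 + 4 * r1 lambda ^+ 2 + 4 * Num.sqrt C * r2 lambda + 4 * C.

Definition M2 (lambda : R) : R :=
  8 / 3 * (1 / 4 + r1 lambda ^+ 2
           + r2 lambda * Num.sqrt (2 * C) * (1 + Num.sqrt C)
           + C * (1 / 2 + 4 / 3 * C)).

Definition M3 (lambda : R) : R :=
  8 / 3 * (1 / 4 + r1 lambda ^+ 2
           + r2 lambda * Num.sqrt C * (1 + 2 * Num.sqrt (1 + C))
           + 3 * r2 lambda ^+ 2 / 4
           + C * (7 / 6 + 2 / 3 * C)).

(* [+oo] when no penalty level qualifies. *)
Definition lambda_star (qs : nat) : \bar R :=
  ereal_inf (EFin @` [set l : R | 0 < l /\ M1 l * q%:R + 1 <= qs%:R]).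

End Constants.

Definition lambda_np (R : realType) (n p : nat) (sigma c0 an cu : R) : R :=
  2 * sigma *
    Num.sqrt (2 * (1 + c0) * cu * n%:R * ln (Num.max p%:R an)).

Definition prob_lower (R : realType) (p : nat) (c0 an : R) : R :=
  2 - expR (2 * p%:R / (Num.max p%:R an) `^ (1 + c0))
    - 2 / (Num.max p%:R an) `^ (1 + c0).

Definition borel (T : topologicalType) : set (set T) := <<s @open T >>.

(* eps ~ N(0, sigma^2 I_n): its law is, on measurable rectangles, the product
   of n copies of N(0, sigma^2). The second argument of [normal_prob] is the
   standard deviation. *)
Definition gaussian_noise (R : realType) (n : nat) (d : measure_display)
    (T : measurableType d) (P : probability T R) (sigma : R)
    (eps : T -> 'cV[R]_n) : Prop :=
  (forall i : 'I_n, measurable_fun [set: T] (fun w => eps w i 0)) /\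
  (forall B : 'I_n -> set R, (forall i, measurable (B i)) ->
     P [set w | forall i, B i (eps w i 0)] =
     (\prod_(i < n) normal_prob 0 sigma (B i))%E).

(* Main.v *)
Require Import Defs.
From HB Require Import structures.
From mathcomp Require Import all_boot all_order all_algebra.
From mathcomp Require Import all_classical all_reals all_analysis.
From mathcomp Require Import measurable_realfun ring lra.

Set Implicit Arguments.
Unset Strict Implicit.
Unset Printing Implicit Defensive.

Import Order.TTheory GRing.Theory Num.Theory.
Import numFieldNormedType.Exports.

Local Open Scope classical_set_scope.
Local Open Scope ring_scope.

(* Let A lie between the selected set and the union of the equicorrelation set
   with the complement of A_0, and let s be the sign vector of the residual
   correlations on A, set to 0 outside A_0. Testing the KKT conditions against
   X_A (X_A^T X_A)^-1 s and against the part of beta outside A bounds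
   |lambda X_A (X_A^T X_A)^-1 s|^2 + |(I - P_A) X beta|^2 by terms that the
   sparse Riesz condition controls, plus the inner product of the noise with
   lambda X_A (X_A^T X_A)^-1 s - (I - P_A) X beta. These two vectors are
   orthogonal, so after normalisation and for all lambda at once this product is
   at most the norm of the projection of the noise on a plane; its square is
   chi-square with two degrees of freedom and has the exact tail exp(-t/2).
   Omega_0 controls it for all A and all s in {-1, 0, 1}^A. The bound
   #|A| <= q^* needed to start with is propagated along the LASSO path from
   lambda = +oo: M_1^* q <= q^* - 1 leaves one free slot in the equicorrelation
   set, which makes the property both open and closed in lambda. *)

(** * Rotation invariance and radial tail of the planar Gaussian measure *)

(** The residual correlations on A are known to be +-lambda only inside A_0; outside they may take
    any value in [-lambda, lambda]. That part of the sign vector is therefore estimated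
    deterministically, and only finitely many vectors s remain for the union bound. With k = (p \/
    a_n)^-(1 + c_0) a pair (A, s) is allowed to fail with probability k^max(|A|, 1), and summing
    over all pairs gives (1 + 3 k)^p - 1 + k. This is too much by a factor of about 3/2 in the
    exponent; a factor 1/2 in front repairs it, since opposite sign vectors give the same event and
    s = 0 needs only a one-sided Gaussian tail. With v = exp(p k) the failure probability is then at
    most (v^3 - 1 + k) / 2, which is below v^2 - 1 + 2 k as long as v^2 <= 2; for larger v the
    claimed lower bound is negative. *)

Section AffineSubstitution.
Context {R : realType}.
Local Notation mu := (@lebesgue_measure R).
Local Open Scope ereal_scope.

Let aff (a b : R) (x : R) : measurableTypeR R := (a * x + b)%R.

Let measurable_aff a b : measurable_fun [set: measurableTypeR R] (aff a b).
Proof. by apply: measurable_funD => //; exact: measurable_funM. Qed.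

(** Both sides are measures in [A], so half-open intervals []u, v]] suffice; for [a < 0] their
    preimages are closed on the left and open on the right, which does not affect the length. *)
Lemma lebesgue_measure_affine (a b : R) (A : set (measurableTypeR R)) :
  a != 0%R -> measurable A ->
  `|a|%:E * mu ((fun x => (a * x + b)%R) @^-1` A) = mu A.
Proof.
move=> a0 mA.
pose m := mscale (NngNum (normr_ge0 a)) (pushforward mu (aff a b)).
rewrite -[LHS]/(m (measurable_aff a b) A); apply/esym/lebesgue_measure_unique => //= _ [[u v]] _ <-.
rewrite /mscale/= /pushforward/=.
have [a_gt0|a_lt0|/eqP] := ltgtP 0%R a; last by rewrite eq_sym (negbTE a0).
- rewrite (_ : _ @^-1` _ = `](u - b) / a, (v - b) / a]%classic%R); last first.
    apply/seteqP; split => x /=; rewrite /aff !in_itv/=;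
    by rewrite ltr_pdivrMr// ler_pdivlMr// ltrBlDr lerBrDr mulrC.
  rewrite !lebesgue_measure_itv/= !lte_fin ltr_pM2r ?invr_gt0// ltrD2r.
  case: ifPn => uv; last by rewrite mule0.
  by rewrite -!EFinD -EFinM (gtr0_norm a_gt0); congr EFin; field.
- rewrite (_ : _ @^-1` _ = `[(v - b) / a, (u - b) / a[%classic%R); last first.
    apply/seteqP; split => x /=; rewrite /aff !in_itv/=;
    by rewrite ltr_ndivlMr// ler_ndivrMr// ltrBlDr lerBrDr mulrC andbC.
  rewrite !lebesgue_measure_itv/= !lte_fin ltr_nM2r ?invr_lt0// ltrD2r.
  case: ifPn => uv; last by rewrite mule0.
  by rewrite -!EFinD -EFinM (ltr0_norm a_lt0); congr EFin; field.
Qed.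

Lemma ge0_integral_affine (a b : R) (f : measurableTypeR R -> \bar R) :
  a != 0%R -> measurable_fun [set: measurableTypeR R] f -> (forall x, 0 <= f x) ->
  \int[mu]_x f x = `|a|%:E * \int[mu]_x f (a * x + b)%R.
Proof.
move=> a0 mf f0.
pose m := mscale (NngNum (normr_ge0 a)) (pushforward mu (aff a b)).
transitivity (\int[m (measurable_aff a b)]_x f x).
  apply: eq_measure_integral => A mA _ /=.
  by rewrite /m /mscale/= /pushforward lebesgue_measure_affine.
rewrite ge0_integral_mscale//=; congr (_ * _).
by rewrite ge0_integral_pushforward.
Qed.

End AffineSubstitution.

Section NormalProduct.
Context {R : realType}.
Variable s : R.
Local Notation mu := (@lebesgue_measure R).
Local Notation N := (normal_prob 0 s).
Local Notation phi := (normal_pdf 0 s).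
Local Open Scope ereal_scope.

Let T2 : measurableType _ := (measurableTypeR R * measurableTypeR R)%type.

Let dens (z : T2) : \bar R := (phi z.1 * phi z.2)%:E.

Let dens_ge0 z : 0 <= dens z.
Proof. by rewrite lee_fin mulr_ge0// normal_pdf_ge0. Qed.

Let measurable_dens : measurable_fun setT dens.
Proof.
apply/measurable_EFinP; apply: measurable_funM.
  apply: measurableT_comp; first exact: measurable_normal_pdf.
  exact: measurable_fst.
apply: measurableT_comp; first exact: measurable_normal_pdf.
exact: measurable_snd.
Qed.

(** By uniqueness of the product measure this is [N \x N]; the detour turns Gaussian probabilities
    in the plane into iterated Lebesgue integrals, where substitutions are available. *)
Definition normal_product_density (E : set T2) : \bar R :=
  \int[mu \x mu]_(z in E) dens z.

Let npd0 : normal_product_density set0 = 0.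
Proof. by rewrite /normal_product_density integral_set0. Qed.

Let npd_ge0 E : 0 <= normal_product_density E.
Proof. exact: integral_ge0. Qed.

Let npd_sigma_additive : semi_sigma_additive normal_product_density.
Proof.
move=> /= A mA tA mUA; rewrite /normal_product_density ge0_integral_bigcup//.
  by apply: is_cvg_ereal_nneg_natsum_cond => n _ _; exact: integral_ge0.
exact: measurable_funTS.
Qed.

HB.instance Definition _ := isMeasure.Build _ _ _
  normal_product_density npd0 npd_ge0 npd_sigma_additive.

Lemma normal_probE A : measurable A -> N A = \int[mu]_x (\1_A x * phi x)%:E.
Proof.
move=> mA; rewrite /normal_prob integral_mkcond; apply: eq_integral => x _.
by rewrite patchE indicE; case: (x \in A); rewrite ?mul1r ?mul0r.
Qed.

Lemma normal_product_densityE E : measurable E -> normal_product_density E =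
  \int[mu]_x \int[mu]_y (\1_E (x, y) * (phi x * phi y))%:E.
Proof.
move=> mE; rewrite /normal_product_density integral_mkcond.
rewrite (eq_integral (fun z => (\1_E z)%:E * dens z)); last first.
  by move=> z _; rewrite patchE indicE; case: (z \in E); rewrite ?mul1e ?mul0e.
rewrite fubini_tonelli1//; last first.
- by move=> z; rewrite mule_ge0.
- apply: emeasurable_funM => //; apply/measurable_EFinP.
  exact: measurable_indic.
Qed.

Lemma normal_product_densityX A B : measurable A -> measurable B ->
  normal_product_density (A `*` B) = N A * N B.
Proof.
move=> mA mB; rewrite normal_product_densityE; last exact: measurableX.
rewrite [N A]normal_probE// [N B]normal_probE//.
have mN C : measurable C -> measurable_fun setT
    (fun x => (\1_C x * phi x)%:E : \bar R).
  move=> mC; apply/measurable_EFinP; apply: measurable_funM.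
    exact: measurable_indic.
  exact: measurable_normal_pdf.
rewrite -ge0_integralZr//; last 3 first.
- exact: mN.
- by move=> x _; rewrite lee_fin mulr_ge0// normal_pdf_ge0.
- by apply: integral_ge0 => x _; rewrite lee_fin mulr_ge0// normal_pdf_ge0.
apply: eq_integral => x _; rewrite -ge0_integralZl//; last 3 first.
- exact: mN.
- by move=> y _; rewrite lee_fin mulr_ge0// normal_pdf_ge0.
- by rewrite lee_fin mulr_ge0// normal_pdf_ge0.
apply: eq_integral => y _; rewrite -EFinM; congr EFin.
by rewrite !indicE in_setX/= -mulnb natrM; ring.
Qed.

Lemma normal_productE E : measurable E -> (N \x N) E =
  \int[mu]_x \int[mu]_y (\1_E (x, y) * (phi x * phi y))%:E.
Proof.
move=> mE; rewrite -normal_product_densityE//.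
apply: (@product_measure_unique _ _ _ _ _ (normal_prob 0 s) (normal_prob 0 s)
  normal_product_density) => //.
exact: normal_product_densityX.
Qed.

End NormalProduct.

Section Rotation.
Context {R : realType}.
Local Notation mu := (@lebesgue_measure R).
Local Open Scope ereal_scope.
Let T2 : measurableType _ := (measurableTypeR R * measurableTypeR R)%type.

Lemma ge0_integral_rotation (c d : R) (h : T2 -> \bar R) :
  c != 0%R -> (c ^+ 2 + d ^+ 2 = 1)%R ->
  measurable_fun setT h -> (forall z, 0 <= h z) ->
  \int[mu]_x \int[mu]_y h (x, y) =
  \int[mu]_u \int[mu]_v h ((c * u - d * v)%R, (d * u + c * v)%R).
Proof.
move=> c0 cd1 mh h0.
have mh1 (k : T2 -> \bar R) y : measurable_fun setT k ->
  measurable_fun setT (fun x => k (x, y)) by move=> mk; exact: measurable_fun_pair1.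
pose k (z : T2) : T2 := (((c^-1)%R * z.1 + (- d * z.2 / c))%R, z.2).
have mk : measurable_fun setT k.
  apply: measurable_fun_pair; last exact: measurable_snd.
  apply: measurable_funD; first by apply: measurable_funM => //; exact: measurable_fst.
  apply: measurable_funM => //; apply: measurable_funM => //; exact: measurable_snd.
(* Two one-dimensional affine substitutions, x = (u - d y) / c and then
   y = c v + d u, whose Jacobians 1/c and c cancel. *)
transitivity (\int[mu]_y \int[mu]_x h (x, y)).
  exact: (@fubini_tonelli _ _ _ _ _ mu mu h mh h0).
transitivity (\int[mu]_y (`|c^-1|%:E * \int[mu]_u h (k (u, y)))).
  apply: eq_integral => y _.
  rewrite (@ge0_integral_affine _ c^-1 (- d * y / c)) ?invr_eq0//.
  exact: mh1.
have mhk : measurable_fun setT (h \o k) by exact: measurableT_comp.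
have [c1 cP] : (`|c^-1| * `|c| = 1)%R /\ (0 <= `|c^-1|)%R.
  by rewrite normfV mulVf ?normr_eq0// invr_ge0.
rewrite ge0_integralZl//; last 2 first.
- exact: (@measurable_fun_fubini_tonelli_G _ _ _ _ _ mu (h \o k) mhk (fun z => h0 (k z))).
- by move=> y _; apply: integral_ge0 => x _; exact: h0.
rewrite -(@fubini_tonelli _ _ _ _ _ mu mu (h \o k) mhk (fun z => h0 (k z))).
rewrite -ge0_integralZl//; last 2 first.
- exact: (@measurable_fun_fubini_tonelli_F _ _ _ _ _ mu (h \o k) mhk (fun z => h0 (k z))).
- by move=> y _; apply: integral_ge0 => x _; exact: h0.
apply: eq_integral => u _ /=.
rewrite (@ge0_integral_affine _ c (d * u) (fun y => h (k (u, y))))//; last first.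
  exact: (measurable_fun_pair2 u mhk).
rewrite muleA -EFinM c1 mul1e.
apply: eq_integral => v _; rewrite /k/=; congr (h (_, _)); last by ring.
apply: (mulfI c0); rewrite mulrDr mulVKf// mulrC divfK//.
by rewrite -{1}[u]mul1r -cd1; ring.
Qed.

End Rotation.

Section NormalRotation.
Context {R : realType}.
Variable s : R.
Hypothesis s0 : s != 0.
Local Notation mu := (@lebesgue_measure R).
Local Notation N := (normal_prob 0 s).
Local Notation phi := (normal_pdf 0 s).
Let T2 : measurableType _ := (measurableTypeR R * measurableTypeR R)%type.

Lemma normal_pdf_mul (x y : R) :
  phi x * phi y = normal_peak s ^+ 2 * expR (- (x ^+ 2 + y ^+ 2) / (s ^+ 2 *+ 2)).
Proof.
rewrite normal_pdfE// /normal_fun mulrACA -expRD -expr2 !subr0.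
by congr (_ * expR _); rewrite -mulrDl -opprD.
Qed.

Let measurable_pdf2 (E : set T2) : measurable E -> measurable_fun setT
  (fun z => (\1_E z * (phi z.1 * phi z.2))%:E : \bar R).
Proof.
move=> mE; apply/measurable_EFinP; apply: measurable_funM.
  exact: measurable_indic.
apply: measurable_funM; apply: measurableT_comp; try exact: measurable_normal_pdf.
  exact: measurable_fst.
exact: measurable_snd.
Qed.

Lemma measurable_rot (c d : R) (A B : set (measurableTypeR R)) :
  measurable A -> measurable B ->
  measurable [set z : T2 | A (c * z.1 + d * z.2) /\ B (- d * z.1 + c * z.2)].
Proof.
have mf (a b : R) : measurable_fun setT
    (fun z : T2 => a * z.1 + b * z.2 : measurableTypeR R).
  apply: measurable_funD; apply: measurable_funM.
  - exact: measurable_cst.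
  - exact: measurable_fst.
  - exact: measurable_cst.
  - exact: measurable_snd.
move=> mA mB.
rewrite [X in measurable X](_ : _ =
  (setT `&` (fun z : T2 => c * z.1 + d * z.2) @^-1` A) `&`
  (setT `&` (fun z : T2 => - d * z.1 + c * z.2) @^-1` B)).
  by apply: measurableI; [exact: (mf _ _ measurableT _ mA)|exact: (mf _ _ measurableT _ mB)].
by apply/seteqP; split => z /=; [move=> [] | move=> [[_ ?] [_ ?]]].
Qed.

(** The inverse rotation carries the event to a rectangle, and the joint density is a function of
    [x ^+ 2 + y ^+ 2] only. *)
Lemma normal_prod_rotation (c d : R) (A B : set (measurableTypeR R)) :
  c != 0 -> c ^+ 2 + d ^+ 2 = 1 -> measurable A -> measurable B ->
  ((N \x N) [set z : T2 | A (c * z.1 + d * z.2)%R /\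
                         B (- d * z.1 + c * z.2)%R] = N A * N B)%E.
Proof.
move=> c0 cd1 mA mB; set E := [set z | _].
have mE : measurable E by exact: measurable_rot.
rewrite (normal_productE s mE).
rewrite (ge0_integral_rotation c0 cd1 (measurable_pdf2 mE)); last first.
  by move=> z; rewrite lee_fin !mulr_ge0// normal_pdf_ge0.
rewrite -product_measure1E//.
rewrite normal_productE; last exact: measurableX.
apply: eq_integral => u _; apply: eq_integral => v _.
congr (_ * _)%:E.
  rewrite !indicE; congr ((nat_of_bool _)%:R).
  apply/idP/idP; rewrite !inE/= /E/=.
    have -> : c * (c * u - d * v) + d * (d * u + c * v) = u.
      by rewrite -[RHS]mul1r -cd1; ring.
    have -> : - d * (c * u - d * v) + c * (d * u + c * v) = v.
      by rewrite -[RHS]mul1r -cd1; ring.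
    by [].
  have -> : c * (c * u - d * v) + d * (d * u + c * v) = u.
    by rewrite -[RHS]mul1r -cd1; ring.
  have -> : - d * (c * u - d * v) + c * (d * u + c * v) = v.
    by rewrite -[RHS]mul1r -cd1; ring.
  by [].
rewrite (normal_pdf_mul (c * u - d * v)) (normal_pdf_mul u).
suff -> : (c * u - d * v) ^+ 2 + (d * u + c * v) ^+ 2 = u ^+ 2 + v ^+ 2 by [].
by rewrite -[RHS]mul1r -cd1; ring.
Qed.

End NormalRotation.

Section ChiSquare.
Context {R : realType}.
Local Notation mu := (@lebesgue_measure R).
Let T2 : measurableType _ := (measurableTypeR R * measurableTypeR R)%type.

Lemma integral_itv_mul_expR_sqr (k r : R) : 0 < k -> 0 <= r ->
  (\int[mu]_(x in `[r, +oo[) (x * expR (- (k * x ^+ 2)))%:E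
   = (expR (- (k * r ^+ 2)) / (2 * k))%:E)%E.
Proof.
move=> k0 r0.
pose F (x : R) := - (expR (- (k * x ^+ 2)) / (2 * k)).
have dF (x : R) : is_derive x 1 F (x * expR (- (k * x ^+ 2))).
  apply: is_derive_eq; rewrite !scaler0 /GRing.scale/=.
  by field; rewrite gt_eqF.
rewrite (@ge0_continuous_FTC2y R _ F r 0).
- by rewrite sub0e -EFinN opprK.
- by move=> x rx; rewrite mulr_ge0 ?expR_ge0// (le_trans r0).
- apply: continuous_subspaceT => x.
  apply: cvgM; first exact: cvg_id.
  apply: continuous_comp; last exact: continuous_expR.
  apply: cvgN; apply: cvgM; first exact: cvg_cst.
  exact: exprn_continuous.
- rewrite -[X in _ --> X]oppr0; apply: cvgN.
  rewrite -[X in _ --> X](mul0r (2 * k)^-1); apply: cvgM; last exact: cvg_cst.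
  apply: (@cvg_comp _ _ _ (fun x : R => k * x ^+ 2) (fun y => expR (- y)) _ +oo%R).
    apply/gt0_cvgMry => //; exact: cvgr_expr2.
  exact: cvgr_expR.
- by move=> x _; exact: ex_derive.
- apply: cvg_at_right_filter; apply: differentiable_continuous.
  by apply/derivable1_diffP; exact: ex_derive.
- by move=> x _; rewrite derive1E derive_val.
Qed.


(** The factor |x| is the Jacobian of [y = x * v]. For [k = kap v] the Gaussian exponent at
    [(x, x * v)] is [- (k * x ^+ 2)], and the last factor says that this point is not inside the
    disc. *)
Let radial (k t x : R) : R := `|x| * expR (- (k * x ^+ 2)) * (t <= k * x ^+ 2)%R%:R.

Let radial_ge0 k t x : 0 <= radial k t x.
Proof. by rewrite !mulr_ge0// expR_ge0. Qed.

Let measurable_sqr_le d (T : measurableType d) (t : R) (f : T -> R) :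
  measurable_fun setT f -> measurable_fun setT (fun x => (t <= f x)%R%:R : R).
Proof.
move=> mf; have mE : measurable [set x | t <= f x].
  rewrite [X in measurable X](_ : _ = setT `&` f @^-1` `[t, +oo[); first exact: mf.
  by apply/seteqP; split => x /=; rewrite in_itv/= andbT; [split|case].
have := measurable_indic (R := R) (D := setT) mE.
apply: eq_measurable_fun => x _; rewrite indicE; congr ((nat_of_bool _)%:R).
by apply/idP/idP; rewrite inE.
Qed.

Let measurable_radial k t : measurable_fun setT (radial k t).
Proof.
have m2 : measurable_fun setT (fun x : R => k * x ^+ 2).
  by apply: measurable_funM.
apply: measurable_funM; last exact: (measurable_sqr_le _ m2).
apply: measurable_funM; first exact: normr_measurable.
apply: measurableT_comp; first exact: measurable_expR.
exact: measurableT_comp.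
Qed.

Lemma integral_radial (k t : R) : 0 < k -> 0 <= t ->
  (\int[mu]_x (radial k t x)%:E = (expR (- t) / k)%:E)%E.
Proof.
move=> k0 t0.
pose g (x : R) := radial k t x * (0 < x)%R%:R.
have mlt : measurable_fun setT (fun x : R => (0 < x)%R%:R : R).
  have mI : measurable (`]0, +oo[%classic : set R) by exact: measurable_itv.
  have := measurable_indic (R := R) (D := setT) mI.
  apply: eq_measurable_fun => x _; rewrite indicE; congr ((nat_of_bool _)%:R).
  by apply/idP/idP; rewrite inE/= in_itv/= andbT.
have mg : measurable_fun setT g by apply: measurable_funM.
have g0 x : 0 <= g x by rewrite mulr_ge0.
have gE : (\int[mu]_x (g x)%:E = (expR (- t) / (2 * k))%:E)%E.
  have r0 : 0 <= Num.sqrt (t / k) by exact: sqrtr_ge0.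
  have kr : k * Num.sqrt (t / k) ^+ 2 = t.
    by rewrite sqr_sqrtr ?divr_ge0// ?ltW// mulrC divfK// gt_eqF.
  rewrite -[in RHS]kr -integral_itv_mul_expR_sqr// [RHS]integral_mkcond.
  apply: eq_integral => x _; rewrite patchE.
  have -> : (x \in `[Num.sqrt (t / k), +oo[%classic) = (Num.sqrt (t / k) <= x).
    by apply/idP/idP; rewrite inE/= in_itv/= andbT.
  rewrite /g /radial.
  have [x0|x0] := ltP 0 x; last first.
    rewrite mulr0; case: ifPn => // rx.
    suff -> : x = 0 by rewrite mul0r.
    by apply/eqP; rewrite eq_le x0 (le_trans r0 rx).
  rewrite gtr0_norm// mulr1.
  have -> : (Num.sqrt (t / k) <= x) = (t <= k * x ^+ 2).
    by rewrite -{1}[x]gtr0_norm// -sqrtr_sqr ler_sqrt ?sqr_ge0// ler_pdivrMr// mulrC.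
  by case: ifPn; rewrite ?mulr1 ?mulr0.
transitivity (\int[mu]_x ((g x)%:E + (g (- x))%:E))%E.
  apply: eq_integral => x _; rewrite -EFinD /g; congr EFin.
  have -> : radial k t (- x) = radial k t x by rewrite /radial normrN sqrrN.
  rewrite oppr_gt0; have [x0|x0|<-] := ltgtP 0 x; last by rewrite /radial normr0 !mul0r addr0.
  - by rewrite mulr1 mulr0 addr0.
  - by rewrite mulr1 mulr0 add0r.
rewrite ge0_integralD//; last 4 first.
- by move=> x _; rewrite lee_fin.
- exact/measurable_EFinP.
- by move=> x _; rewrite lee_fin.
- by apply/measurable_EFinP; apply: measurableT_comp => //; exact: mg.
have -> : (\int[mu]_x (g (- x))%:E = \int[mu]_x (g x)%:E)%E.
  rewrite (@ge0_integral_affine _ (-1) 0 (fun x => (g x)%:E)) ?oppr_eq0 ?oner_eq0//; last first.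
    exact/measurable_EFinP.
  rewrite normrN1 mul1e; apply: eq_integral => x _; congr (g _)%:E; ring.
by rewrite gE -EFinD; congr EFin; field; rewrite gt_eqF.
Qed.

Variable s : R.
Hypothesis s0 : s != 0.
Local Notation N := (normal_prob 0 s).
Local Notation phi := (normal_pdf 0 s).

Let s2 : 0 < s ^+ 2 *+ 2.
Proof. by rewrite pmulrn_lgt0// exprn_even_gt0. Qed.

Let kap (v : R) := (1 + v ^+ 2) / (s ^+ 2 *+ 2).

Let kap0 v : 0 < kap v.
Proof. by rewrite divr_gt0// ltr_pwDl// sqr_ge0. Qed.

Let msum : measurable_fun setT (fun z : T2 => z.1 ^+ 2 + z.2 ^+ 2 : R).
Proof.
apply: measurable_funD; apply: measurable_funX.
  exact: measurable_fst.
exact: measurable_snd.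
Qed.

Lemma measurable_radius_ge (r : R) :
  measurable [set z : T2 | r <= z.1 ^+ 2 + z.2 ^+ 2].
Proof.
rewrite [X in measurable X](_ : _ = setT `&` (fun z : T2 => z.1 ^+ 2 + z.2 ^+ 2) @^-1` `[r, +oo[).
  exact: msum.
by apply/seteqP; split => x /=; rewrite in_itv/= andbT; [split|case].
Qed.

(* The substitution y = x v turns the integral over y into an integral over the
   slopes v, after which the integral over x is elementary; the remaining
   constant is fixed by the total mass, without polar coordinates. *)
Let normal_prod_radius_ge_aux (r : R) : 0 <= r ->
  ((N \x N) [set z : T2 | (r <= z.1 ^+ 2 + z.2 ^+ 2)%R] =
  (expR (- (r / (s ^+ 2 *+ 2))))%:E
   * \int[mu]_v (normal_peak s ^+ 2 / kap v)%:E)%E.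
Proof.
move=> r0; rewrite (normal_productE s (measurable_radius_ge r)).
set E := [set z | _].
have phiE x v : `|x| * (\1_E (x, x * v) * (phi x * phi (x * v))) =
    normal_peak s ^+ 2 * radial (kap v) (r / (s ^+ 2 *+ 2)) x.
  rewrite normal_pdf_mul// /radial indicE.
  have -> : ((x, x * v) \in E) = (r / (s ^+ 2 *+ 2) <= kap v * x ^+ 2).
    rewrite /kap mulrAC ler_pM2r ?invr_gt0//.
    have -> : (1 + v ^+ 2) * x ^+ 2 = x ^+ 2 + (x * v) ^+ 2 by ring.
    by apply/idP/idP; rewrite inE.
  have -> : - (x ^+ 2 + (x * v) ^+ 2) / (s ^+ 2 *+ 2) = - (kap v * x ^+ 2).
    by rewrite /kap mulrAC mulNr; congr (- (_ / _)); ring.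
  by ring.
have mE := measurable_radius_ge r.
have mh : measurable_fun setT
    (fun z : T2 => (\1_E z * (phi z.1 * phi z.2))%:E : \bar R).
  apply/measurable_EFinP; apply: measurable_funM; first exact: measurable_indic.
  apply: measurable_funM; apply: measurableT_comp; try exact: measurable_normal_pdf.
    exact: measurable_fst.
  exact: measurable_snd.
have phi0 x y : 0 <= \1_E (x, y) * (phi x * phi y).
  by rewrite !mulr_ge0// normal_pdf_ge0.
pose k (z : T2) : T2 := (z.1, z.1 * z.2).
have mk : measurable_fun setT k.
  apply: measurable_fun_pair; first exact: measurable_fst.
  apply: measurable_funM; first exact: measurable_fst.
  exact: measurable_snd.
pose h (z : T2) : \bar R := (`|z.1| * (\1_E (k z) * (phi (k z).1 * phi (k z).2)))%:E.
have mhk : measurable_fun setT h.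
  apply/measurable_EFinP; apply: measurable_funM.
    by apply: measurableT_comp => //; exact: measurable_fst.
  by apply/measurable_EFinP; exact: (measurableT_comp mh mk).
have h0 z : (0 <= h z)%E by rewrite lee_fin mulr_ge0//; exact: phi0.
transitivity (\int[mu]_x \int[mu]_v h (x, v))%E.
  apply: ae_eq_integral => //.
  - exact: (@measurable_fun_fubini_tonelli_F _ _ _ _ _ mu _ mh (fun z => phi0 z.1 z.2)).
  - exact: (@measurable_fun_fubini_tonelli_F _ _ _ _ _ mu _ mhk h0).
  (* [y = x * v] is no substitution at [x = 0], a null set. *)
  exists [set 0]; split => //; first exact: lebesgue_measure_set1.
  move=> x /=; apply: contra_notP => /eqP x0 _.
  pose f (y : measurableTypeR R) := (\1_E (x, y) * (phi x * phi y))%:E.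
  have mf : measurable_fun setT f by exact: (measurable_fun_pair2 x mh).
  have f0 y : (0 <= f y)%E by rewrite lee_fin.
  have maff : measurable_fun setT
      (fun v : measurableTypeR R => x * v + 0 : measurableTypeR R).
    by apply: measurable_funD; [exact: measurable_funM|exact: measurable_cst].
  rewrite -[LHS]/(\int[mu]_y f y)%E (ge0_integral_affine 0 x0 mf f0).
  transitivity (\int[mu]_v (`|x|%:E * f (x * v + 0)%R))%E; last first.
    by apply: eq_integral => v _; rewrite addr0.
  apply/esym/ge0_integralZl => //; exact: (measurableT_comp mf maff).
rewrite (@fubini_tonelli _ _ _ _ _ mu mu h mhk h0).
have kinv : measurable_fun setT (fun v => (normal_peak s ^+ 2 / kap v)%:E : \bar R).
  apply/measurable_EFinP; apply: continuous_measurable_fun => v.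
  apply: cvgM; first exact: cvg_cst.
  apply: cvgV; first by rewrite gt_eqF.
  apply: cvgM; last exact: cvg_cst.
  by apply: cvgD; [exact: cvg_cst|exact: exprn_continuous].
rewrite -ge0_integralZl//; last first.
  by move=> v _; rewrite lee_fin divr_ge0 ?sqr_ge0// ltW.
apply: eq_integral => v _; rewrite /h/=.
transitivity (\int[mu]_x ((normal_peak s ^+ 2)%:E * (radial (kap v) (r / (s ^+ 2 *+ 2)) x)%:E))%E.
  by apply: eq_integral => x _; rewrite phiE EFinM.
rewrite ge0_integralZl//; last 3 first.
- apply/measurable_EFinP; exact: measurable_radial.
- by move=> x _; rewrite lee_fin.
- by rewrite lee_fin sqr_ge0.
rewrite integral_radial// ?divr_ge0// ?(ltW s2)//.
by rewrite -!EFinM; congr EFin; ring.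
Qed.

Lemma normal_prod_radius_ge (r : R) : 0 <= r ->
  ((N \x N) [set z : T2 | (r <= z.1 ^+ 2 + z.2 ^+ 2)%R] =
  (expR (- (r / (s ^+ 2 *+ 2))))%:E)%E.
Proof.
move=> r0; rewrite normal_prod_radius_ge_aux//.
have := normal_prod_radius_ge_aux (lexx 0).
rewrite mul0r oppr0 expR0 mul1e => <-.
rewrite (_ : [set z | _] = setT `*` setT); last first.
  by apply/seteqP; split => z //= _; rewrite addr_ge0// sqr_ge0.
have N1 : N [set: R] = 1%E by exact: probability_setT.
have -> : ((N \x N) ([set: R] `*` [set: R]) = 1)%E.
  by rewrite product_measure1E// -[1%E]mule1; congr (_ * _)%E.
by rewrite mule1.
Qed.

End ChiSquare.

(** * Linear functionals of independent Gaussian variables *)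

Section GaussFamily.
Context {R : realType} {n : nat} {d : measure_display} {T : measurableType d}.
Variables (P : probability T R) (s : R).
Local Notation N := (normal_prob 0 s).
Let T2 : measurableType _ := (measurableTypeR R * measurableTypeR R)%type.

(** The property of [gaussian_noise] for bare families of coordinates, a form that is stable under
    recombining the coordinates. *)
Definition gauss_family (Z : 'I_n -> T -> R) : Prop :=
  (forall i, measurable_fun setT (Z i)) /\
  (forall B : 'I_n -> set R, (forall i, measurable (B i)) ->
     P [set w | forall i, B i (Z i w)] = (\prod_(i < n) N (B i))%E).

Lemma measurable_family_rectangle (Z : 'I_n -> T -> R) (p : pred 'I_n)
    (B : 'I_n -> set R) :
  (forall i, measurable_fun setT (Z i)) -> (forall i, measurable (B i)) ->
  measurable [set w | forall i, p i -> B i (Z i w)].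
Proof.
move=> mZ mB.
rewrite [X in measurable X](_ : _ =
  \big[setI/setT]_(i < n | p i) (setT `&` Z i @^-1` B i)).
  by apply: bigsetI_measurable => i _; apply: mZ.
rewrite -bigcap_seq_cond; apply/seteqP; split => w /=.
  by move=> h k /= /andP[_ /h].
by move=> h k pk; have [] := h k; rewrite //= mem_index_enum.
Qed.

(** A rotation of two coordinates destroys product sets, so the pair must be handled on all planar
    Borel sets. Restricting to the event on the other coordinates and dividing by its probability
    gives a measure that agrees with [N \x N] on rectangles, hence everywhere. *)
Lemma gauss_family_pair (Z : 'I_n -> T -> R) (i j : 'I_n) (B : 'I_n -> set R)
    (E : set T2) : i != j -> gauss_family Z ->
  (forall k, measurable (B k)) -> measurable E ->
  (P [set w | (forall k, (k != i) && (k != j) -> B k (Z k w)) /\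
             E (Z i w, Z j w)] =
  (\prod_(k < n | (k != i) && (k != j)) N (B k)) * (N \x N) E)%E.
Proof.
move=> ij [mZ ZN] mB mE.
pose O := [set w | forall k, (k != i) && (k != j) -> B k (Z k w)].
have mO : measurable O by exact: measurable_family_rectangle.
pose pair (w : T) : T2 := (Z i w, Z j w).
have mpair : measurable_fun setT pair.
  by apply: measurable_fun_pair; exact: mZ.
pose kap : \bar R := (\prod_(k < n | (k != i) && (k != j)) N (B k))%E.
have kap0 : (0 <= kap)%E by apply: prode_ge0 => k _; exact: measure_ge0.
have kap_fin : kap \is a fin_num.
  apply: prode_fin_num => k _; apply: fin_num_measure; exact: mB.
have rectE C D : measurable C -> measurable D ->
    (P (O `&` pair @^-1` (C `*` D)) = kap * (N C * N D))%E.
  move=> mC mD.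
  pose B' k := if k == i then C else if k == j then D else B k.
  have mB' k : measurable (B' k).
    rewrite /B'; case: ifP => _; first exact: mC.
    by case: ifP => _; [exact: mD|exact: mB].
  have := ZN B' mB'.
  rewrite (bigD1 i)//= (bigD1 j)/=; last by rewrite eq_sym.
  have -> : B' i = C by rewrite /B' eqxx.
  have -> : B' j = D by rewrite /B' eq_sym (negbTE ij) eqxx.
  rewrite (eq_bigr (fun k => N (B k))); last first.
    by move=> k /andP[ki kj]; rewrite /B' (negbTE ki) (negbTE kj).
  rewrite -/kap => h; rewrite [RHS]muleC -[RHS]muleA -h; congr (P _); apply/seteqP; split => w /=.
    move=> [Ow [Cw Dw]] k; rewrite /B'; case: eqP => [->//|/eqP ki].
    by case: eqP => [->//|/eqP kj]; apply: Ow; rewrite ki.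
  move=> h'; split.
    by move=> k /andP[ki kj]; have := h' k; rewrite /B' (negbTE ki) (negbTE kj).
  have := h' i; have := h' j; rewrite /B' !eqxx eq_sym (negbTE ij).
  by [].
rewrite [X in P X](_ : _ = O `&` pair @^-1` E)// -/kap.
(* When the event on the other coordinates has probability 0 there is nothing to divide by, and both
   sides vanish. *)
have [k0|kn0] := eqVneq kap 0.
  rewrite k0 mul0e; apply/eqP; rewrite eq_le measure_ge0 andbT.
  rewrite -(mul0e (N setT * N setT)) -k0 -rectE//; apply: le_measure.
  - by rewrite inE; apply: measurableI => //; rewrite -[X in measurable X]setTI; exact: mpair.
  - by rewrite inE; apply: measurableI => //; rewrite -[X in measurable X]setTI;
    apply: mpair => //; exact: measurableX.
  - by move=> w [].
have kpos : 0 < fine kap by rewrite fine_gt0// lt0e kn0 kap0 ltey_eq kap_fin.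
have kinv0 : 0 <= (fine kap)^-1 by rewrite invr_ge0 ltW.
pose m' := mscale (NngNum kinv0) (pushforward (mrestr P mO) pair).
have m'E F : (m' mpair F = (fine kap)^-1%:E * P (O `&` pair @^-1` F))%E.
  by rewrite /m' /mscale/= /pushforward /mrestr setIC.
have kk : ((fine kap)^-1%:E * kap = 1)%E.
  by rewrite -{2}(fineK kap_fin) -EFinM mulVf// gt_eqF.
have -> : ((N \x N) E = m' mpair E)%E.
  apply: product_measure_unique => // C D mC mD.
  by rewrite [LHS]m'E rectE// muleA kk mul1e.
by rewrite m'E muleA (muleC kap) kk mul1e.
Qed.

End GaussFamily.

Section Givens.
Context {R : realType} {n : nat}.
Implicit Types (x y : 'I_n -> R) (S : {set 'I_n}).

Definition dotf x y : R := \sum_k x k * y k.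

Definition givens (c e : R) (i j : 'I_n) x (k : 'I_n) : R :=
  if k == i then c * x i + e * x j
  else if k == j then - e * x i + c * x j else x k.

Lemma dotf_givens c e i j x y : i != j -> c ^+ 2 + e ^+ 2 = 1 ->
  dotf (givens c e i j x) (givens c e i j y) = dotf x y.
Proof.
move=> ij ce1; rewrite /dotf.
rewrite (bigD1 i)//= (bigD1 j)/=; last by rewrite eq_sym.
rewrite [RHS](bigD1 i)//= [in RHS](bigD1 j)/=; last by rewrite eq_sym.
rewrite /givens !eqxx (eq_sym j) (negbTE ij) !addrA; congr (_ + _).
  transitivity ((c ^+ 2 + e ^+ 2) * (x i * y i + x j * y j)); first by ring.
  by rewrite ce1 mul1r.
by apply: eq_bigr => k /andP[/negbTE -> /negbTE ->].
Qed.

End Givens.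

Section GaussRotation.
Context {R : realType} {n : nat} {d : measure_display} {T : measurableType d}.
Variables (P : probability T R) (s : R).
Hypothesis s0 : s != 0.
Local Notation N := (normal_prob 0 s).
Implicit Types (Z : 'I_n -> T -> R).

Let gauss_givens_neq0 Z i j c e : i != j -> c != 0 -> c ^+ 2 + e ^+ 2 = 1 ->
  gauss_family P s Z ->
  gauss_family P s (fun k w => givens c e i j (Z^~ w) k).
Proof.
move=> ij c0 ce1 gZ; have [mZ _] := gZ; split.
  move=> k; rewrite /givens; case: eqP => _; last case: eqP => _; last exact: mZ.
    by apply: measurable_funD; apply: measurable_funM.
  by apply: measurable_funD; apply: measurable_funM.
move=> B mB.
pose E := [set z : R * R | B i (c * z.1 + e * z.2) /\ B j (- e * z.1 + c * z.2)].
rewrite [X in P X](_ : _ = [set w | (forall k, (k != i) && (k != j) -> B k (Z k w)) /\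
             E (Z i w, Z j w)]).
  rewrite (gauss_family_pair (s := s))//; last by apply: measurable_rot; exact: mB.
  rewrite [X in (_ * X)%E](normal_prod_rotation s0 c0 ce1 (mB i) (mB j)).
  rewrite [RHS](bigD1 i)//= [in RHS](bigD1 j)/=; last by rewrite eq_sym.
  by rewrite muleA [RHS]muleC.
apply/seteqP; split => w /=.
  move=> h; split.
    by move=> k /andP[/negbTE ki /negbTE kj]; have := h k; rewrite /givens ki kj.
  have := h i; have := h j; rewrite /givens !eqxx (eq_sym j) (negbTE ij).
  by [].
move=> [h [hi hj]] k; rewrite /givens; case: eqP => [->//|/eqP ki].
by case: eqP => [->//|/eqP kj]; apply: h; rewrite ki.
Qed.

Lemma gauss_givens Z i j c e : i != j -> c ^+ 2 + e ^+ 2 = 1 ->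
  gauss_family P s Z ->
  gauss_family P s (fun k w => givens c e i j (Z^~ w) k).
Proof.
move=> ij ce1 gZ; have [c0|] := eqVneq c 0; last by move=> *; exact: gauss_givens_neq0.
(* A quarter turn is obtained as the square of an eighth of a turn. *)
pose h : R := Num.sqrt (1 / 2).
have h2 : h * h = 1 / 2 by rewrite -expr2 sqr_sqrtr ?divr_ge0.
have h0 : h != 0.
  by apply/eqP => h0; move: h2; rewrite h0 mulr0 => /esym/eqP;
    rewrite mulf_eq0 oner_eq0 invr_eq0 pnatr_eq0.
have e1 : e * e = 1 by move: ce1; rewrite c0 expr0n add0r expr2.
have h1 : h ^+ 2 + (e * h) ^+ 2 = 1.
  transitivity (h * h * (1 + e * e)); first by ring.
  by rewrite h2 e1; field.
have := gauss_givens_neq0 ij h0 h1 (gauss_givens_neq0 ij h0 h1 gZ).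
congr (gauss_family P s _); apply/funext => k; apply/funext => w.
rewrite /givens !eqxx (eq_sym j) (negbTE ij); case: eqP => _; last case: eqP => _ //.
  transitivity (h * h * (1 - e * e) * Z i w + 2 * (h * h) * e * Z j w); first by ring.
  by rewrite h2 e1 c0; field.
transitivity (h * h * (1 - e * e) * Z j w - 2 * (h * h) * e * Z i w); first by ring.
by rewrite h2 e1 c0; field.
Qed.

(* Orthogonal maps of R^n under which the Gaussian law is invariant and which
   only mix the coordinates in S. *)
Definition gauss_isometry (S : {set 'I_n}) (f : ('I_n -> R) -> ('I_n -> R)) :=
  [/\ forall x y, dotf (f x) (f y) = dotf x y,
      forall Z, gauss_family P s Z -> gauss_family P s (fun k w => f (Z^~ w) k),
      forall x k, k \notin S -> f x k = x k &
      forall x, (forall k, k \in S -> x k = 0) -> forall k, k \in S -> f x k = 0].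

(** One column of a QR factorisation: Givens rotations in the planes [(i, j)] collect the entries
    [j] of [a] in position [i] one after the other. The map is thus a product of planar rotations,
    and invariance of the law reduces to the planar case. *)
Lemma gauss_isometry_kill (a : 'I_n -> R) (S : {set 'I_n}) (i : 'I_n) :
  i \in S -> exists2 f, gauss_isometry S f &
    forall k, k \in S -> k != i -> f a k = 0.
Proof.
move=> iS.
suff H (l : seq 'I_n) : {subset l <= S} -> exists2 f, gauss_isometry S f &
    forall k, k \in l -> k != i -> f a k = 0.
  have [|f fS fa] := H (enum S); first by move=> k; rewrite mem_enum.
  by exists f => // k kS ki; apply: fa; rewrite ?mem_enum.
elim: l => [|j l IH] lS.
  by exists id.
have [|f [f1 f2 f3 f4] fl] := IH; first by move=> k kl; apply: lS; rewrite inE kl orbT.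
have jS : j \in S by apply: lS; rewrite inE eqxx.
have [ji|ij] := eqVneq j i.
  exists f => // k; rewrite inE => /orP[/eqP ->|]; first by rewrite ji eqxx.
  exact: fl.
pose r := Num.sqrt (f a i ^+ 2 + f a j ^+ 2).
have r2 : r ^+ 2 = f a i ^+ 2 + f a j ^+ 2.
  by rewrite sqr_sqrtr// addr_ge0// sqr_ge0.
have [c [e [ce1 ceE]]] : exists c e : R, c ^+ 2 + e ^+ 2 = 1 /\
    - e * f a i + c * f a j = 0.
  have [r0|r0] := eqVneq r 0.
    exists 1, 0; split; first by rewrite expr1n expr0n addr0.
    move: r2; rewrite r0 expr0n => /esym/eqP.
    rewrite paddr_eq0 ?sqr_ge0// !sqrf_eq0 => /andP[/eqP -> /eqP ->].
    by rewrite !mulr0 addr0.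
  exists (f a i / r), (f a j / r); split; last by ring.
  by rewrite !expr_div_n -mulrDl -r2 divff// expf_neq0.
have ij' : i != j by rewrite eq_sym.
exists (fun x => givens c e i j (f x)).
  split.
  - by move=> x y; rewrite dotf_givens.
  - by move=> Z gZ; apply: (gauss_givens ij' ce1) (f2 _ gZ).
  - move=> x k kS; rewrite /givens.
    case: eqP kS => [->|_ kS]; first by rewrite iS.
    by case: eqP kS => [->|_ kS]; [rewrite jS|exact: f3].
  - move=> x x0 k kS; rewrite /givens !f4// !mulr0 addr0.
    by case: ifP => // _; case: ifP.
move=> k; rewrite inE => kl ki; rewrite /givens (negbTE ki).
case: eqP => // /eqP kj; apply: fl => //.
by move: kl; rewrite (negbTE kj).
Qed.

End GaussRotation.

Section GaussTails.
Context {R : realType} {n : nat} {d : measure_display} {T : measurableType d}.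
Variables (P : probability T R) (s : R).
Hypothesis s0 : s != 0.
Local Notation N := (normal_prob 0 s).
Let T2 : measurableType _ := (measurableTypeR R * measurableTypeR R)%type.
Implicit Types (Z : 'I_n -> T -> R) (a b : 'I_n -> R).

Lemma measurable_dotf Z a : gauss_family P s Z ->
  measurable_fun setT (fun w => dotf a (Z^~ w)).
Proof.
move=> [mZ _]; apply: measurable_sum => k.
by apply: measurable_funM.
Qed.

Let dotf_single i a (z : 'I_n -> R) : (forall k, k != i -> a k = 0) ->
  dotf a z = a i * z i.
Proof.
move=> ai; rewrite /dotf (bigD1 i)//= big1 ?addr0// => k ki.
by rewrite ai// mul0r.
Qed.

Let dotf_exists a : 0 < dotf a a -> exists i, a i != 0.
Proof.
move=> a0; apply/existsP; apply: contraTT isT => /existsPn a00.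
have a0' : dotf a a = 0; last by rewrite a0' ltxx in a0.
by apply: big1 => k _; have := a00 k; rewrite negbK => /eqP ->; rewrite mul0r.
Qed.

Lemma gauss_pair_radius Z i j (r : R) : i != j -> 0 <= r -> gauss_family P s Z ->
  P [set w | r <= Z i w ^+ 2 + Z j w ^+ 2] = (expR (- (r / (s ^+ 2 *+ 2))))%:E.
Proof.
move=> ij r0 gZ.
have := gauss_family_pair (B := fun=> setT) ij gZ (fun=> measurableT)
  (measurable_radius_ge r).
rewrite normal_prod_radius_ge// big1; last first.
  by move=> k _; exact: (@probability_setT _ _ _ (normal_prob 0 s)).
rewrite mul1e => <-; congr (P _).
by apply/seteqP; split => w //= [].
Qed.

Lemma gauss_marginal Z i (A : set R) : measurable A -> gauss_family P s Z ->
  P [set w | A (Z i w)] = N A.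
Proof.
move=> mA [_ ZN].
have := ZN (fun k => if k == i then A else setT) _.
rewrite (bigD1 i)//= eqxx big1 ?mule1; last first.
  by move=> k /negbTE ->; exact: (@probability_setT _ _ _ (normal_prob 0 s)).
move=> <-; last by move=> k; case: ifP.
congr (P _); apply/seteqP; split => w /=.
  by move=> Aw k; case: eqP => // ->.
by move=> /(_ i); rewrite eqxx.
Qed.

(** An isometry moves [a] to an axis; orthogonality then clears that entry of [b], so a second
    isometry, acting on the other coordinates only, moves [b] to another axis without disturbing
    [a]. The event then lies in the one where two independent coordinates have squared radius at
    least [r]. *)
Lemma gauss_orthogonal_tail Z a b (r : R) : gauss_family P s Z -> 0 <= r ->
  0 < dotf a a -> 0 < dotf b b -> dotf a b = 0 ->
  (P [set w | (r * dotf a a * dotf b b <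
              dotf a (Z^~ w) ^+ 2 * dotf b b + dotf b (Z^~ w) ^+ 2 * dotf a a)%R]
    <= (expR (- (r / (s ^+ 2 *+ 2))))%:E)%E.
Proof.
move=> gZ r0 aa bb ab.
have [i0 _] := dotf_exists aa.
have [f [f1 f2 f3 f4] fa] := gauss_isometry_kill P s0 a (finset.in_setT i0).
have fa0 k : k != i0 -> f a k = 0 by apply: fa; rewrite finset.in_setT.
have faa : dotf a a = f a i0 ^+ 2 by rewrite -f1 (dotf_single _ fa0).
have fai0 : f a i0 != 0 by apply/eqP => h; rewrite faa h expr0n ltxx in aa.
have fbi0 : f b i0 = 0.
  move: ab; rewrite -f1 (dotf_single _ fa0) => /eqP; rewrite mulf_eq0 (negbTE fai0).
  by move=> /eqP.
have [i1 fbi1] : exists i, f b i != 0 by apply: dotf_exists; rewrite f1.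
have i10 : i1 != i0 by apply/eqP => h; rewrite h fbi0 eqxx in fbi1.
have i1S : i1 \in ~: [set i0] by rewrite !inE.
have [g [g1 g2 g3 g4] ga] := gauss_isometry_kill P s0 (f b) i1S.
pose h x := g (f x).
have ha0 k : k != i0 -> h a k = 0.
  move=> ki0; apply: g4; last by rewrite !inE.
  by move=> k'; rewrite !inE => /fa0.
have hb0 k : k != i1 -> h b k = 0.
  move=> ki1; have [->|ki0] := eqVneq k i0; last by apply: ga; rewrite ?inE.
  by rewrite /h g3 ?inE ?eqxx.
have h1 x y : dotf (h x) (h y) = dotf x y by rewrite g1 f1.
pose Z' k w := h (Z^~ w) k.
have gZ' : gauss_family P s Z' by exact: (g2 _ (f2 _ gZ)).
have aE w : dotf a (Z^~ w) = h a i0 * Z' i0 w.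
  by rewrite -h1 (dotf_single _ ha0).
have bE w : dotf b (Z^~ w) = h b i1 * Z' i1 w.
  by rewrite -h1 (dotf_single _ hb0).
have aaE : dotf a a = h a i0 ^+ 2 by rewrite -h1 (dotf_single _ ha0).
have bbE : dotf b b = h b i1 ^+ 2 by rewrite -h1 (dotf_single _ hb0).
have mS (u v : R) : measurable_fun setT
    (fun w => dotf a (Z^~ w) ^+ 2 * u + dotf b (Z^~ w) ^+ 2 * v).
  by apply: measurable_funD; apply: measurable_funM => //;
    apply: measurable_funX; exact: measurable_dotf.
rewrite -(gauss_pair_radius i10 r0 gZ'); apply: le_measure.
- rewrite inE [X in measurable X](_ : _ = setT `&`
    (fun w => dotf a (Z^~ w) ^+ 2 * dotf b b + dotf b (Z^~ w) ^+ 2 * dotf a a) @^-1`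
    `]r * dotf a a * dotf b b, +oo[); first exact: mS.
  by apply/seteqP; split => w /=; rewrite in_itv/= andbT; [split|case].
- rewrite inE [X in measurable X](_ : _ = setT `&`
    (fun w => Z' i1 w ^+ 2 + Z' i0 w ^+ 2) @^-1` `[r, +oo[).
    have [mZ' _] := gZ'.
    have mS2 : measurable_fun setT (fun w => Z' i1 w ^+ 2 + Z' i0 w ^+ 2).
      by apply: measurable_funD; apply: measurable_funX.
    exact: mS2.
  by apply/seteqP; split => w /=; rewrite in_itv/= andbT; [split|case].
- move=> w /=; rewrite aE bE aaE bbE => /ltW; rewrite !exprMn.
  have -> : h a i0 ^+ 2 * Z' i0 w ^+ 2 * h b i1 ^+ 2 +
     h b i1 ^+ 2 * Z' i1 w ^+ 2 * h a i0 ^+ 2 =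
     (Z' i1 w ^+ 2 + Z' i0 w ^+ 2) * (h a i0 ^+ 2 * h b i1 ^+ 2) by ring.
  by rewrite -mulrA ler_pM2r// -aaE -bbE mulr_gt0.
Qed.

(** Adding the square of an independent copy enlarges the event to the planar one, whose probability
    is exact. *)
Let normal_sqr_tail (r : R) : 0 <= r ->
  (N [set x | (r < x ^+ 2)%R] <= (expR (- (r / (s ^+ 2 *+ 2))))%:E)%E.
Proof.
move=> r0; rewrite -normal_prod_radius_ge//.
have mA : measurable [set x : R | r < x ^+ 2].
  rewrite [X in measurable X](_ : _ = setT `&` (fun x : R => x ^+ 2) @^-1` `]r, +oo[).
    exact: exprn_measurable.
  by apply/seteqP; split => w /=; rewrite in_itv/= andbT; [split|case].
have <- : ((N \x N) ([set x : R | (r < x ^+ 2)%R] `*` [set: R]) =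
    N [set x : R | (r < x ^+ 2)%R])%E.
  rewrite product_measure1E// -[RHS]mule1; congr (_ * _)%E.
  exact: (@probability_setT _ _ _ (normal_prob 0 s)).
apply: le_measure.
- by rewrite inE; apply: measurableX.
- by rewrite inE; exact: measurable_radius_ge.
by move=> z [/= /ltW h _]; rewrite (le_trans h)// lerDl sqr_ge0.
Qed.

Let gauss_single_reduce Z a : gauss_family P s Z -> 0 < dotf a a ->
  exists2 Z' : 'I_n -> T -> R, gauss_family P s Z' & exists i c,
    c ^+ 2 = dotf a a /\ forall w, dotf a (Z^~ w) = c * Z' i w.
Proof.
move=> gZ aa; have [i0 _] := dotf_exists aa.
have [f [f1 f2 f3 f4] fa] := gauss_isometry_kill P s0 a (finset.in_setT i0).
have fa0 k : k != i0 -> f a k = 0 by apply: fa; rewrite finset.in_setT.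
exists (fun k w => f (Z^~ w) k); first exact: f2.
exists i0, (f a i0); split; first by rewrite -f1 (dotf_single _ fa0).
by move=> w; rewrite -f1 (dotf_single _ fa0).
Qed.

Lemma gauss_linear_tail Z a (r : R) : gauss_family P s Z -> 0 <= r ->
  0 < dotf a a ->
  (P [set w | (r * dotf a a < dotf a (Z^~ w) ^+ 2)%R]
    <= (expR (- (r / (s ^+ 2 *+ 2))))%:E)%E.
Proof.
move=> gZ r0 aa; have [Z' gZ' [i [c [cE aE]]]] := gauss_single_reduce gZ aa.
apply: le_trans (normal_sqr_tail r0).
rewrite -(gauss_marginal i _ gZ'); last first.
  rewrite [X in measurable X](_ : _ = setT `&` (fun x : R => x ^+ 2) @^-1` `]r, +oo[).
    exact: exprn_measurable.
  by apply/seteqP; split => w /=; rewrite in_itv/= andbT; [split|case].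
rewrite le_eqVlt; apply/orP; left; apply/eqP; congr (P _).
apply/seteqP; split => w /=; by rewrite aE exprMn cE mulrC ltr_pM2l.
Qed.

Let normalN (A : set R) : measurable A -> N [set x | A (- x)] = N A.
Proof.
move=> mA; have mA' : measurable [set x | A (- x)].
  by rewrite -[X in measurable X]setTI; apply: (oppr_measurable (D := setT)).
rewrite !normal_probE//.
rewrite (@ge0_integral_affine _ (-1) 0 (fun x => (\1_A x * normal_pdf 0 s x)%:E))//.
- rewrite normrN1 mul1e; apply: eq_integral => x _; rewrite mulN1r addr0.
  congr (_ * _)%:E.
  by rewrite !normal_pdfE// /normal_fun !subr0 sqrrN.
- apply/measurable_EFinP; apply: measurable_funM; first exact: measurable_indic.
  exact: measurable_normal_pdf.
- by move=> x; rewrite lee_fin mulr_ge0// normal_pdf_ge0.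
Qed.

Let normal_onesided_tail (t : R) : 0 <= t ->
  (N [set x | (t < x)%R] <= (expR (- (t ^+ 2 / (s ^+ 2 *+ 2))) / 2)%:E)%E.
Proof.
move=> t0.
have mA : measurable [set x : R | t < x].
  rewrite (_ : [set x | _] = `]t, +oo[%classic); first exact: measurable_itv.
  by apply/seteqP; split => w /=; rewrite in_itv/= andbT.
have mA' : measurable [set x : R | t < - x].
  rewrite (_ : [set x | _] = `]-oo, - t[%classic); first exact: measurable_itv.
  by apply/seteqP; split => w /=; rewrite in_itv/= ltrNr.
have := normal_sqr_tail (sqr_ge0 t).
rewrite (_ : [set x | _] = [set x : R | t < x] `|` [set x : R | t < - x]); last first.
  apply/seteqP; split => x /=; rewrite -[x ^+ 2]real_normK ?num_real//.
    by rewrite ltr_pXn2r// ?nnegrE// ltr_normr => /orP.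
  by move=> h; rewrite ltr_pXn2r// ?nnegrE// ltr_normr; apply/orP.
have -> : (N ([set x : R | (t < x)%R] `|` [set x : R | (t < - x)%R]) =
    N [set x : R | (t < x)%R] + N [set x : R | (t < - x)%R])%E.
  apply: measureU => //; apply/seteqP; split => x //= [h1 h2].
  have : 0 < - x by rewrite (le_lt_trans t0).
  by rewrite oppr_gt0 => x0; move: (lt_trans (le_lt_trans t0 h1) x0); rewrite ltxx.
have hN := normalN mA; rewrite /= in hN; rewrite hN.
have : N [set x | t < x] \is a fin_num by apply: fin_num_measure.
case: (N _) => // v _; rewrite -EFinD !lee_fin => h.
by rewrite ler_pdivlMr// mulr_natr mulr2n.
Qed.

(** Serves the zero sign vectors: being their own opposites they gain nothing from pairing [s] with
    [- s], and the factor 1/2 comes from the symmetry of the normal law instead. *)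
Lemma gauss_linear_onesided_tail Z a (t : R) : gauss_family P s Z -> 0 <= t ->
  0 < dotf a a ->
  (P [set w | (t * Num.sqrt (dotf a a) < dotf a (Z^~ w))%R]
    <= (expR (- (t ^+ 2 / (s ^+ 2 *+ 2))) / 2)%:E)%E.
Proof.
move=> gZ t0 aa; have [Z' gZ' [i [c [cE aE]]]] := gauss_single_reduce gZ aa.
have mA : measurable [set x : R | t < x].
  rewrite (_ : [set x | _] = `]t, +oo[%classic); first exact: measurable_itv.
  by apply/seteqP; split => w /=; rewrite in_itv/= andbT.
apply: le_trans (normal_onesided_tail t0).
rewrite -cE sqrtr_sqr.
have [c0|c0|c0] := ltgtP 0 c; last by rewrite -cE -c0 expr0n ltxx in aa.
  rewrite -(gauss_marginal i _ gZ')// le_eqVlt; apply/orP; left; apply/eqP; congr (P _).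
  by apply/seteqP; split => w /=; rewrite aE gtr0_norm// mulrC ltr_pM2l.
rewrite -(normalN mA) -(gauss_marginal i _ gZ'); last first.
  by rewrite -[X in measurable X]setTI; apply: (oppr_measurable (D := setT)).
rewrite le_eqVlt; apply/orP; left; apply/eqP; congr (P _).
by apply/seteqP; split => w /=; rewrite aE ltr0_norm// mulrN -mulNr mulrC
  ltr_nM2l// ltrNr.
Qed.

End GaussTails.

(** * Euclidean geometry and the sparse Riesz condition *)

Section EuclideanColumns.
Context {R : realType}.

Definition cdot n (u v : 'cV[R]_n) : R := \sum_i u i 0 * v i 0.

(** Vectors indexed by [A] are kept in R^p and made to vanish off [A], so that vectors over
    different sets can be added and compared without casts. *)
Definition supported p (A : {set 'I_p}) (c : 'cV[R]_p) : Prop :=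
  forall j, j \notin A -> c j 0 = 0.

Definition restrict p (A : {set 'I_p}) (c : 'cV[R]_p) : 'cV[R]_p :=
  \col_j (if j \in A then c j 0 else 0).

Section Cdot.
Variable n : nat.
Implicit Types u v w : 'cV[R]_n.

Lemma cdotC u v : cdot u v = cdot v u.
Proof. by apply: eq_bigr => i _; rewrite mulrC. Qed.

Lemma cdotDl u v w : cdot (u + v) w = cdot u w + cdot v w.
Proof. by rewrite -big_split; apply: eq_bigr => i _; rewrite !mxE mulrDl. Qed.

Lemma cdotZl a u w : cdot (a *: u) w = a * cdot u w.
Proof. by rewrite mulr_sumr; apply: eq_bigr => i _; rewrite !mxE mulrA. Qed.

Lemma cdotNl u w : cdot (- u) w = - cdot u w.
Proof. by rewrite -scaleN1r cdotZl mulN1r. Qed.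

Lemma cdotBl u v w : cdot (u - v) w = cdot u w - cdot v w.
Proof. by rewrite cdotDl cdotNl. Qed.

Lemma cdotDr u v w : cdot w (u + v) = cdot w u + cdot w v.
Proof. by rewrite cdotC cdotDl !(cdotC w). Qed.

Lemma cdotZr a u w : cdot w (a *: u) = a * cdot w u.
Proof. by rewrite cdotC cdotZl (cdotC w). Qed.

Lemma cdotNr u w : cdot w (- u) = - cdot w u.
Proof. by rewrite cdotC cdotNl (cdotC w). Qed.

Lemma cdotBr u v w : cdot w (u - v) = cdot w u - cdot w v.
Proof. by rewrite cdotDr cdotNr. Qed.

Lemma cdot_ge0 u : 0 <= cdot u u.
Proof. by apply: sumr_ge0 => i _; rewrite -expr2 sqr_ge0. Qed.

Lemma cdot_eq0 u : (cdot u u == 0) = (u == 0).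
Proof.
apply/idP/eqP => [|->]; last by rewrite /cdot big1// => i _; rewrite mxE mul0r.
rewrite psumr_eq0; last by move=> i _; rewrite -expr2 sqr_ge0.
move=> /allP h; apply/matrixP => i j; rewrite ord1 mxE.
by have := h i (mem_index_enum i); rewrite mulf_eq0 orbb => /eqP.
Qed.

Lemma enorm_sqr u : enorm u ^+ 2 = cdot u u.
Proof.
rewrite /enorm sqr_sqrtr; first by apply: eq_bigr => i _; rewrite expr2.
by apply: sumr_ge0 => i _; rewrite sqr_ge0.
Qed.

Lemma enormE u : enorm u = Num.sqrt (cdot u u).
Proof. by rewrite -enorm_sqr sqrtr_sqr ger0_norm// sqrtr_ge0. Qed.

Lemma enorm_ge0 u : 0 <= enorm u.
Proof. exact: sqrtr_ge0. Qed.

Lemma cdot_sqr_le u v : cdot u v ^+ 2 <= cdot u u * cdot v v.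
Proof.
have [v0|v0] := eqVneq (cdot v v) 0.
  move/eqP: v0; rewrite cdot_eq0 => /eqP ->.
  by rewrite cdotC -(scale0r 0) cdotZl mul0r expr0n mulr_ge0 ?cdot_ge0.
have vpos : 0 < cdot v v by rewrite lt0r v0 cdot_ge0.
have := cdot_ge0 (cdot v v *: u - cdot u v *: v).
rewrite !cdotBl !cdotBr !cdotZl !cdotZr (cdotC v u).
have -> : cdot v v * (cdot v v * cdot u u) - cdot v v * (cdot u v * cdot u v) -
  (cdot u v * (cdot v v * cdot u v) - cdot u v * (cdot u v * cdot v v)) =
  cdot v v * (cdot u u * cdot v v - cdot u v ^+ 2) by ring.
by rewrite pmulr_rge0// subr_ge0.
Qed.

Lemma cdot_le u v : cdot u v <= enorm u * enorm v.
Proof.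
rewrite (le_trans (ler_norm _))// -sqrtr_sqr !enormE -sqrtrM ?cdot_ge0//.
by rewrite ler_wsqrtr// cdot_sqr_le.
Qed.

Lemma enormD_le u v : enorm (u + v) <= enorm u + enorm v.
Proof.
have h : 0 <= enorm u + enorm v by rewrite addr_ge0 ?enorm_ge0.
rewrite -(ler_pXn2r (n := 2))// ?nnegrE ?enorm_ge0//.
rewrite enorm_sqr cdotDl !cdotDr -!enorm_sqr (cdotC v u).
have := cdot_le u v; nra.
Qed.

Lemma enormN u : enorm (- u) = enorm u.
Proof. by rewrite !enormE cdotNl cdotNr opprK. Qed.

End Cdot.

Lemma cdot_mulmx n p (X : 'M[R]_(n, p)) b v :
  cdot (X *m b) v = cdot b (X^T *m v).
Proof.
rewrite /cdot.
under eq_bigr do rewrite mxE mulr_suml.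
rewrite exchange_big/=; apply: eq_bigr => j _; rewrite mxE mulr_sumr.
by apply: eq_bigr => i _; rewrite !mxE mulrAC mulrC mulrA.
Qed.

Lemma cdot_supported p (A : {set 'I_p}) (c v : 'cV[R]_p) : supported A c ->
  cdot c v = \sum_(j in A) c j 0 * v j 0.
Proof.
move=> cA; rewrite /cdot [RHS]big_mkcond; apply: eq_bigr => j _.
by case: ifPn => // /cA ->; rewrite mul0r.
Qed.

Lemma cdot_supported_eq p (A : {set 'I_p}) (c u v : 'cV[R]_p) : supported A c ->
  (forall j, j \in A -> u j 0 = v j 0) -> cdot c u = cdot c v.
Proof.
by move=> cA uv; rewrite !(cdot_supported _ cA); apply: eq_bigr => j /uv ->.
Qed.

Lemma restrict_supported p (A : {set 'I_p}) c : supported A (restrict A c).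
Proof. by move=> j /negbTE jA; rewrite mxE jA. Qed.

Lemma restrictC p (A : {set 'I_p}) c : restrict A c + restrict (~: A) c = c.
Proof.
apply/matrixP => i j; rewrite ord1 !mxE inE.
by case: (i \in A); rewrite ?addr0 ?add0r.
Qed.

End EuclideanColumns.

Lemma exists_subset_card (T : finType) (S : {set T}) k : (k <= #|S|)%N ->
  exists2 B : {set T}, B \subset S & #|B| = k.
Proof.
move=> kS; exists [set x in take k (enum S)].
  by apply/fintype.subsetP => x; rewrite inE => /mem_take; rewrite mem_enum.
rewrite cardsE; have /card_uniqP -> := take_uniq k (enum_uniq S).
by rewrite size_takel// -cardE.
Qed.

Lemma exists_superset_card (T : finType) (S U : {set T}) k : S \subset U ->
  (#|S| <= k <= #|U|)%N ->
  exists2 B : {set T}, (S \subset B) && (B \subset U) & #|B| = k.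
Proof.
move=> SU /andP[Sk kU].
have [|B BS Bk] := @exists_subset_card _ (U :\: S) (k - #|S|)%N.
  by rewrite cardsD (finset.setIidPr SU) leq_sub2r.
exists (S :|: B).
  rewrite finset.subsetUl finset.subUset SU (fintype.subset_trans BS)//.
  by rewrite finset.subsetDl.
rewrite cardsU (_ : (S :&: B)%SET = finset.set0) ?cards0 ?subn0 ?Bk ?subnKC//.
apply/setP => x; rewrite !inE; apply/negbTE/negP => /andP[xS xB].
by have := fintype.subsetP BS x xB; rewrite !inE xS.
Qed.

Section SparseRiesz.
Context {R : realType} {n p : nat}.
Variables (X : 'M[R]_(n, p)) (qs : nat) (cl cu : R).
Hypotheses (qs_gt0 : (1 <= qs)%N) (qs_le : (qs <= p)%N).
Hypotheses (cl0 : 0 < cl) (SR : sparse_riesz X qs cl cu).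

(** For [n = 0] the quotient would be a division by zero, hence 0, against [0 < cl]; [1 <= qs <= p]
    provides a set and a nonzero vector to test. *)
Lemma sparse_riesz_n_gt0 : 0 < n%:R :> R.
Proof.
have [|A _ Aq] := @exists_subset_card _ [set: 'I_p]%SET qs.
  by rewrite cardsT card_ord.
rewrite ltr0n lt0n; apply/eqP => n0.
have i : 'I_#|A| by apply: (Ordinal (n := #|A|) (m := 0)); rewrite Aq.
have v0 : (delta_mx i 0 : 'cV[R]_#|A|) != 0.
  by apply/eqP => /matrixP/(_ i 0); rewrite !mxE !eqxx => /eqP; rewrite oner_eq0.
have /andP[+ _] := SR Aq v0.
have n0R : n%:R = 0 :> R by rewrite n0.
by rewrite n0R mul0r invr0 mulr0 leNgt cl0.
Qed.

(** The condition speaks of sets of size exactly [qs]; a smaller set is enlarged to that size, which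
    [qs <= p] permits. Without the quotient the bounds also cover [c = 0]. *)
Lemma sparse_riesz_supported (A : {set 'I_p}) (c : 'cV[R]_p) :
  (#|A| <= qs)%N -> supported A c ->
  cl * n%:R * cdot c c <= cdot (X *m c) (X *m c) /\
  cdot (X *m c) (X *m c) <= cu * n%:R * cdot c c.
Proof.
move=> Aq cA.
have [|A' /andP[AA' _] A'q] := @exists_superset_card _ A [set: 'I_p]%SET qs (finset.subsetT A).
  by rewrite Aq cardsT card_ord.
have cA' : supported A' c.
  by move=> j jA'; apply: cA; apply: contraNN jA'; exact: (fintype.subsetP AA').
pose v : 'cV[R]_#|A'| := \col_k c (enum_val k) 0.
have Xv : colsin X A' *m v = X *m c.
  apply/matrixP => i j; rewrite ord1 !mxE.
  under eq_bigr do rewrite !mxE.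
  rewrite -(big_enum_val (A := mem A') (fun k => X i k * c k 0)) /= big_mkcond/=.
  by apply: eq_bigr => k _; case: ifPn => // /cA' ->; rewrite mulr0.
have vv : cdot v v = cdot c c.
  rewrite (cdot_supported c cA') /cdot; under eq_bigr do rewrite !mxE.
  by rewrite -(big_enum_val (A := mem A') (fun k => c k 0 * c k 0)).
have [v0|v0] := eqVneq v 0.
  have cc0 : cdot c c = 0 by apply/eqP; rewrite -vv cdot_eq0 v0.
  have /eqP := cc0; rewrite cdot_eq0 => /eqP c0.
  have -> : X *m c = 0 by rewrite c0 mulmx0.
  by rewrite cc0 !mulr0; have /eqP -> : cdot (0 : 'cV[R]_n) 0 == 0 by rewrite cdot_eq0.
have n0 := sparse_riesz_n_gt0.
have c0 : 0 < cdot c c by rewrite -vv lt0r cdot_eq0 v0 cdot_ge0.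
have /andP[] := SR A'q v0.
rewrite Xv !enorm_sqr vv ler_pdivlMr ?mulr_gt0// ler_pdivrMr ?mulr_gt0//.
by rewrite !mulrA.
Qed.

End SparseRiesz.

Section NormalEquations.
Context {R : realType} {n p : nat}.
Variable X : 'M[R]_(n, p).

Definition maskmx (A : {set 'I_p}) : 'M[R]_p := diag_mx (\row_j (j \in A)%:R).

Lemma maskmxE A c : maskmx A *m c = restrict A c.
Proof.
apply/matrixP => i j; rewrite ord1 mul_diag_mx !mxE.
by case: (i \in A); rewrite ?mul1r ?mul0r.
Qed.

(* X_A^T X_A bordered by an identity block on the complement of A. *)
Definition gram (A : {set 'I_p}) : 'M[R]_p :=
  maskmx A *m X^T *m X *m maskmx A + (1%:M - maskmx A).

Lemma gramE A c :
  gram A *m c = restrict A (X^T *m (X *m restrict A c)) + (c - restrict A c).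
Proof. by rewrite mulmxDl mulmxBl mul1mx -!mulmxA !maskmxE. Qed.

Definition injective_on (A : {set 'I_p}) :=
  forall c, supported A c -> X *m c = 0 -> c = 0.

(** Pairing [gram A *m v = 0] with [v] gives |X r|^2 + |v - r|^2 = 0 for the restriction [r] of [v],
    so the kernel is trivial. *)
Lemma gram_unit A : injective_on A -> gram A \in unitmx.
Proof.
move=> inj.
have ker (v : 'cV[R]_p) : gram A *m v = 0 -> v = 0.
  rewrite gramE => h.
  have /eqP : cdot v (restrict A (X^T *m (X *m restrict A v)) + (v - restrict A v)) = 0.
    by rewrite h -(scale0r 0) cdotZr mul0r.
  set r := restrict A v; have rA : supported A r by exact: restrict_supported.
  have vr (z : 'cV[R]_p) : supported A z -> cdot v z = cdot r z.
    move=> zA; rewrite cdotC [RHS]cdotC; apply: (cdot_supported_eq zA) => j jA.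
    by rewrite mxE jA.
  have vrr : cdot v (v - r) = cdot (v - r) (v - r).
    transitivity (cdot ((v - r) + r) (v - r)); first by rewrite subrK.
    rewrite cdotDl.
    suff -> : cdot r (v - r) = 0 by rewrite addr0.
    rewrite (cdot_supported _ rA) big1// => j jA.
    by rewrite !mxE jA subrr mulr0.
  rewrite cdotDr vr; last exact: restrict_supported.
  have -> : cdot r (restrict A (X^T *m (X *m r))) = cdot (X *m r) (X *m r).
    rewrite cdot_mulmx; apply: (cdot_supported_eq rA) => j jA.
    by rewrite [LHS]mxE jA.
  rewrite vrr paddr_eq0 ?cdot_ge0// !cdot_eq0 => /andP[/eqP /(inj _ rA) r0].
  by rewrite subr_eq0 => /eqP ->.
rewrite -unitmx_tr -row_free_unit -kermx_eq0; apply/eqP.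
apply: trmx_inj; rewrite trmx0; apply/matrixP => i j.
set K := kermx _.
have K0 : gram A *m K^T = 0 by rewrite -[gram A]trmxK -trmx_mul mulmx_ker trmx0.
have /matrixP/(_ i 0) : col j K^T = 0.
  by apply: ker; rewrite colE mulmxA K0 mul0mx.
by rewrite !mxE.
Qed.

Lemma normal_equation_solution A (s : 'cV[R]_p) : injective_on A ->
  exists2 c, supported A c &
    forall j, j \in A -> (X^T *m (X *m c)) j 0 = s j 0.
Proof.
move=> inj; have gU := gram_unit inj.
exists (restrict A (invmx (gram A) *m s)); first exact: restrict_supported.
move=> j jA; have /matrixP/(_ j 0) := mulKVmx gU s.
by rewrite gramE !mxE jA subrr addr0.
Qed.

End NormalEquations.

(** * Deterministic inequalities from the KKT conditions *)

Section BasicInequality.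
Context {R : realType} {n p : nat}.
Variables (X : 'M[R]_(n, p)) (beta b : 'cV[R]_p) (eps : 'cV[R]_n) (lam : R).
Variables (A0 A : {set 'I_p}).
Let y : 'cV[R]_n := X *m beta + eps.
Let g : 'cV[R]_p := X^T *m (y - X *m b).

(** The subgradient condition without a case distinction: the equation is void where [b] vanishes
    and elsewhere makes the correlation [lam] times the sign of [b j 0]. *)
Definition kkt (y : 'cV[R]_n) (lam : R) (b : 'cV[R]_p) : Prop :=
  forall j, `|(X^T *m (y - X *m b)) j 0| <= lam /\
    b j 0 * (X^T *m (y - X *m b)) j 0 = lam * `|b j 0|.

Hypothesis lam0 : 0 < lam.
Hypothesis KKT : kkt y lam b.
Hypothesis bA : supported A b.

Variables (c3 c4 : 'cV[R]_p) (w : 'cV[R]_n) (cw : 'cV[R]_p).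
Hypotheses (c3A : supported A c3) (c4A : supported A c4) (cwA : supported A cw).
Hypothesis c3E : forall j, j \in A ->
  (X^T *m (X *m c3)) j 0 = (if j \in A0 then 0 else g j 0 / lam).
Hypothesis c4E : forall j, j \in A ->
  (X^T *m (X *m c4)) j 0 = (if j \in A0 then g j 0 / lam else 0).
Hypothesis w_orth : forall j, j \in A -> (X^T *m w) j 0 = 0.
Hypothesis wE : w = X *m beta - X *m cw.

(** These are X_A (X_A^T X_A)^-1 applied to the parts of the normalised correlations outside and
    inside [A0]. Hence [lam *: (a3 + a4)] is the projection of the residual on the span of the
    columns in [A], and [w] is (I - P_A) X beta. *)
Let a3 := X *m c3.
Let a4 := X *m c4.

(** In the sum of the two tests, the first one multiplied by [lam], the products of [a4] with the
    part of X beta off [A] cancel. The [a3] terms stay on the right, to be bounded by the sparse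
    Riesz condition. *)
Lemma basic_inequality :
  lam ^+ 2 * cdot a4 a4 + cdot w w <=
  lam * (\sum_(j in A0) `|beta j 0|)
  + lam * (\sum_(j in ~: A0 :\: A) `|beta j 0|)
  - lam ^+ 2 * cdot a4 a3
  - lam * cdot (X *m restrict (~: A) beta) a3 + cdot (lam *: a4 - w) eps.
Proof.
pose r := y - X *m b.
have gE j : j \in A -> g j 0 = lam * (X^T *m (a3 + a4)) j 0.
  move=> jA; rewrite mulmxDr [in RHS]mxE c3E// c4E//.
  by case: ifP => _; field; rewrite gt_eqF.
have glam j : `|g j 0| <= lam by case: (KKT j).
have bg j : b j 0 * g j 0 = lam * `|b j 0| by case: (KKT j).
have w0 c : supported A c -> cdot (X *m c) w = 0.
  move=> cA; rewrite cdot_mulmx (cdot_supported _ cA) big1// => j jA.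
  by rewrite w_orth// mulr0.
have dotr c : supported A c -> cdot (X *m c) r = lam * cdot (X *m c) (a3 + a4).
  move=> cA; rewrite !cdot_mulmx !(cdot_supported _ cA) mulr_sumr.
  by apply: eq_bigr => j jA; rewrite -/g gE// mulrCA.
pose bA1 := restrict A beta; pose bA2 := restrict (~: A) beta.
have bE : X *m beta = X *m bA1 + X *m bA2 by rewrite -mulmxDr restrictC.
have bA1A : supported A bA1 by exact: restrict_supported.
have a4b1 : cdot a4 (X *m bA1) <= \sum_(j in A0 :&: A) `|beta j 0|.
  rewrite cdotC cdot_mulmx (cdot_supported _ bA1A) big_mkcond [leRHS]big_mkcond.
  apply: ler_sum => j _; rewrite inE andbC; case: ifPn => //= jA.
  rewrite c4E// mxE jA; case: ifPn => _; last by rewrite mulr0.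
  rewrite (le_trans (ler_norm _))// normrM ler_piMr//.
  by rewrite normrM normfV (gtr0_norm lam0) ler_pdivrMr// mul1r.
(* Correlations and coefficients agree in sign, so this product is the l1 norm of [b] over the
   indices of [A] in [A0]; it is dropped. *)
have a4b : 0 <= cdot a4 (X *m b).
  rewrite cdotC cdot_mulmx (cdot_supported _ bA); apply: sumr_ge0 => j jA.
  rewrite c4E//; case: ifPn => _; last by rewrite mulr0.
  by rewrite mulrA bg mulrAC divff ?gt_eqF// mul1r.
have step1 : lam * cdot a4 (a3 + a4) <=
    \sum_(j in A0 :&: A) `|beta j 0| + cdot a4 (X *m bA2) + cdot a4 eps.
  rewrite -(dotr _ c4A) /r /y bE cdotBr !cdotDr.
  rewrite lerBlDr -!addrA lerD// lerD2l lerDl//.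
have step2 : cdot w w + cdot w eps + lam * cdot (X *m bA2) (a3 + a4) <=
    lam * \sum_(j in ~: A) `|beta j 0|.
  have -> : cdot w w + cdot w eps + lam * cdot (X *m bA2) (a3 + a4) =
      cdot (X *m bA2) r.
    (* [X *m bA2] is [w] plus a combination of the columns in [A]; on those columns the residual
       acts as [lam *: (a3 + a4)], and [w] is orthogonal to them. *)
    have piE : X *m bA2 = w + X *m (cw - bA1).
      by rewrite wE bE mulmxBr addrA subrK addrAC subrr add0r.
    have cwbA : supported A (cw - bA1).
      by move=> j jA; rewrite !mxE cwA// (negbTE jA) subrr.
    rewrite {2}piE cdotDl (dotr _ cwbA).
    have -> : cdot (X *m bA2) (a3 + a4) = cdot (X *m (cw - bA1)) (a3 + a4).
      by rewrite piE cdotDl cdotDr !(cdotC w) !w0// !add0r.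
    congr (_ + _).
    rewrite /r /y cdotBr cdotDr (cdotC w (X *m b)) w0// subr0; congr (_ + _).
    have -> : X *m beta = w + X *m cw by rewrite wE subrK.
    by rewrite cdotDr (cdotC w (X *m cw)) w0// addr0.
  rewrite cdot_mulmx (cdot_supported _ (restrict_supported (A := ~: A) beta)).
  rewrite mulr_sumr; apply: ler_sum => j jA; rewrite mxE jA.
  by rewrite (le_trans (ler_norm _))// normrM mulrC ler_wpM2r.
have sumA0 : \sum_(j in A0) `|beta j 0| + \sum_(j in ~: A0 :\: A) `|beta j 0| =
    \sum_(j in A0 :&: A) `|beta j 0| + \sum_(j in ~: A) `|beta j 0|.
  rewrite !(big_mkcond (fun j => j \in _)) -!big_split; apply: eq_bigr => j _ /=.
  by rewrite !inE; case: (j \in A0); case: (j \in A); rewrite /= ?addr0 ?add0r.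
have {step1} step1 := ler_wpM2l (ltW lam0) step1.
have := lerD step1 step2.
rewrite cdotBl cdotZl !mulrDr !cdotDr mulrDr (cdotC a4 (X *m bA2)).
rewrite (mulrDr lam (lam * _)).
move: sumA0 => /(congr1 ( *%R lam)); rewrite !mulrDr expr2.
set k1 := cdot a4 a4; set k2 := cdot a4 a3; set k3 := cdot (X *m bA2) a3.
set k4 := cdot (X *m bA2) a4.
lra.
Qed.

End BasicInequality.

Lemma sum_normr_le (R : realType) (p : nat) (S : {set 'I_p}) (v : 'cV[R]_p) :
  \sum_(j in S) `|v j 0| <=
  Num.sqrt #|S|%:R * Num.sqrt (\sum_(j in S) v j 0 ^+ 2).
Proof.
pose e : 'cV[R]_p := \col_j (j \in S)%:R.
pose a : 'cV[R]_p := \col_j `|v j 0|.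
have eS : supported S e by move=> j /negbTE jS; rewrite mxE jS.
have aS : supported S (restrict S a) by exact: restrict_supported.
have E1 : \sum_(j in S) `|v j 0| = cdot e (restrict S a).
  by rewrite (cdot_supported _ eS); apply: eq_bigr => j jS; rewrite !mxE jS mul1r.
have E2 : #|S|%:R = cdot e e.
  rewrite (cdot_supported _ eS) -sum1_card natr_sum; apply: eq_bigr => j jS.
  by rewrite !mxE jS mul1r.
have E3 : \sum_(j in S) v j 0 ^+ 2 = cdot (restrict S a) (restrict S a).
  rewrite (cdot_supported _ aS); apply: eq_bigr => j jS.
  by rewrite !mxE jS -expr2 real_normK ?num_real.
by rewrite E1 E2 E3 -!enormE cdot_le.
Qed.

Lemma le_eta2_of (R : realType) (n p : nat) (X : 'M[R]_(n, p)) (beta : 'cV[R]_p)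
    (A0 A : {set 'I_p}) :
  A \subset A0 -> enorm (X *m restrict A beta) <= eta2_of X beta A0.
Proof.
move=> AA0.
have -> : X *m restrict A beta = \sum_(j in A) beta j 0 *: col j X.
  apply/matrixP => i k; rewrite ord1 mxE summxE [RHS]big_mkcond.
  apply: eq_bigr => j _; rewrite !mxE; case: ifP => _; first by rewrite mulrC.
  by rewrite mulr0.
rewrite /eta2_of (bigD1 A)//= le_max lexx//.
Qed.

Lemma eta2_of_ge0 (R : realType) (n p : nat) (X : 'M[R]_(n, p)) (beta : 'cV[R]_p)
    (A0 : {set 'I_p}) :
  0 <= eta2_of X beta A0.
Proof.
apply: le_trans (@le_eta2_of _ _ _ X beta A0 finset.set0 (finset.sub0set _)).
exact: enorm_ge0.
Qed.

Section CoreBounds.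
Context {R : realType} {n p : nat}.
Variables (X : 'M[R]_(n, p)) (beta b : 'cV[R]_p) (eps : 'cV[R]_n) (lam : R).
Variables (A0 A : {set 'I_p}) (qs q : nat) (cl cu : R).
Hypotheses (qs_gt0 : (1 <= qs)%N) (qs_le : (qs <= p)%N).
Hypotheses (cl0 : 0 < cl) (clu : cl < cu) (SR : sparse_riesz X qs cl cu).
Hypotheses (q_gt0 : (1 <= q)%N) (qE : #|~: A0| = q) (qqs : (q <= qs)%N).
Hypotheses (lam0 : 0 < lam) (KKT : kkt X (X *m beta + eps) lam b).
Hypothesis bA : supported A b.
Hypothesis Aqs : (#|A| <= qs)%N.
Hypothesis gA : forall j, j \in A -> j \in A0 ->
  `|(X^T *m (X *m beta + eps - X *m b)) j 0| = lam.

(* The last factor is the noise level guaranteed by [lam >= lambda_np]. *)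
Definition noise_ok (A : {set 'I_p}) : Prop :=
  forall (s c : 'cV[R]_p) (w : 'cV[R]_n) (cw : 'cV[R]_p),
  (forall j, [\/ s j 0 = 0, s j 0 = 1 | s j 0 = -1]) ->
  supported A s -> supported A c -> supported A cw ->
  (forall j, j \in A -> (X^T *m (X *m c)) j 0 = s j 0) ->
  (forall j, j \in A -> (X^T *m w) j 0 = 0) -> w = X *m beta - X *m cw ->
  cdot (lam *: (X *m c) - w) eps <=
  Num.sqrt (lam ^+ 2 * cdot (X *m c) (X *m c) + cdot w w) *
  (lam / 2 * Num.sqrt ((maxn #|A| 1)%:R / (cu * n%:R))).

Hypothesis noise : noise_ok A.

Let n0 : 0 < n%:R :> R := sparse_riesz_n_gt0 qs_gt0 qs_le cl0 SR.
Let SRs := sparse_riesz_supported qs_gt0 qs_le cl0 SR.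
Let cu0 : 0 < cu := lt_trans cl0 clu.
(** [zt] is the lower Riesz bound for the part of X beta that [A] misses outside [A0]. [k] dominates
    [lam] times |X c3|, and [k * zt] dominates [lam] times the l1 norm of the missed
    coefficients. *)
Let zt : R := Num.sqrt (cl * n%:R) * Num.sqrt (\sum_(j in ~: A0 :\: A) beta j 0 ^+ 2).
Let eta2 := eta2_of X beta A0.
Let k : R := lam / Num.sqrt (cl * n%:R) * Num.sqrt q%:R.

Lemma injective_on_sparse (B : {set 'I_p}) : (#|B| <= qs)%N -> injective_on X B.
Proof.
move=> Bq c cB Xc0; have [h _] := SRs Bq cB.
have XX : cdot (X *m c) (X *m c) = 0 by apply/eqP; rewrite cdot_eq0 Xc0.
apply/eqP; rewrite -cdot_eq0; apply/eqP/le_anti; rewrite cdot_ge0 andbT.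
by rewrite XX pmulr_rle0 ?mulr_gt0// in h.
Qed.

Lemma core_bounds : exists x w cw,
  [/\ supported A cw /\ 0 <= x,
      w = X *m beta - X *m cw /\ (forall j, j \in A -> (X^T *m w) j 0 = 0),
      x ^+ 2 / 2 + 3 / 4 * enorm w ^+ 2 <=
        (q%:R * lam ^+ 2 / (cu * n%:R)) / 4 + lam * (\sum_(j in A0) `|beta j 0|)
        + k * Num.sqrt (1 + cu / cl) * zt + k * eta2 + x * k,
      #|A :&: A0|%:R * lam ^+ 2 <= cu * n%:R * x ^+ 2 &
      (#|A :|: ~: A0| <= qs)%N -> zt <= enorm w + eta2].
Proof.
pose g := X^T *m (X *m beta + eps - X *m b).
have inj := injective_on_sparse Aqs.
pose s3 : 'cV[R]_p := \col_j (if (j \in A) && (j \notin A0) then g j 0 / lam else 0).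
pose s4 : 'cV[R]_p := \col_j (if (j \in A) && (j \in A0) then g j 0 / lam else 0).
have s3E j : s3 j 0 = if (j \in A) && (j \notin A0) then g j 0 / lam else 0.
  by rewrite mxE.
have s4E j : s4 j 0 = if (j \in A) && (j \in A0) then g j 0 / lam else 0.
  by rewrite mxE.
have [c3 c3A c3E] := normal_equation_solution s3 inj.
have [c4 c4A c4E] := normal_equation_solution s4 inj.
have [cw cwA cwE] := normal_equation_solution (X^T *m (X *m beta)) inj.
pose w := X *m beta - X *m cw.
have w_orth j : j \in A -> (X^T *m w) j 0 = 0.
  by move=> jA; rewrite mulmxBr mxE [X in _ + X]mxE cwE// subrr.
have s3A : supported A s3 by move=> j /negbTE jA; rewrite mxE jA.
have s4A : supported A s4 by move=> j /negbTE jA; rewrite mxE jA.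
pose x := lam * enorm (X *m c4).
pose W := enorm w.
have x0 : 0 <= x by rewrite mulr_ge0 ?enorm_ge0// ltW.
have W0 : 0 <= W by exact: enorm_ge0.
have x2 : x ^+ 2 = lam ^+ 2 * cdot (X *m c4) (X *m c4).
  by rewrite exprMn enorm_sqr.
pose A5 := (~: A0 :\: A)%SET; pose A2 := (A0 :\: A)%SET.
pose q3 := #|(A :\: A0)%SET|; pose q4 := #|(A :&: A0)%SET|.
have q35 : (q3 + #|A5| = q)%N.
  rewrite /q3 -qE -(cardsID A (~: A0)%SET); congr (_ + _)%N; apply: eq_card => j.
  by rewrite !inE andbC.
have q34 : (q4 + q3 = #|A|)%N by rewrite cardsID.
have cln : 0 < cl * n%:R by rewrite mulr_gt0.
have cun : 0 < cu * n%:R by rewrite mulr_gt0.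
pose cn := Num.sqrt (cl * n%:R).
have cn0 : 0 < cn by rewrite sqrtr_gt0.
have cn2 : cn ^+ 2 = cl * n%:R by rewrite sqr_sqrtr// ltW.
have le_enorm c : (#|A| <= qs)%N -> supported A c -> cn * enorm c <= enorm (X *m c).
  move=> _ cA; rewrite -(ler_pXn2r (n := 2))// ?nnegrE ?mulr_ge0 ?enorm_ge0 ?(ltW cn0)//.
  by rewrite exprMn cn2 !enorm_sqr; case: (SRs Aqs cA).
have glam j : `|g j 0 / lam| <= 1.
  rewrite normrM normfV (gtr0_norm lam0) ler_pdivrMr// mul1r.
  by case: (KKT j).
have s3s3 : cdot s3 s3 <= q3%:R.
  rewrite (cdot_supported _ s3A) /q3 -sum1_card natr_sum.
  rewrite big_mkcond [leRHS]big_mkcond; apply: ler_sum => j _.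
  rewrite !inE !s3E; case: (j \in A); case: (j \in A0); rewrite /= ?mul0r//.
  by rewrite -expr2 -real_normK ?num_real// expr_le1.
have s4s4 : cdot s4 s4 = q4%:R.
  rewrite (cdot_supported _ s4A) /q4 -sum1_card natr_sum.
  rewrite big_mkcond [RHS]big_mkcond; apply: eq_bigr => j _.
  rewrite !inE !s4E; case jA : (j \in A); case jA0 : (j \in A0); rewrite /= ?mul0r//.
  rewrite -expr2 -real_normK ?num_real// normrM normfV (gtr0_norm lam0).
  by rewrite gA// divff ?gt_eqF// expr1n.
(* |X c3|^2 = <c3, s3>, and the lower Riesz bound turns |c3| back into |X c3|, one factor of which
   cancels. *)
have e3 : enorm (X *m c3) * cn <= Num.sqrt q3%:R.
  have h1 : enorm (X *m c3) ^+ 2 <= enorm c3 * enorm s3.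
    rewrite enorm_sqr cdot_mulmx (cdot_supported_eq c3A c3E) cdot_le//.
  have h2 := le_enorm c3 Aqs c3A.
  have h3 : enorm s3 <= Num.sqrt q3%:R by rewrite enormE ler_wsqrtr.
  have [->|z] := eqVneq (enorm (X *m c3)) 0; first by rewrite mul0r sqrtr_ge0.
  have zpos : 0 < enorm (X *m c3) by rewrite lt0r z enorm_ge0.
  rewrite (le_trans _ h3)// -(ler_pM2l zpos) mulrA -expr2.
  rewrite (le_trans (ler_wpM2r (ltW cn0) h1))// mulrAC ler_wpM2r ?enorm_ge0//.
  by rewrite mulrC.
(* The nonzero entries of [s4] are signs, so their number [q4] is <X s4, X c4>; Cauchy-Schwarz and
   the upper Riesz bound for [s4] let [x] control this count. *)
have e4 : q4%:R * lam ^+ 2 <= cu * n%:R * x ^+ 2.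
  have h1 : q4%:R = cdot (X *m s4) (X *m c4).
    by rewrite cdot_mulmx (cdot_supported_eq s4A c4E).
  have [_ h2] := SRs Aqs s4A.
  have h3 := cdot_sqr_le (X *m s4) (X *m c4); rewrite -h1 in h3.
  rewrite x2 [leRHS]mulrCA [leLHS]mulrC ler_wpM2l ?sqr_ge0//.
  have [->|q40] := eqVneq q4 0%N; first by rewrite mulr_ge0 ?cdot_ge0// ltW.
  have q4pos : 0 < q4%:R :> R by rewrite ltr0n lt0n.
  rewrite -(ler_pM2l q4pos) -expr2 (le_trans h3)// [leRHS]mulrA.
  by rewrite ler_wpM2r ?cdot_ge0// -s4s4 mulrC.
have s4sgn j : [\/ s4 j 0 = 0, s4 j 0 = 1 | s4 j 0 = -1].
  rewrite s4E; case jA : (j \in A) => /=; last by apply: Or31.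
  case jA0 : (j \in A0) => /=; last by apply: Or31.
  have := gA jA jA0; rewrite -/g => gl.
  have [h|h] := ltrP 0 (g j 0).
    by apply: Or32; move: gl; rewrite gtr0_norm// => ->; rewrite divff// gt_eqF.
  apply: Or33; move: gl; rewrite ler0_norm// => gl.
  by rewrite -[g j 0]opprK gl mulNr divff// gt_eqF.
have nz := noise s4sgn s4A c4A cwA c4E w_orth erefl.
have basic : lam ^+ 2 * cdot (X *m c4) (X *m c4) + cdot w w <=
  lam * (\sum_(j in A0) `|beta j 0|)
  + lam * (\sum_(j in ~: A0 :\: A) `|beta j 0|)
  - lam ^+ 2 * cdot (X *m c4) (X *m c3)
  - lam * cdot (X *m restrict (~: A) beta) (X *m c3)
  + cdot (lam *: (X *m c4) - w) eps.
  apply: (basic_inequality lam0 KKT bA c3A c4A cwA _ _ w_orth erefl).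
  - by move=> j jA; rewrite c3E// s3E jA/=; case: (j \in A0).
  - by move=> j jA; rewrite c4E// s4E jA/=; case: (j \in A0).
have restrE : restrict (~: A) beta = restrict A5 beta + restrict A2 beta.
  apply/matrixP => i j; rewrite ord1 !mxE !inE.
  by case: (i \in A); case: (i \in A0); rewrite /= ?addr0 ?add0r.
pose Z := Num.sqrt (\sum_(j in A5) beta j 0 ^+ 2).
have ZE : enorm (restrict A5 beta) = Z.
  rewrite enormE (cdot_supported _ (restrict_supported (A := A5) beta)).
  by congr Num.sqrt; apply: eq_bigr => j jA; rewrite mxE jA expr2.
have ztE : zt = cn * Z by [].
have Z0 : 0 <= Z by exact: sqrtr_ge0.
exists x, w, cw; split => //.
- pose D := Num.sqrt (x ^+ 2 + W ^+ 2).
  pose Nn := lam / 2 * Num.sqrt ((maxn #|A| 1)%:R / (cu * n%:R)).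
  have D2 : D ^+ 2 = x ^+ 2 + W ^+ 2 by rewrite sqr_sqrtr// addr_ge0 ?sqr_ge0.
  have {}nz : cdot (lam *: (X *m c4) - w) eps <= D * Nn.
    by rewrite /D x2 enorm_sqr.
  pose u := q%:R * lam ^+ 2 / (cu * n%:R).
  (* [maxn #|A| 1 <= q4 + q]: the share of [q4] is paid by [x] through [e4], that of [q] by [u]. *)
  have Nn2 : Nn ^+ 2 <= (x ^+ 2 + u) / 4.
    rewrite /Nn exprMn sqr_sqrtr ?divr_ge0 ?ler0n// ?(ltW cun)//.
    have -> : (lam / 2) ^+ 2 * ((maxn #|A| 1)%:R / (cu * n%:R)) =
       ((maxn #|A| 1)%:R * lam ^+ 2) / (cu * n%:R) / 4 by field; rewrite !gt_eqF.
    rewrite ler_pM2r ?invr_gt0// ler_pdivrMr// mulrDl /u divfK ?gt_eqF//.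
    rewrite (@le_trans _ _ ((q4%:R + q%:R) * lam ^+ 2))//.
      rewrite ler_wpM2r ?sqr_ge0// -natrD ler_nat geq_max -q34 leq_add2l.
      by rewrite -q35 leq_addr/= (leq_trans q_gt0)// -q35 leq_addl.
    by rewrite mulrDl lerD2r mulrC [leRHS]mulrC mulrC.
  have b5 : lam * (\sum_(j in A5) `|beta j 0|) <=
      lam / cn * Num.sqrt #|A5|%:R * zt.
    rewrite ztE; have -> : lam / cn * Num.sqrt #|A5|%:R * (cn * Z) =
      lam * (Num.sqrt #|A5|%:R * Z) by field; rewrite gt_eqF.
    by rewrite ler_wpM2l ?(ltW lam0)// sum_normr_le.
  have la3 : lam * enorm (X *m c3) <= lam / cn * Num.sqrt q3%:R.
    by rewrite -mulrA ler_wpM2l ?(ltW lam0)// [leRHS]mulrC ler_pdivlMr.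
  have lak : lam * enorm (X *m c3) <= k.
    rewrite (le_trans la3)// /k -/cn ler_wpM2l ?divr_ge0 ?(ltW lam0) ?(ltW cn0)//.
    by rewrite ler_wsqrtr// ler_nat -q35 leq_addr.
  have m43 : - (lam ^+ 2 * cdot (X *m c4) (X *m c3)) <= x * k.
    rewrite -mulrN -cdotNl (le_trans (ler_wpM2l (sqr_ge0 _) (cdot_le _ _)))//.
    rewrite enormN.
    have -> : lam ^+ 2 * (enorm (X *m c4) * enorm (X *m c3)) =
      x * (lam * enorm (X *m c3)) by rewrite /x; ring.
    by rewrite ler_wpM2l.
  have A5q : (#|A5| <= qs)%N by rewrite (leq_trans _ qqs)// -q35 leq_addl.
  have X5 : enorm (X *m restrict A5 beta) <= Num.sqrt (cu / cl) * zt.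
    rewrite ztE mulrA -(ler_pXn2r (n := 2))// ?nnegrE ?mulr_ge0 ?sqrtr_ge0 ?enorm_ge0//.
    rewrite !exprMn cn2 (@sqr_sqrtr _ (cu / cl)) ?divr_ge0 ?(ltW cl0) ?(ltW cu0)//.
    rewrite enorm_sqr -ZE enorm_sqr.
    have -> : cu / cl * (cl * n%:R) = cu * n%:R by field; rewrite gt_eqF.
    by have [] := SRs A5q (restrict_supported (A := A5) beta).
  have X2 : enorm (X *m restrict A2 beta) <= eta2.
    by apply: le_eta2_of; exact: finset.subsetDl.
  have zt0 : 0 <= zt by rewrite ztE mulr_ge0 ?(ltW cn0).
  have e0 : 0 <= lam * enorm (X *m c3) by rewrite mulr_ge0 ?enorm_ge0 ?(ltW lam0).
  have mpi : - (lam * cdot (X *m restrict (~: A) beta) (X *m c3)) <=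
      lam / cn * Num.sqrt q3%:R * (Num.sqrt (cu / cl) * zt) + k * eta2.
    rewrite restrE mulmxDr cdotDl mulrDr opprD.
    have cs v : - (lam * cdot v (X *m c3)) <= lam * enorm (X *m c3) * enorm v.
      rewrite -mulrN -cdotNl -mulrA ler_wpM2l ?(ltW lam0)//.
      by rewrite (le_trans (cdot_le _ _))// enormN mulrC.
    apply: lerD; apply: (le_trans (cs _)).
      by apply: ler_pM; rewrite ?enorm_ge0.
    by apply: ler_pM; rewrite ?enorm_ge0.
  (* Cauchy-Schwarz with [#|A5| + q3 = q]: the indices outside [A0] that [A] misses and those that
     it contains share [q], which is how 1 and [cu / cl] come under a single root. *)
  have comb : lam / cn * Num.sqrt #|A5|%:R * zt +
      lam / cn * Num.sqrt q3%:R * (Num.sqrt (cu / cl) * zt) <=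
      k * Num.sqrt (1 + cu / cl) * zt.
    have -> : lam / cn * Num.sqrt #|A5|%:R * zt +
      lam / cn * Num.sqrt q3%:R * (Num.sqrt (cu / cl) * zt) =
      lam / cn * (Num.sqrt #|A5|%:R + Num.sqrt q3%:R * Num.sqrt (cu / cl)) * zt.
      by ring.
    rewrite ler_wpM2r// /k -/cn -!mulrA ler_wpM2l ?(ltW lam0)//.
    rewrite ler_wpM2l ?invr_ge0 ?(ltW cn0)//.
    have C0 : 0 <= cu / cl by rewrite divr_ge0 ?(ltW cl0) ?(ltW cu0).
    rewrite -(ler_pXn2r (n := 2))// ?nnegrE ?addr_ge0 ?mulr_ge0 ?sqrtr_ge0//.
    rewrite [leRHS]exprMn !sqr_sqrtr ?ler0n ?addr_ge0// -q35 natrD.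
    set a := Num.sqrt #|A5|%:R; set bb := Num.sqrt q3%:R.
    have <- : a ^+ 2 = #|A5|%:R by rewrite sqr_sqrtr ?ler0n.
    have <- : bb ^+ 2 = q3%:R by rewrite sqr_sqrtr ?ler0n.
    set cc := Num.sqrt (cu / cl).
    have <- : cc ^+ 2 = cu / cl by rewrite sqr_sqrtr.
    have := sqr_ge0 (a * cc - bb); nra.
  (* A quarter of x^2 + |w|^2 goes to [D ^+ 2 / 4] and another quarter of x^2 to [Nn2]; hence 1/2
     and 3/4 in the conclusion. *)
  have dn : D * Nn <= D ^+ 2 / 4 + Nn ^+ 2.
    have := sqr_ge0 (D / 2 - Nn); nra.
  rewrite -/W -/u; rewrite -x2 -enorm_sqr -/W in basic.
  rewrite -/A5 in basic.
  rewrite D2 in dn.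
  move: basic nz Nn2 b5 m43 mpi comb dn.
  set t1 := lam * _; set t2 := lam ^+ 2 * _; set t3 := lam * _; set t4 := lam * _.
  set t5 := D * Nn; set t6 := cdot _ eps.
  set t7 := lam / cn * _ * _; set t8 := lam / cn * _ * (_ * _).
  set t9 := k * _ * zt; set t10 := k * eta2; set t11 := x * k.
  lra.
- move=> A1q; rewrite ztE.
  have [v vA vE] : exists2 v, supported A v & v = cw - restrict A beta.
    exists (cw - restrict A beta) => // j jA.
    by rewrite !mxE cwA// (negbTE jA) subrr.
  have b5A : supported A5 (restrict A5 beta) by exact: restrict_supported.
  (* Up to the columns in [A2], [w] is [X *m c5], and [c5] lives on [A] and the complement of [A0],
     where the lower Riesz bound applies. Its two parts have disjoint supports, so dropping [v] only
     shrinks the norm. *)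
  pose c5 := restrict A5 beta - v.
  have c5A : supported (A :|: ~: A0)%SET c5.
    move=> j; rewrite !inE negb_or => /andP[jA jA0].
    rewrite mxE [X in _ + X]mxE vA// b5A ?subr0//.
    by rewrite !inE jA (negbTE jA0).
  have cross : cdot (restrict A5 beta) v = 0.
    rewrite (cdot_supported _ b5A) big1// => j; rewrite inE => /andP[jA _].
    by rewrite vA// mulr0.
  have c5c5 : cdot (restrict A5 beta) (restrict A5 beta) <= cdot c5 c5.
    rewrite /c5 cdotBl !cdotBr (cdotC v (restrict A5 beta)) cross subr0 sub0r opprK lerDl.
    exact: cdot_ge0.
  have Xc5 : X *m c5 = w - X *m restrict A2 beta.
    rewrite /w -[in X *m beta](restrictC A beta) restrE /c5 vE !(mulmxDr, mulmxN, mulmxBr).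
    by apply/matrixP => i j; rewrite !mxE; ring.
  rewrite (@le_trans _ _ (cn * enorm c5))//.
    by rewrite ler_wpM2l ?(ltW cn0)// -ZE !enormE ler_wsqrtr.
  rewrite (@le_trans _ _ (enorm (X *m c5)))//.
    rewrite -(ler_pXn2r (n := 2))// ?nnegrE ?mulr_ge0 ?enorm_ge0 ?(ltW cn0)//.
    by rewrite exprMn cn2 !enorm_sqr; case: (SRs A1q c5A).
  rewrite Xc5 (le_trans (enormD_le _ _))// enormN lerD2l.
  by apply: le_eta2_of; exact: finset.subsetDl.
Qed.

End CoreBounds.

Section UnitBounds.
Context {R : realType}.
(** Lengths are measured in units of the root of q lam^2 / (cu n): [a] and [b] stand for [r1] and
    [r2], and [x], [w], [z] for the scaled quantities of [core_bounds]. *)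
Variables (C a b x w z : R).
Hypotheses (C1 : 1 <= C) (b0 : 0 <= b).
Hypotheses (w0 : 0 <= w) (z0 : 0 <= z).
Hypothesis E : x ^+ 2 / 2 + 3 / 4 * w ^+ 2 <=
  1 / 4 + a ^+ 2 + Num.sqrt C * Num.sqrt (1 + C) * z + Num.sqrt C * b
  + x * Num.sqrt C.

Let C0 : 0 <= C := le_trans ler01 C1.
Let sC2 : Num.sqrt C ^+ 2 = C. Proof. by rewrite sqr_sqrtr. Qed.
Let sC12 : Num.sqrt (1 + C) ^+ 2 = 1 + C. Proof. by rewrite sqr_sqrtr ?addr_ge0. Qed.

(** [z = 0] occurs when [A] contains the complement of [A0]. Absorbing the linear term leaves a
    quarter of x^2, hence the factors 4 of [M1]; its 2 is the 1 found here plus 1 for the [q]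
    indices outside [A0]. *)
Lemma unit_bound_x : z = 0 ->
  x ^+ 2 <= 1 + 4 * a ^+ 2 + 4 * Num.sqrt C * b + 4 * C.
Proof.
move=> z00; move: E; rewrite z00 mulr0 addr0 => h.
have sq : (x / 2 - Num.sqrt C) ^+ 2 = x ^+ 2 / 4 - x * Num.sqrt C + C.
  by rewrite sqrrB sC2; field.
have := sqr_ge0 (x / 2 - Num.sqrt C); rewrite sq => h2.
have w2 := sqr_ge0 w.
by nra.
Qed.

(* Completing the square removes the terms in x. *)
Let F : 3 / 4 * w ^+ 2 <= 1 / 4 + a ^+ 2 + C / 2 + Num.sqrt C * b
  + Num.sqrt C * Num.sqrt (1 + C) * z.
Proof.
have := sqr_ge0 (x - Num.sqrt C); rewrite sqrrB sC2 => h; have := E; nra.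
Qed.

(** Half of 3/4 w^2 absorbs the term in [w] that comes from [z], hence 8/3. [1 <= C] replaces 1 + C
    by 2 C, which accounts for the root of 2 C and for 4/3 in [M2]. *)
Lemma unit_bound_w : z <= w + b ->
  w ^+ 2 <= 8 / 3 * (1 / 4 + a ^+ 2 + b * Num.sqrt (2 * C) * (1 + Num.sqrt C)
                     + C * (1 / 2 + 4 / 3 * C)).
Proof.
move=> zw; set s := Num.sqrt C; set r := Num.sqrt (1 + C).
have s0 : 0 <= s by exact: sqrtr_ge0.
have r0 : 0 <= r by exact: sqrtr_ge0.
pose t := s * r.
have t0 : 0 <= t by rewrite mulr_ge0.
have t2 : t ^+ 2 = C * (1 + C) by rewrite exprMn sC2 sC12.
pose v := Num.sqrt (2 * C).
have v0 : 0 <= v by exact: sqrtr_ge0.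
have v2 : v ^+ 2 = 2 * C by rewrite sqr_sqrtr ?mulr_ge0.
have tv : t <= v * s.
  rewrite -(ler_pXn2r (n := 2))// ?nnegrE ?mulr_ge0//.
  rewrite t2 exprMn v2 sC2 -subr_ge0.
  have -> : 2 * C * C - C * (1 + C) = C * (C - 1) by ring.
  by rewrite mulr_ge0// subr_ge0.
have sv : s <= v by rewrite ler_wsqrtr// ler_peMl// ler1n.
have tz : t * z <= t * w + t * b by rewrite -mulrDr ler_wpM2l.
have tw : t * w <= 3 / 8 * w ^+ 2 + 2 / 3 * t ^+ 2.
  have := sqr_ge0 (3 / 4 * w - t); nra.
have tb : t * b <= v * s * b by rewrite ler_wpM2r.
have sb : s * b <= v * b by rewrite ler_wpM2r.
have CC : C * (1 + C) <= 2 * C ^+ 2.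
  rewrite -subr_ge0; have -> : 2 * C ^+ 2 - C * (1 + C) = C * (C - 1) by ring.
  by rewrite mulr_ge0// subr_ge0.
have := F; rewrite -/s -/r -/t -/v; rewrite t2 in tw.
have -> : b * v * (1 + s) = v * b + v * s * b by ring.
nra.
Qed.

(** For [z <= b] the term in b^2 suffices. Otherwise (z - b)^2 <= w^2 enters [F], and a single
    square absorbs the terms linear in [z] at half of 3/4 z^2. Its constant 2/3 (t + 3/2 b)^2
    produces the 2 before the root of 1 + C, 3/4 = 3/2 - 3/4 and 7/6 = 1/2 + 2/3. *)
Lemma unit_bound_z : z <= w + b ->
  z ^+ 2 <= 8 / 3 * (1 / 4 + a ^+ 2
     + b * Num.sqrt C * (1 + 2 * Num.sqrt (1 + C)) + 3 * b ^+ 2 / 4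
     + C * (7 / 6 + 2 / 3 * C)).
Proof.
move=> zw; set s := Num.sqrt C; set r := Num.sqrt (1 + C).
have s0 : 0 <= s by exact: sqrtr_ge0.
have r0 : 0 <= r by exact: sqrtr_ge0.
pose t := s * r.
have t0 : 0 <= t by rewrite mulr_ge0.
have t2 : t ^+ 2 = C * (1 + C) by rewrite exprMn sC2 sC12.
have sb : 0 <= s * b by rewrite mulr_ge0.
have tb : 0 <= t * b by rewrite mulr_ge0.
have -> : b * s * (1 + 2 * r) = s * b + 2 * (t * b) by rewrite /t; ring.
have a2 := sqr_ge0 a.
have [zb|bz] := lerP z b.
  have z2 : z ^+ 2 <= b ^+ 2 by rewrite ler_pXn2r// nnegrE.
  have b2 := sqr_ge0 b.
  have CC0 : 0 <= C * (7 / 6 + 2 / 3 * C).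
    by rewrite mulr_ge0// addr_ge0 ?mulr_ge0 ?divr_ge0.
  move: sb tb a2 z2 b2 CC0; set t1 := s * b; set t2' := t * b; set t3 := C * _.
  by set t4 := b ^+ 2; set t5 := z ^+ 2; set t6 := a ^+ 2; lra.
have w2 : (z - b) ^+ 2 <= w ^+ 2.
  have zb0 : 0 <= z - b by rewrite subr_ge0 ltW.
  by rewrite ler_pXn2r ?nnegrE// lerBlDr.
have sq := sqr_ge0 (3 / 4 * z - (t + 3 / 2 * b)).
have := F; rewrite -/s -/r -/t => h.
have e1 : (z - b) ^+ 2 = z ^+ 2 - 2 * (z * b) + b ^+ 2 by ring.
have e2 : (3 / 4 * z - (t + 3 / 2 * b)) ^+ 2 = 9 / 16 * z ^+ 2
  - 3 / 2 * (t * z) - 9 / 4 * (z * b) + t ^+ 2 + 3 * (t * b) + 9 / 4 * b ^+ 2.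
  by field.
rewrite e1 in w2; rewrite e2 t2 in sq.
move: h w2 sq; set zz := z ^+ 2; set zb := z * b; set tz := t * z; set ww := w ^+ 2.
set CC := C * (1 + C); have -> : C * (7 / 6 + 2 / 3 * C) = C / 2 + 2 / 3 * CC.
  by rewrite /CC; field.
lra.
Qed.

End UnitBounds.

Section ModelBounds.
Context {R : realType} {n p : nat}.
Variables (X : 'M[R]_(n, p)) (beta b : 'cV[R]_p) (eps : 'cV[R]_n) (lam : R).
Variables (A0 A : {set 'I_p}) (qs q : nat) (cl cu eta1 : R).
Hypotheses (qs_gt0 : (1 <= qs)%N) (qs_le : (qs <= p)%N).
Hypotheses (cl0 : 0 < cl) (clu : cl < cu) (SR : sparse_riesz X qs cl cu).
Hypotheses (q_gt0 : (1 <= q)%N) (qE : #|~: A0| = q) (qqs : (q <= qs)%N).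
Hypotheses (lam0 : 0 < lam) (KKT : kkt X (X *m beta + eps) lam b).
Hypothesis bA : supported A b.
Hypothesis Aqs : (#|A| <= qs)%N.
Hypothesis gA : forall j, j \in A -> j \in A0 ->
  `|(X^T *m (X *m beta + eps - X *m b)) j 0| = lam.
Hypothesis noise : noise_ok X beta eps lam cu A.
Hypothesis eta1E : \sum_(j in A0) `|beta j 0| <= eta1.

Let n0 : 0 < n%:R :> R := sparse_riesz_n_gt0 qs_gt0 qs_le cl0 SR.
Let cu0 : 0 < cu := lt_trans cl0 clu.
Let eta2 := eta2_of X beta A0.
Let u : R := q%:R * lam ^+ 2 / (cu * n%:R).
Let q0 : 0 < q%:R :> R. Proof. by rewrite ltr0n. Qed.
Let u0 : 0 < u.
Proof. by rewrite divr_gt0 ?mulr_gt0// exprn_gt0. Qed.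

(** Serves two choices of [A]: sets containing the complement of [A0], where nothing is missed
    outside [A0] and the size is bounded, and the selected set, for which [w] is the projection
    error. *)
Lemma model_bounds : exists w cw,
  [/\ supported A cw /\ w = X *m beta - X *m cw,
      forall j, j \in A -> (X^T *m w) j 0 = 0,
      ~: A0 \subset A -> #|A|%:R <= M1 n q eta1 eta2 cl cu lam * q%:R &
      (#|A :|: ~: A0| <= qs)%N ->
      enorm w ^+ 2 <= M2 n q eta1 eta2 cl cu lam * u /\
      \sum_(j in ~: A0 :\: A) beta j 0 ^+ 2 <=
        M3 n q eta1 eta2 cl cu lam * (q%:R * lam ^+ 2 / (cu * cl * n%:R ^+ 2))].
Proof.
have [x [w [cw [[cwA x0] [wE worth] E1 E2 E3]]]] :=
  core_bounds qs_gt0 qs_le cl0 clu SR q_gt0 qE qqs lam0 KKT bA Aqs gA noise.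
set zt := Num.sqrt _ * Num.sqrt _ in E1 E3; set k := lam / _ * _ in E1.
set r1' := r1 n q eta1 cu lam; set r2' := r2 n q eta2 cu lam.
(* Relative to [U], the quantities [eta2] and [k] become [r2] and the root of [cu / cl], and
   [lam * eta1] becomes r1^2 relative to [u]: this is the normalisation behind [r1] and [r2]. *)
pose U := Num.sqrt u; have U0 : 0 < U by rewrite sqrtr_gt0.
have U2 : U ^+ 2 = u by rewrite sqr_sqrtr// ltW.
have C1 : 1 <= cu / cl by rewrite ler_pdivlMr// mul1r ltW.
have eta10 : 0 <= eta1 by rewrite (le_trans _ eta1E)// sumr_ge0.
have r12 : r1' ^+ 2 * u = lam * eta1.
  rewrite sqr_sqrtr; last first.
    by rewrite divr_ge0// mulr_ge0 ?ler0n// ?mulr_ge0// ltW.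
  by rewrite /u; field; rewrite !gt_eqF.
have r2U : r2' * U = eta2.
  rewrite -sqrtrM; last first.
    by rewrite divr_ge0// mulr_ge0 ?ler0n ?sqr_ge0// mulr_ge0 ?sqr_ge0// ltW.
  have -> : cu * eta2 ^+ 2 * n%:R / (q%:R * lam ^+ 2) * u = eta2 ^+ 2.
    by rewrite /u; field; rewrite !gt_eqF.
  by rewrite sqrtr_sqr ger0_norm// eta2_of_ge0.
have r20 : 0 <= r2' by exact: sqrtr_ge0.
have kU : k = Num.sqrt (cu / cl) * U.
  rewrite -sqrtrM ?divr_ge0 ?(ltW cl0) ?(ltW cu0)//.
  have -> : cu / cl * u = lam ^+ 2 * (q%:R / (cl * n%:R)).
    by rewrite /u; field; rewrite !gt_eqF.
  rewrite sqrtrM ?sqr_ge0// sqrtr_sqr gtr0_norm// sqrtrM ?ler0n// sqrtrV.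
    by rewrite /k; ring.
  by rewrite mulr_ge0 ?ler0n ?(ltW cl0).
have E : (x / U) ^+ 2 / 2 + 3 / 4 * (enorm w / U) ^+ 2 <=
  1 / 4 + r1' ^+ 2 + Num.sqrt (cu / cl) * Num.sqrt (1 + cu / cl) * (zt / U)
   + Num.sqrt (cu / cl) * r2' + x / U * Num.sqrt (cu / cl).
  rewrite -(ler_pM2r u0).
  have -> : ((x / U) ^+ 2 / 2 + 3 / 4 * (enorm w / U) ^+ 2) * u =
     x ^+ 2 / 2 + 3 / 4 * enorm w ^+ 2 by rewrite -U2; field; rewrite gt_eqF.
  have -> : (1 / 4 + r1' ^+ 2 + Num.sqrt (cu / cl) * Num.sqrt (1 + cu / cl) * (zt / U)
   + Num.sqrt (cu / cl) * r2' + x / U * Num.sqrt (cu / cl)) * u =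
   u / 4 + r1' ^+ 2 * u + k * Num.sqrt (1 + cu / cl) * zt + k * (r2' * U) + x * k.
   by rewrite kU -U2; field; rewrite gt_eqF.
  rewrite r12 r2U; apply: (le_trans E1).
  by rewrite !lerD2r lerD2l ler_wpM2l// ltW.
have zt0 : 0 <= zt by rewrite mulr_ge0 ?sqrtr_ge0.
exists w, cw; split => //.
- move=> A0A.
  have zt00 : zt = 0.
    rewrite /zt (_ : (~: A0 :\: A)%SET = finset.set0); last by apply/eqP; rewrite finset.setD_eq0.
    by rewrite big_set0 sqrtr0 mulr0.
  have := unit_bound_x C1 E; rewrite zt00 mul0r => /(_ erefl) hx.
  rewrite /M1 -/r1' -/r2'.
  have Aq : #|A| = (#|A :&: A0| + q)%N.
    rewrite -(cardsID A0 A) -qE; congr (_ + _)%N; apply: eq_card => j.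
    rewrite !inE; case: (boolP (j \in A0)) => //= jA0.
    by apply: (fintype.subsetP A0A); rewrite inE.
  have q4 : #|A :&: A0|%:R <= q%:R * (x / U) ^+ 2.
    rewrite -(ler_pM2r (exprn_gt0 2 lam0)) (le_trans E2)//.
    have -> : (x / U) ^+ 2 = x ^+ 2 / u by rewrite -U2; field; rewrite gt_eqF.
    by rewrite /u le_eqVlt; apply/orP; left; apply/eqP; field; rewrite !gt_eqF.
  rewrite Aq natrD (le_trans (lerD q4 (lexx _)))//.
  rewrite [leRHS]mulrC -{2}[q%:R]mulr1 -mulrDr ler_wpM2l ?ler0n//.
  by rewrite (le_trans (lerD hx (lexx _)))// le_eqVlt; apply/orP; left; apply/eqP; ring.
- move=> Aq; have zw : zt / U <= enorm w / U + r2'.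
    rewrite -(ler_pM2r U0) mulrDl r2U !divfK ?gt_eqF//; exact: E3.
  have wU : 0 <= enorm w / U by rewrite divr_ge0 ?enorm_ge0 ?(ltW U0).
  have zU : 0 <= zt / U by rewrite divr_ge0 ?(ltW U0).
  split.
    have := unit_bound_w C1 r20 E zw; rewrite -(ler_pM2r u0).
    rewrite (_ : (enorm w / U) ^+ 2 * u = enorm w ^+ 2); first by [].
    by rewrite -U2; field; rewrite gt_eqF.
  have := unit_bound_z C1 r20 wU zU E zw; rewrite -(ler_pM2r u0).
  rewrite (_ : (zt / U) ^+ 2 * u = cl * n%:R * \sum_(j in ~: A0 :\: A) beta j 0 ^+ 2); last first.
    have <- : zt ^+ 2 = cl * n%:R * \sum_(j in ~: A0 :\: A) beta j 0 ^+ 2.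
      rewrite exprMn !sqr_sqrtr ?mulr_ge0 ?ler0n ?(ltW cl0)//.
      by apply: sumr_ge0 => j _; rewrite sqr_ge0.
    by rewrite -U2; field; rewrite gt_eqF.
  have cln : 0 < cl * n%:R by rewrite mulr_gt0.
  rewrite -[leLHS]mulrC -ler_pdivlMr// => /le_trans; apply.
  rewrite /M3 -/r1' -/r2' /u le_eqVlt; apply/orP; left; apply/eqP; field.
  by rewrite !gt_eqF.
Qed.

End ModelBounds.

(** * Existence and path of the LASSO *)

Section ContinuousReal.
Context {R : realType} {T : topologicalType}.
Implicit Types f g : T -> R.

Lemma continuous_addR f g : continuous f -> continuous g ->
  continuous (fun x => f x + g x).
Proof. by move=> cf cg x; apply: cvgD; [exact: cf|exact: cg]. Qed.

Lemma continuous_oppR f : continuous f -> continuous (fun x => - f x).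
Proof. by move=> cf x; apply: cvgN; exact: cf. Qed.

Lemma continuous_mulR f g : continuous f -> continuous g ->
  continuous (fun x => f x * g x).
Proof. by move=> cf cg x; apply: cvgM; [exact: cf|exact: cg]. Qed.

Lemma continuous_sumR (I : Type) (r : seq I) (p : pred I) (F : I -> T -> R) :
  (forall i, continuous (F i)) -> continuous (fun x => \sum_(i <- r | p i) F i x).
Proof.
move=> cF; elim: r => [|i r IH].
  by under eq_fun do rewrite big_nil; move=> x; exact: cvg_cst.
under eq_fun do rewrite big_cons.
by case: (p i) => //; apply: continuous_addR.
Qed.

Lemma continuous_prodR (I : Type) (r : seq I) (p : pred I) (F : I -> T -> R) :
  (forall i, continuous (F i)) -> continuous (fun x => \prod_(i <- r | p i) F i x).
Proof.
move=> cF; elim: r => [|i r IH].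
  by under eq_fun do rewrite big_nil; move=> x; exact: cvg_cst.
under eq_fun do rewrite big_cons.
by case: (p i) => //; apply: continuous_mulR.
Qed.

Lemma continuous_cstR (a : R) : continuous (fun _ : T => a).
Proof. by move=> x; exact: cvg_cst. Qed.

Lemma continuous_normR f : continuous f -> continuous (fun x => `|f x|).
Proof. by move=> cf x; apply: cvg_norm; exact: cf. Qed.

End ContinuousReal.

Section Lasso.
Context {R : realType} {n p : nat}.
Variables (X : 'M[R]_(n, p)) (y : 'cV[R]_n).
Implicit Types (b c : 'cV[R]_p) (lam mu : R) (S : {set 'I_p}).

Lemma l1norm_ge0 b : 0 <= l1norm b.
Proof. by apply: sumr_ge0. Qed.

Lemma lasso_objE lam b :
  lasso_obj X y lam b = cdot (y - X *m b) (y - X *m b) / 2 + lam * l1norm b.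
Proof. by rewrite /lasso_obj enorm_sqr. Qed.

(** Variations of a single coordinate: a small step along the sign of the correlation gives the
    bound, and shrinking [b j 0] by a factor [1 - d] gives the equation. *)
Lemma lasso_kkt lam b : 0 <= lam -> lasso_sol X y lam b -> kkt X y lam b.
Proof.
move=> lam0 sol j; set r := y - X *m b; set g := (X^T *m r) j 0.
pose e : 'cV[R]_p := delta_mx j 0.
pose k := cdot (X *m e) (X *m e) / 2.
have k0 : 0 <= k by rewrite divr_ge0 ?cdot_ge0.
have gE : cdot r (X *m e) = g.
  rewrite cdotC cdot_mulmx /cdot (bigD1 j)//= big1 ?addr0.
    by rewrite mxE !eqxx mul1r.
  by move=> i /negbTE ij; rewrite mxE ij mul0r.
have var t : 0 <= - t * g + t ^+ 2 * k + lam * (`|b j 0 + t| - `|b j 0|).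
  have := sol (b + t *: e); rewrite !lasso_objE.
  have -> : y - X *m (b + t *: e) = r - t *: (X *m e).
    by rewrite /r mulmxDr scalemxAr opprD addrA.
  rewrite -/r (cdotBl r) !(cdotBr r) !cdotZl !cdotZr (cdotC (X *m e) r) gE.
  have -> : l1norm (b + t *: e) = l1norm b + (`|b j 0 + t| - `|b j 0|).
    rewrite /l1norm (bigD1 j)//= [in RHS](bigD1 j)//= !mxE !eqxx mulr1.
    rewrite (eq_bigr (fun i => `|b i 0|)); first by ring.
    by move=> i /negbTE ij; rewrite !mxE ij mulr0 addr0.
  rewrite -subr_ge0 /k; set kk := cdot (X *m e) _.
  by congr (0 <= _); field.
have gl : `|g| <= lam.
  rewrite leNgt; apply/negP => lg.
  have tri t : `|b j 0 + t| - `|b j 0| <= `|t|.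
    by rewrite lerBlDl ler_normD.
  (* [k + 1] in place of [k] allows for a zero column. *)
  pose d := (`|g| - lam) / (2 * (k + 1)).
  have k1 : 0 < k + 1 by rewrite ltr_pwDr.
  have d0 : 0 < d by rewrite divr_gt0 ?subr_gt0 ?mulr_gt0.
  have h := var (d * Num.sg g).
  have e1 : - (d * Num.sg g) * g = - d * `|g| by rewrite mulNr mulNr -mulrA -normrEsg.
  have n1 : `|d * Num.sg g| <= d.
    by rewrite normrM (gtr0_norm d0) ler_piMr ?(ltW d0)// normr_sg; case: (g != 0).
  have e2 : (d * Num.sg g) ^+ 2 * k <= d ^+ 2 * k.
    rewrite ler_wpM2r// -[leLHS]real_normK ?num_real// ler_pXn2r ?nnegrE//.
    exact: ltW.
  have e3 : lam * (`|b j 0 + d * Num.sg g| - `|b j 0|) <= lam * d.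
    by rewrite ler_wpM2l// (le_trans (tri _)).
  have e4 : d * (2 * (k + 1)) = `|g| - lam by rewrite /d divfK// gt_eqF// mulr_gt0.
  rewrite e1 in h.
  have : 0 <= d * (lam - `|g| + d * k) by lra.
  rewrite pmulr_rge0// => h'.
  have : d * k + 2 * d <= 0 by lra.
  have : 0 <= d * k by rewrite mulr_ge0 ?(ltW d0).
  by lra.
split => //; apply/eqP; rewrite eq_le; apply/andP; split.
  by rewrite (le_trans (ler_norm _))// normrM mulrC ler_wpM2r.
rewrite leNgt; apply/negP => lt.
pose a := lam * `|b j 0| - b j 0 * g.
pose m := b j 0 ^+ 2 * k.
have a0 : 0 < a by rewrite subr_gt0.
have m0 : 0 <= m by rewrite mulr_ge0 ?sqr_ge0.
pose d := Num.min (1 / 2) (a / (2 * (m + 1))).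
have m1 : 0 < 2 * (m + 1) by rewrite mulr_gt0// ltr_pwDr.
have d0 : 0 < d by rewrite lt_min !divr_gt0.
have d1 : d <= 1 / 2 by rewrite /d ge_min lexx.
have dm : d * (2 * (m + 1)) <= a.
  by rewrite -ler_pdivlMr// /d ge_min lexx orbT.
have := var (- d * b j 0).
have -> : b j 0 + - d * b j 0 = (1 - d) * b j 0 by ring.
rewrite normrM (@ger0_norm _ (1 - d)); last lra.
have -> : - (- d * b j 0) * g + (- d * b j 0) ^+ 2 * k +
   lam * ((1 - d) * `|b j 0| - `|b j 0|) = d * (d * m - a).
  by rewrite /m /a; ring.
rewrite pmulr_rge0// => h.
have : 0 <= d * m by rewrite mulr_ge0 ?(ltW d0).
lra.
Qed.

Lemma kkt_dot lam b : kkt X y lam b ->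
  cdot (X *m b) (y - X *m b) = lam * l1norm b.
Proof.
move=> K; rewrite cdot_mulmx /cdot /l1norm mulr_sumr.
by apply: eq_bigr => j _; case: (K j).
Qed.

Lemma kkt_dot_le lam b c : kkt X y lam b ->
  cdot (X *m c) (y - X *m b) <= lam * l1norm c.
Proof.
move=> K; rewrite cdot_mulmx /cdot /l1norm mulr_sumr.
apply: ler_sum => j _; rewrite (le_trans (ler_norm _))// normrM mulrC.
by rewrite ler_wpM2r//; case: (K j).
Qed.

(** Two uses: for [lam = mu] all solutions have the same fit, hence the same equicorrelation set;
    for different levels the fit is Hoelder continuous of order 1/2 while the l1 norms stay
    bounded. *)
Lemma kkt_fit lam mu b c : kkt X y lam b -> kkt X y mu c ->
  cdot (X *m (b - c)) (X *m (b - c)) <= (lam - mu) * (l1norm c - l1norm b).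
Proof.
move=> Kb Kc.
have h1 := kkt_dot Kb; have h2 := kkt_dot Kc.
have h3 := kkt_dot_le c Kb; have h4 := kkt_dot_le b Kc.
have -> : cdot (X *m (b - c)) (X *m (b - c)) =
  cdot (X *m c) (y - X *m b) - cdot (X *m b) (y - X *m b)
  + cdot (X *m b) (y - X *m c) - cdot (X *m c) (y - X *m c).
  by rewrite mulmxBr !cdotBl !cdotBr; ring.
rewrite h1 h2; lra.
Qed.

Lemma lasso_l1_le lam b : lasso_sol X y lam b ->
  lam * l1norm b <= cdot y y / 2.
Proof.
move=> /(_ 0); rewrite !lasso_objE mulmx0 subr0.
have -> : l1norm (0 : 'cV[R]_p) = 0.
  by rewrite /l1norm big1// => j _; rewrite mxE normr0.
rewrite mulr0 addr0 => h; have := cdot_ge0 (y - X *m b); lra.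
Qed.

(** Outside the cube given by [B] the penalty alone exceeds the objective at 0, so a minimum over
    the compact cube is global. The support constraint serves [small_sol_limit]. *)
Lemma lasso_restricted_exists lam S : 0 < lam ->
  exists2 b, supported S b &
    forall b', supported S b' -> lasso_obj X y lam b <= lasso_obj X y lam b'.
Proof.
move=> lam0.
pose B := cdot y y / 2 / lam.
have B0 : 0 <= B by rewrite divr_ge0 ?divr_ge0 ?cdot_ge0 ?(ltW lam0).
pose ext (v : 'rV[R]_p) := restrict S v^T.
pose f v := lasso_obj X y lam (ext v).
pose K : set 'rV[R]_p := [set v | forall i, `[- B, B]%classic (v ord0 i)].
have K0 : K !=set0.
  exists 0 => i /=; rewrite mxE in_itv/= B0 andbT; lra.
have cK : compact K.
  apply: (@rV_compact R p (fun=> `[- B, B]%classic)) => i; exact: segment_compact.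
have cf : continuous f.
  have cx j : continuous (fun v : 'rV[R]_p => ext v j 0).
    rewrite (_ : (fun v => _) = fun v : 'rV[R]_p => if j \in S then v 0 j else 0).
      by case: (j \in S); [exact: (@coord_continuous R 1 p 0 j)|exact: continuous_cstR].
    by apply/funext => v; rewrite !mxE.
  rewrite (_ : f = fun v => (\sum_i (y i 0 - \sum_j X i j * ext v j 0)
     * (y i 0 - \sum_j X i j * ext v j 0)) / 2 + lam * \sum_j `|ext v j 0|); last first.
    apply/funext => v; rewrite /f lasso_objE; congr (_ / 2 + _).
    by apply: eq_bigr => i _; rewrite !mxE.
  have cs i : continuous (fun v => y i 0 - \sum_j X i j * ext v j 0).
    apply: continuous_addR; first exact: continuous_cstR.
    apply: continuous_oppR; apply: continuous_sumR => j.
    by apply: continuous_mulR => //; exact: continuous_cstR.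
  apply: continuous_addR.
    apply: continuous_mulR; last exact: continuous_cstR.
    by apply: continuous_sumR => i; apply: continuous_mulR.
  apply: continuous_mulR; first exact: continuous_cstR.
  by apply: continuous_sumR => j; exact: continuous_normR.
have [v vK vmin] := compact_EVT_min K0 cK (continuous_subspaceT cf).
exists (ext v); first exact: restrict_supported.
move=> b' b'S.
have extE : ext b'^T = b'.
  apply/matrixP => i j; rewrite ord1 /ext trmxK mxE.
  by case: ifPn => // /b'S ->.
have [bB|/existsNP[i /negP iB]] := pselect (forall i, `|b' i 0| <= B).
  have := vmin b'^T; rewrite /f extE; apply; rewrite inE /K/= => i.
  by rewrite mxE in_itv/= -ler_norml.
have := vmin 0; rewrite inE => h; apply: (le_trans (h _)) => {h}.
  move=> i' /=; rewrite mxE in_itv/= B0 andbT; lra.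
have ext0 : ext 0 = 0.
  by apply/matrixP => i' j; rewrite !mxE; case: ifP.
rewrite /f ext0 !lasso_objE mulmx0 subr0.
have -> : l1norm (0 : 'cV[R]_p) = 0.
  by rewrite /l1norm big1// => j _; rewrite mxE normr0.
rewrite mulr0 addr0 -ltNge in iB *.
have bi : `|b' i 0| <= l1norm b' by rewrite /l1norm (bigD1 i)//= lerDl sumr_ge0.
have yE : cdot y y / 2 = lam * B by rewrite /B [RHS]mulrC divfK// gt_eqF.
rewrite yE (@le_trans _ _ (lam * l1norm b'))//.
  by rewrite ler_wpM2l ?(ltW lam0)// (le_trans (ltW iB)).
by rewrite lerDr divr_ge0 ?cdot_ge0.
Qed.

Lemma lasso_exists lam : 0 < lam -> exists b, lasso_sol X y lam b.
Proof.
move=> /(@lasso_restricted_exists _ [set: 'I_p]%SET)[b _ h]; exists b => b'.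
by apply: h => j; rewrite inE.
Qed.

Lemma lasso_sol0 lam : (forall j, `|(X^T *m y) j 0| <= lam) ->
  lasso_sol X y lam 0.
Proof.
move=> h b'; rewrite !lasso_objE mulmx0 subr0.
have -> : l1norm (0 : 'cV[R]_p) = 0.
  by rewrite /l1norm big1// => j _; rewrite mxE normr0.
rewrite cdotBl !cdotBr (cdotC y (X *m b')).
have : cdot (X *m b') y <= lam * l1norm b'.
  rewrite cdot_mulmx /cdot /l1norm mulr_sumr; apply: ler_sum => j _.
  by rewrite (le_trans (ler_norm _))// normrM mulrC ler_wpM2r.
by have := cdot_ge0 (X *m b'); lra.
Qed.

End Lasso.

Section LassoPath.
Context {R : realType} {n p : nat}.
Variables (X : 'M[R]_(n, p)) (y : 'cV[R]_n) (U : {set 'I_p}) (m : nat) (lam : R).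
Implicit Types (b c : 'cV[R]_p) (mu l : R).
Hypothesis lam0 : 0 < lam.
Hypothesis Um : (#|U| <= m)%N.

Definition equicorr mu b : {set 'I_p} :=
  [set j | `|(X^T *m (y - X *m b)) j 0| == mu].

Lemma selected_equicorr mu b : 0 < mu -> kkt X y mu b ->
  selected b \subset equicorr mu b.
Proof.
move=> mu0 K; apply/fintype.subsetP => j; rewrite !inE => bj.
have [_ /(congr1 Num.norm)] := K j.
rewrite !normrM normr_id (gtr0_norm mu0) mulrC => /mulIf -> //.
by rewrite normr_eq0.
Qed.

(** Asks for one solution only, as solutions need not be unique; [lasso_path_selected] passes to all
    of them through the common fit. *)
Definition small_sol mu := exists2 b, lasso_sol X y mu b &
  (#|selected b :|: U| <= m)%N.

(* The equicorrelation set has at least one slot left, so that small solutions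
   stay small under a slight decrease of the penalty. *)
Hypothesis slack : forall mu b, lam <= mu -> lasso_sol X y mu b ->
  (#|selected b :|: U| <= m)%N -> (#|equicorr mu b :|: U| < m)%N.

(** Finitely many supports replace compactness: the candidate is the best minimiser over all small
    supports. If some [b'] beat it at [l0], then [b'] would also beat the small solutions at levels
    just above [l0]. *)
Lemma small_sol_limit l0 : 0 < l0 ->
  (forall e, 0 < e -> exists2 l, l0 < l < l0 + e & small_sol l) -> small_sol l0.
Proof.
move=> l00 lim.
have /choice[bS bSP] : forall S : {set 'I_p}, exists b, supported S b /\
    forall b', supported S b' -> lasso_obj X y l0 b <= lasso_obj X y l0 b'.
  by move=> S; have [b] := lasso_restricted_exists X y S l00; exists b.
have P0 : (#|finset.set0 :|: U| <= m)%N by rewrite finset.set0U.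
pose S0 := [arg min_(S < (finset.set0 : {set 'I_p}) | (#|S :|: U| <= m)%N)
  lasso_obj X y l0 (bS S)]%O.
have [S0m S0min] : (#|S0 :|: U| <= m)%N /\ forall S : {set 'I_p},
    (#|S :|: U| <= m)%N -> lasso_obj X y l0 (bS S0) <= lasso_obj X y l0 (bS S).
  rewrite /S0; case: (@Order.TotalTheory.arg_minP _ R _ finset.set0
    (fun S => (#|S :|: U| <= m)%N) (fun S => lasso_obj X y l0 (bS S)) P0).
  by move=> S Sm Smin; split.
exists (bS S0); last first.
  apply: leq_trans S0m; apply: subset_leq_card; apply: finset.setSU.
  apply/fintype.subsetP => j; rewrite inE => bj; apply/negPn/negP => /(proj1 (bSP S0)) h.
  by rewrite h eqxx in bj.
move=> b'; rewrite leNgt; apply/negP => lt.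
(* Raising the level by less than [e] costs [b'] less than its advantage. *)
pose e := (lasso_obj X y l0 (bS S0) - lasso_obj X y l0 b') / (1 + l1norm b').
have n1 : 0 < 1 + l1norm b' by rewrite ltr_pwDl// l1norm_ge0.
have e0 : 0 < e by rewrite divr_gt0// subr_gt0.
have [l /andP[l0l le] [b bsol bm]] := lim e e0.
have h1 := S0min _ bm.
have bb : supported (selected b) b by move=> j; rewrite inE negbK => /eqP.
have h2 := proj2 (bSP (selected b)) b bb.
have h3 : lasso_obj X y l0 b <= lasso_obj X y l b.
  by rewrite !lasso_objE lerD2l ler_wpM2r ?l1norm_ge0// ltW.
have h4 := bsol b'.
have h5 : lasso_obj X y l b' = lasso_obj X y l0 b' + (l - l0) * l1norm b'.
  by rewrite !lasso_objE; ring.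
have h6 : (l - l0) * (1 + l1norm b') < lasso_obj X y l0 (bS S0) - lasso_obj X y l0 b'.
  by rewrite -ltr_pdivlMr// -/e ltrBlDl.
have h7 : 0 < l - l0 by rewrite subr_gt0.
lra.
Qed.

(** Correlations off the equicorrelation set at [l0] stay away from the level when the fit moves a
    little. Supports just below [l0] thus lie in that set, whose size is controlled by [slack]. *)
Lemma small_sol_open l0 : lam <= l0 -> small_sol l0 ->
  exists2 e, 0 < e & forall l, lam <= l -> l0 - e < l -> l <= l0 -> small_sol l.
Proof.
move=> laml0 [b0 b0sol b0m]; have l00 : 0 < l0 by apply: lt_le_trans lam0 _.
have Em := slack laml0 b0sol b0m.
have K0 := lasso_kkt (ltW l00) b0sol.
pose g c j := (X^T *m (y - X *m c)) j 0.
pose Y := cdot y y / 2 / lam.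
have Y0 : 0 <= Y by rewrite divr_ge0 ?divr_ge0 ?cdot_ge0 ?(ltW lam0).
have fit l b : lam <= l -> l <= l0 -> lasso_sol X y l b ->
    cdot (X *m (b0 - b)) (X *m (b0 - b)) <= (l0 - l) * Y.
  move=> laml ll0 bsol; have l_0 : 0 < l by apply: lt_le_trans lam0 _.
  have Kb := lasso_kkt (ltW l_0) bsol.
  apply: (le_trans (kkt_fit K0 Kb)); rewrite ler_wpM2l ?subr_ge0//.
  have h := lasso_l1_le bsol; have h0 := l1norm_ge0 b0; have h1 := l1norm_ge0 b.
  rewrite (@le_trans _ _ (l1norm b))//; first by rewrite gerBl.
  rewrite /Y ler_pdivlMr// (le_trans _ h)// mulrC ler_wpM2r//.
have loc j : exists2 e, 0 < e & (j \notin equicorr l0 b0 -> forall l b, lam <= l ->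
    l0 - e < l -> l <= l0 -> lasso_sol X y l b -> `|g b j| != l).
  have [jE|jE] := boolP (j \in equicorr l0 b0); first by exists 1.
  have gj : 0 < l0 - `|g b0 j|.
    rewrite subr_gt0 lt_neqAle; case: (K0 j) => -> _; rewrite andbT.
    by move: jE; rewrite inE.
  pose xj := col j X; pose k := Num.sqrt (cdot xj xj * Y).
  have k0 : 0 <= k by exact: sqrtr_ge0.
  (* The fit moves by at most a multiple of the root of the change in level, hence the radius
     [h ^+ 2]. In [2 + k], [k] pays for the correlation, 1 for the level as h^2 <= h, and 1 makes
     the inequality strict. *)
  pose h := Num.min 1 ((l0 - `|g b0 j|) / (2 + k)).
  have k2 : 0 < 2 + k by rewrite ltr_pwDl.
  have h0 : 0 < h by rewrite lt_min ltr01 divr_gt0.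
  have h1 : h <= 1 by rewrite /h ge_min lexx.
  have hk : h * (2 + k) <= l0 - `|g b0 j|.
    by rewrite -ler_pdivlMr// /h ge_min lexx orbT.
  exists (h ^+ 2); first by rewrite exprn_gt0.
  move=> _ l b laml lel ll0 bsol.
  have ft := fit l b laml ll0 bsol.
  have dg : g b j - g b0 j = cdot xj (X *m (b0 - b)).
    have xjE v : cdot xj v = (X^T *m v) j 0.
      by rewrite [RHS]mxE; apply: eq_bigr => i _; rewrite !mxE.
    rewrite /g -!xjE -cdotBr; congr cdot.
    by rewrite mulmxBr opprB addrC addrA subrK.
  have dgk : `|g b j - g b0 j| <= h * k.
    rewrite dg -(ler_pXn2r (n := 2))// ?nnegrE ?normr_ge0 ?mulr_ge0 ?(ltW h0)//.
    rewrite real_normK ?num_real// (le_trans (cdot_sqr_le _ _))//.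
    rewrite exprMn sqr_sqrtr; last exact: mulr_ge0 (cdot_ge0 _) Y0.
    rewrite mulrCA ler_wpM2l ?cdot_ge0// (le_trans ft)// ler_wpM2r//.
    by rewrite lerBlDr -lerBlDl ltW.
  have tri : `|g b j| <= `|g b0 j| + `|g b j - g b0 j|.
    by rewrite -{1}[g b j](subrK (g b0 j)) addrC ler_normD.
  apply/negP => /eqP gl.
  have hh : h ^+ 2 <= h by rewrite expr2 ler_piMr// ltW.
  have hk2 : 2 * h + h * k <= l0 - `|g b0 j| by rewrite (mulrC 2) -mulrDr.
  rewrite gl in tri; have := le_trans tri (lerD (lexx _) dgk).
  clear -hk2 hh lel h0; move: (`|g b0 j|) (h * k) (h ^+ 2) hk2 hh lel => a t u.
  lra.
have /choice[e eP] : forall j, exists e, 0 < e /\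
    (j \notin equicorr l0 b0 -> forall l b, lam <= l ->
    l0 - e < l -> l <= l0 -> lasso_sol X y l b -> `|g b j| != l).
  by move=> j; have [e e0 eP] := loc j; exists e.
pose d := \big[Num.min/1]_j e j.
exists d.
  rewrite /d; apply: (big_ind (fun x => 0 < x)) => // [x z x0 z0|j _].
    by rewrite lt_min x0.
  by case: (eP j).
move=> l laml lel ll0; have l_0 : 0 < l by apply: lt_le_trans lam0 _.
have [b bsol] := lasso_exists X y l_0; exists b => //.
apply: leq_trans (ltnW Em); apply: subset_leq_card; apply: finset.setSU.
apply: fintype.subset_trans (selected_equicorr l_0 (lasso_kkt (ltW l_0) bsol)) _.
apply/fintype.subsetP => j; rewrite inE => gj; apply: contraLR gj => jE.
have [_ /(_ jE l b laml)] := eP j; apply => //.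
apply: le_lt_trans lel; rewrite lerD2l lerN2.
by rewrite /d (bigD1 j)//= ge_min lexx.
Qed.

Lemma small_sol_large : exists L, forall l, L <= l -> small_sol l.
Proof.
exists (\sum_j `|(X^T *m y) j 0|) => l Ll; exists 0.
  by apply: lasso_sol0 => j; rewrite (le_trans _ Ll)// (bigD1 j)//= lerDl sumr_ge0.
rewrite (_ : selected 0 = finset.set0) ?finset.set0U//.
by apply/setP => j; rewrite !inE mxE eqxx.
Qed.

(** The supremum of the bad levels is good, being a limit of good levels from above; but then all
    levels just below it, down to [lam], are good as well, so no bad level comes near it. *)
Lemma lasso_path_small : small_sol lam.
Proof.
apply: contrapT => bad.
have [L Lgood] := small_sol_large.
pose B := [set l | lam <= l /\ ~ small_sol l].
have Bsup : has_sup B.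
  split; first by exists lam.
  by exists L => l [_ bl]; rewrite leNgt; apply/negP => /ltW /Lgood.
have laml0 : lam <= sup B by apply: sup_upper_bound.
have l00 : 0 < sup B by apply: lt_le_trans lam0 _.
have good l : sup B < l -> small_sol l.
  move=> ltl; apply: contrapT => bl.
  have : l <= sup B by apply: sup_upper_bound => //; split => //; rewrite (le_trans laml0)// ltW.
  by rewrite leNgt ltl.
have good0 : small_sol (sup B).
  apply: small_sol_limit => // e e0; exists (sup B + e / 2).
    by rewrite ltrDl ltrD2l divr_gt0//= ltr_pdivrMr// mulr_natr mulr2n ltrDl.
  by apply: good; rewrite ltrDl divr_gt0.
have [e e0 eP] := small_sol_open laml0 good0.
have [l [laml bl] ltl] := sup_adherent e0 Bsup.
by apply: (bl); apply: eP => //; apply: (sup_upper_bound Bsup); split.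
Qed.

Lemma lasso_path_selected b : lasso_sol X y lam b -> (#|equicorr lam b :|: U| < m)%N.
Proof.
move=> bsol; have [c csol cm] := lasso_path_small.
have Kb := lasso_kkt (ltW lam0) bsol; have Kc := lasso_kkt (ltW lam0) csol.
have := slack (lexx _) csol cm.
have := kkt_fit Kb Kc; rewrite subrr mul0r => h.
have /eqP : cdot (X *m (b - c)) (X *m (b - c)) = 0.
  by apply/le_anti; rewrite h cdot_ge0.
rewrite cdot_eq0 mulmxBr subr_eq0 => /eqP XbXc.
by rewrite /equicorr XbXc.
Qed.

End LassoPath.

(** * Admissible penalty levels and assembly of the bounds *)

Section PenaltyLevel.
Context {R : realType}.
Variables (n q : nat) (eta1 eta2 cl cu : R).
Hypotheses (cu0 : 0 < cu) (cl0 : 0 < cl) (eta10 : 0 <= eta1) (q_gt0 : (1 <= q)%N).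

Let q0 : 0 < q%:R :> R. Proof. by rewrite ltr0n. Qed.

Lemma M1_decreasing lam mu : 0 < lam -> lam <= mu ->
  M1 n q eta1 eta2 cl cu mu <= M1 n q eta1 eta2 cl cu lam.
Proof.
move=> lam0 lm; have mu0 : 0 < mu by apply: lt_le_trans lam0 _.
have h1 : r1 n q eta1 cu mu <= r1 n q eta1 cu lam.
  rewrite ler_wsqrtr// ler_wpM2l//; first by rewrite !mulr_ge0 ?ler0n// ltW.
  by rewrite lef_pV2 ?posrE ?mulr_gt0// ler_wpM2l// ltW.
have h2 : r2 n q eta2 cu mu <= r2 n q eta2 cu lam.
  rewrite ler_wsqrtr// ler_wpM2l//.
    by rewrite mulr_ge0 ?ler0n// mulr_ge0 ?sqr_ge0// ltW.
  rewrite lef_pV2 ?posrE ?mulr_gt0 ?exprn_gt0// ler_wpM2l ?(ltW q0)//.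
  by rewrite ler_pXn2r// nnegrE ltW.
have h3 : r1 n q eta1 cu mu ^+ 2 <= r1 n q eta1 cu lam ^+ 2.
  by rewrite ler_pXn2r// nnegrE sqrtr_ge0.
rewrite /M1 lerD2r lerD//; first by rewrite lerD2l ler_wpM2l.
by rewrite ler_wpM2l// mulr_ge0// sqrtr_ge0.
Qed.

(** [r1 ^+ 2] and [r2] scale as the inverse of the level, and the constant part of [M1] only grows
    under the factor. This quantifies the continuity of [M1] from the right. *)
Lemma M1_scale (lam e : R) : 0 < lam -> 0 <= eta2 -> 0 < e ->
  M1 n q eta1 eta2 cl cu lam <= (1 + e) * M1 n q eta1 eta2 cl cu ((1 + e) * lam).
Proof.
move=> lam0 eta20 e0; have e1 : 0 < 1 + e by rewrite addr_gt0.
have s1 : r1 n q eta1 cu lam ^+ 2 = (1 + e) * r1 n q eta1 cu ((1 + e) * lam) ^+ 2.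
  rewrite !sqr_sqrtr.
  - by field; rewrite !gt_eqF.
  - by rewrite divr_ge0 ?mulr_ge0 ?ler0n// ltW.
  - by rewrite divr_ge0 ?mulr_ge0 ?ler0n ?(ltW e1)// ltW.
have s2 : r2 n q eta2 cu lam = (1 + e) * r2 n q eta2 cu ((1 + e) * lam).
  rewrite -[X in X * _](@gtr0_norm _ (1 + e))// -sqrtr_sqr -sqrtrM ?sqr_ge0//.
  by congr Num.sqrt; field; rewrite !gt_eqF.
rewrite /M1 s1 s2; set u := r1 _ _ _ _ _ ^+ 2; set v := r2 _ _ _ _ _.
have C0 : 0 <= cu / cl by rewrite divr_ge0 ?ltW.
rewrite -subr_ge0.
have -> : (1 + e) * (2 + 4 * u + 4 * Num.sqrt (cu / cl) * v + 4 * (cu / cl)) -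
  (2 + 4 * ((1 + e) * u) + 4 * Num.sqrt (cu / cl) * ((1 + e) * v) + 4 * (cu / cl))
  = e * (2 + 4 * (cu / cl)) by ring.
by rewrite mulr_ge0 ?(ltW e0)// addr_ge0// mulr_ge0.
Qed.

(** [lam] may equal the infimum, whose membership in the set is not given. All larger levels satisfy
    the inequality, and by [M1_scale] a violation at [lam] would persist at slightly larger
    levels. *)
Lemma lambda_star_M1 (qs : nat) (lam : R) : 0 < lam -> 0 <= eta2 -> (1 <= qs)%N ->
  (lambda_star n q eta1 eta2 cl cu qs <= lam%:E)%E ->
  M1 n q eta1 eta2 cl cu lam * q%:R + 1 <= qs%:R.
Proof.
move=> lam0 eta20 qs1 hstar.
have above l' : lam < l' -> M1 n q eta1 eta2 cl cu l' * q%:R + 1 <= qs%:R.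
  move=> ll'; have : (lambda_star n q eta1 eta2 cl cu qs < l'%:E)%E.
    by rewrite (le_lt_trans hstar)// lte_fin.
  move=> /ereal_inf_lt [_ [l [l0 lM] <-]]; rewrite lte_fin => /ltW llt.
  by apply: le_trans lM; rewrite lerD2r ler_wpM2r ?ler0n// M1_decreasing.
rewrite leNgt; apply/negP => lt.
set x := M1 n q eta1 eta2 cl cu lam * q%:R in lt.
pose m : R := qs%:R - 1.
have m0 : 0 <= m by rewrite subr_ge0 ler1n.
have mx : m < x by rewrite ltrBlDr.
pose e := (x - m) / (2 * (m + 1)).
have m1 : 0 < 2 * (m + 1) by rewrite mulr_gt0// ltr_wpDl.
have e0 : 0 < e by rewrite divr_gt0// subr_gt0.
have h := above ((1 + e) * lam) _.
have {}h : M1 n q eta1 eta2 cl cu ((1 + e) * lam) * q%:R <= m.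
  by rewrite lerBrDr h// mulrDl mul1r ltrDl mulr_gt0.
have h2 : x <= (1 + e) * m.
  apply: le_trans (ler_wpM2l _ h); last by rewrite addr_ge0// ltW.
  by rewrite mulrA ler_wpM2r ?ler0n// M1_scale.
have em : e * (2 * (m + 1)) = x - m by rewrite divfK// gt_eqF.
have : 0 <= e * m by rewrite mulr_ge0// ltW.
lra.
Qed.

End PenaltyLevel.

Section Assemble.
Context {R : realType} {n p : nat}.

(** [proj_mx] determines the splitting once the two row spaces meet trivially: a vector in both is
    orthogonal to itself. *)
Lemma orthproj_compl (X : 'M[R]_(n, p)) (A : {set 'I_p}) (v w : 'cV[R]_n)
    (c : 'cV[R]_p) :
  supported A c -> (forall j, j \in A -> (X^T *m w) j 0 = 0) ->
  w = v - X *m c -> (1%:M - orthproj (colsin X A)) *m v = w.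
Proof.
move=> cA worth wE; set B := colsin X A.
have cap0 : (<<B^T>> :&: kermx B)%MS = 0.
  apply/eqP/rowV0P => u; rewrite sub_capmx genmxE => /andP[/submxP[z uz] /sub_kermxP uB].
  have : cdot u^T u^T = 0.
    have -> : cdot u^T u^T = (u *m u^T) 0 0.
      by rewrite mxE; apply: eq_bigr => i _; rewrite !mxE.
    by rewrite {2}uz trmx_mul trmxK mulmxA uB mul0mx mxE.
  by move=> /eqP; rewrite cdot_eq0 => /eqP /(congr1 trmx); rewrite trmxK trmx0.
have XB : X *m c = B *m (\col_k c (enum_val k) 0).
  apply/matrixP => i j; rewrite ord1 !mxE.
  under [RHS]eq_bigr do rewrite !mxE.
  rewrite -(big_enum_val (A := mem A) (fun k => X i k * c k 0)) /= [RHS]big_mkcond/=.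
  by apply: eq_bigr => k _; case: ifPn => // /cA ->; rewrite mulr0.
have wB : w^T *m B = 0.
  apply/matrixP => i k; rewrite ord1 !mxE.
  have := worth _ (enum_valP k); rewrite mxE => h.
  by rewrite -[RHS]h; apply: eq_bigr => j _; rewrite !mxE mulrC.
have vE : v = X *m c + w by rewrite wE addrC subrK.
rewrite mulmxBl mul1mx.
have -> : orthproj B *m v = X *m c.
  apply: trmx_inj; rewrite trmx_mul /orthproj trmxK {1}vE linearD/= mulmxDl.
  rewrite proj_mx_id ?proj_mx_0 ?addr0//; first by apply/sub_kermxP.
  by rewrite genmxE XB trmx_mul submxMl.
by rewrite wE.
Qed.

Variables (X : 'M[R]_(n, p)) (beta : 'cV[R]_p) (eps : 'cV[R]_n) (lam : R).
Variables (A0 : {set 'I_p}) (qs q : nat) (cl cu eta1 : R).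
Hypotheses (qs_gt0 : (1 <= qs)%N) (qs_le : (qs <= p)%N).
Hypotheses (cl0 : 0 < cl) (clu : cl < cu) (SR : sparse_riesz X qs cl cu).
Hypotheses (q_gt0 : (1 <= q)%N) (qE : #|~: A0| = q).
Hypotheses (lam0 : 0 < lam).
Hypothesis eta1E : \sum_(j in A0) `|beta j 0| <= eta1.
Let eta2 := eta2_of X beta A0.
Let y := X *m beta + eps.

Hypothesis noise : forall mu (A : {set 'I_p}), lam <= mu -> (#|A| <= qs)%N ->
  noise_ok X beta eps mu cu A.
Hypothesis M1q : M1 n q eta1 eta2 cl cu lam * q%:R + 1 <= qs%:R.

Let n0 : 0 < n%:R :> R := sparse_riesz_n_gt0 qs_gt0 qs_le cl0 SR.
Let cu0 : 0 < cu := lt_trans cl0 clu.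
Let q0 : 0 < q%:R :> R. Proof. by rewrite ltr0n. Qed.
Let eta10 : 0 <= eta1. Proof. by rewrite (le_trans _ eta1E)// sumr_ge0. Qed.

Let qqs : (q <= qs)%N.
Proof.
rewrite -(ler_nat R) (le_trans _ M1q)// (@le_trans _ _ (M1 n q eta1 eta2 cl cu lam * q%:R))//.
  rewrite ler_peMl ?ler0n//; apply: (@le_trans _ _ 2); first by rewrite ler1n.
  rewrite /M1; apply: ler_wpDr.
    by rewrite mulr_ge0 ?divr_ge0 ?(ltW cl0) ?(ltW cu0).
  apply: ler_wpDr; first by rewrite mulr_ge0 ?mulr_ge0 ?sqrtr_ge0.
  by apply: ler_wpDr => //; rewrite mulr_ge0 ?sqr_ge0.
by rewrite lerDl.
Qed.

(** Bounds the size at every level [mu] of the path by [M1] at the final level [lam], through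
    monotonicity of [M1]; by [M1q] the bound is at most [qs - 1]. *)
Lemma model_size_lt mu b (A : {set 'I_p}) : lam <= mu -> lasso_sol X y mu b -> (#|A| <= qs)%N ->
  selected b :|: ~: A0 \subset A -> A \subset equicorr X y mu b :|: ~: A0 ->
  #|A|%:R <= M1 n q eta1 eta2 cl cu lam * q%:R.
Proof.
move=> lm bsol Aqs SA AE; have mu0 : 0 < mu by apply: lt_le_trans lam0 _.
have K := lasso_kkt (ltW mu0) bsol.
have bA : supported A b.
  move=> j jA; apply/eqP/negPn/negP => bj; move/negP: jA; apply.
  by apply: (fintype.subsetP SA); rewrite !inE bj.
have gA j : j \in A -> j \in A0 -> `|(X^T *m (X *m beta + eps - X *m b)) j 0| = mu.
  move=> /(fintype.subsetP AE); rewrite !inE => /orP[/eqP//|/negP h /h].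
  by [].
have [w [cw [_ _ h _]]] := model_bounds qs_gt0 qs_le cl0 clu SR q_gt0 qE qqs mu0
  K bA Aqs gA (noise lm Aqs) eta1E.
apply: le_trans (h _) _.
  by apply: fintype.subset_trans SA; exact: finset.subsetUr.
by rewrite ler_wpM2r ?ler0n// (M1_decreasing _ _ _ cu0 eta10 q_gt0 lam0 lm).
Qed.

Lemma lasso_selection_bounds betahat : lasso_sol X y lam betahat ->
  [/\ (qhat betahat <= qtilde A0 betahat)%N /\
      (qtilde A0 betahat)%:R <= M1 n q eta1 eta2 cl cu lam * q%:R,
      Btilde X beta betahat ^+ 2
        <= M2 n q eta1 eta2 cl cu lam * (q%:R * lam ^+ 2 / (cu * n%:R)) &
      zeta2 A0 beta betahat ^+ 2
        <= M3 n q eta1 eta2 cl cu lam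
             * (q%:R * lam ^+ 2 / (cu * cl * n%:R ^+ 2))].
Proof.
move=> bsol.
have Uqs : (#|~: A0| <= qs)%N by rewrite qE.
have slack mu b : lam <= mu -> lasso_sol X y mu b ->
    (#|selected b :|: ~: A0| <= qs)%N -> (#|equicorr X y mu b :|: ~: A0| < qs)%N.
  move=> lm sol Sm; rewrite ltnNge; apply/negP => Em.
  have mu0 : 0 < mu by apply: lt_le_trans lam0 _.
  have SE : selected b :|: ~: A0 \subset equicorr X y mu b :|: ~: A0.
    by apply: finset.setSU; apply: selected_equicorr => //; apply: lasso_kkt (ltW mu0) sol.
  (* If the larger union had [qs] or more elements, some set between the two would have exactly
     [qs], against the bound [qs - 1]. *)
  have [|A /andP[SA AE] Aqs] := @exists_superset_card _ _ _ qs SE; first by rewrite Sm.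
  have := model_size_lt lm sol _ SA AE; rewrite Aqs => /(_ (leqnn _)) h.
  by have := le_trans M1q h; rewrite gerDl ler10.
have El := lasso_path_selected lam0 Uqs slack bsol.
have K := lasso_kkt (ltW lam0) bsol.
have SE := selected_equicorr lam0 K.
have Sq : (#|selected betahat :|: ~: A0| <= qs)%N.
  by apply: leq_trans (ltnW El); apply: subset_leq_card; exact: finset.setSU.
have qtE : qtilde A0 betahat = #|selected betahat :|: ~: A0|.
  by apply: eq_card => j; rewrite !inE.
have S1 : (#|selected betahat| <= qs)%N.
  by apply: leq_trans Sq; apply: subset_leq_card; exact: finset.subsetUl.
have sup : supported (selected betahat) betahat.
  by move=> j; rewrite inE negbK => /eqP.
have gS j : j \in selected betahat -> j \in A0 ->
    `|(X^T *m (X *m beta + eps - X *m betahat)) j 0| = lam.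
  by move=> /(fintype.subsetP SE); rewrite inE => /eqP.
(* With [A] the selected set, [w] is the vector in [Btilde], and the missed indices are those in
   [zeta2]. *)
have [w [cw [[cwA wE] worth _ /(_ Sq)[h2 h3]]]] :=
  model_bounds qs_gt0 qs_le cl0 clu SR q_gt0 qE qqs lam0
  K sup S1 gS (noise (lexx _) S1) eta1E.
split.
- split; first by rewrite qtE; apply: subset_leq_card; exact: finset.subsetUl.
  rewrite qtE; apply: (model_size_lt (lexx _) bsol) => //; exact: finset.setSU.
- by rewrite /Btilde (orthproj_compl cwA worth wE).
- rewrite /zeta2 sqr_sqrtr; last first.
    by apply: sumr_ge0 => j _; rewrite mulr_ge0 ?sqr_ge0.
  apply: le_trans h3; rewrite le_eqVlt; apply/orP; left; apply/eqP.
  rewrite big_mkcond [RHS]big_mkcond; apply: eq_bigr => j _.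
  rewrite !inE real_normK ?num_real//.
  by case: (j \in A0); case: (betahat j 0 == 0); rewrite /= ?mulr1 ?mulr0.
Qed.

End Assemble.

(** * The event Omega_0 *)

Section GoodEvent.
Context {R : realType}.

(* A subset of the columns with a sign vector in {-1, 0, 1} on it: [None] marks
   the columns outside the subset and [Some None] the sign 0. *)
Definition signed_subset (p : nat) := {ffun 'I_p -> option (option bool)}.

Definition ssupp p (g : signed_subset p) : {set 'I_p} := [set j | g j != None].

Definition sign_value (x : option (option bool)) : R :=
  match x with Some (Some true) => -1 | Some (Some false) => 1 | _ => 0 end.

Definition ssign p (g : signed_subset p) : 'cV[R]_p := \col_j sign_value (g j).

(* Up to powers of the Gram determinant these are [X_A (X_A^T X_A)^-1 s] and
   [(I - P_A) mu]; the adjugate makes them polynomial in the entries of X. *)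
Definition sign_direction n p (X : 'M[R]_(n, p)) (g : signed_subset p) :
    'cV[R]_n :=
  X *m (maskmx (ssupp g) *m (\adj (gram X (ssupp g)) *m ssign g)).

Definition residual_direction n p (X : 'M[R]_(n, p)) (mu : 'cV[R]_n)
    (A : {set 'I_p}) : 'cV[R]_n :=
  (\det (gram X A) ^+ 2) *: mu -
  (\det (gram X A)) *:
    (X *m (maskmx A *m (\adj (gram X A) *m (maskmx A *m (X^T *m mu))))).

(** Chosen so that expR (- threshold / 2) is the power [maxn m 1] of (p \/ a_n)^-(1 + c0). The empty
    set, whose residual direction is [mu] itself, counts as size 1. *)
Definition threshold (p : nat) (c0 an : R) (m : nat) : R :=
  2 * (1 + c0) * (maxn m 1)%:R * ln (Num.max p%:R an).

(** The first inequality bounds the squared projection of [z] on the plane of [a] and [b],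
    denominators cleared; it is void if [a] or [b] vanishes, where the other two take over. For a
    zero sign vector only the product with [- b] matters, and one side suffices. *)
Definition good_noise n p (X : 'M[R]_(n, p)) (mu z : 'cV[R]_n) (t : R)
    (g : signed_subset p) : Prop :=
  let a := sign_direction X g in
  let b := residual_direction X mu (ssupp g) in
  if ssign g == 0 then (- cdot b z <= Num.sqrt t * Num.sqrt (cdot b b) : Prop)
  else [/\ cdot a z ^+ 2 * cdot b b + cdot b z ^+ 2 * cdot a a <=
             t * cdot a a * cdot b b,
           cdot a z ^+ 2 <= t * cdot a a &
           cdot b z ^+ 2 <= t * cdot b b].

(** Neither [A0] nor the Riesz constants may enter, so all subsets occur; those with a singular Gram
    matrix are exempted. *)
Definition good_event n p (mu : 'cV[R]_n) (c0 an : R) :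
    set ('M[R]_(n, p) * 'cV[R]_n)%type :=
  [set Xz | forall g : signed_subset p, \det (gram Xz.1 (ssupp g)) = 0 \/
     good_noise Xz.1 mu Xz.2 (threshold p c0 an #|ssupp g|) g].

End GoodEvent.

Section GoodEventBorel.
Context {R : realType} {T : topologicalType}.

Definition mx_continuous m n (F : T -> 'M[R]_(m, n)) :=
  forall i j, continuous (fun x => F x i j).

Lemma mx_continuous_cst m n (A : 'M[R]_(m, n)) : mx_continuous (fun _ : T => A).
Proof. by move=> i j; exact: continuous_cstR. Qed.

Lemma mx_continuousD m n (F G : T -> 'M[R]_(m, n)) :
  mx_continuous F -> mx_continuous G -> mx_continuous (fun x => F x + G x).
Proof.
move=> cF cG i j; under eq_fun do rewrite mxE.
exact: continuous_addR.
Qed.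

Lemma mx_continuousN m n (F : T -> 'M[R]_(m, n)) :
  mx_continuous F -> mx_continuous (fun x => - F x).
Proof.
move=> cF i j; under eq_fun do rewrite mxE.
exact: continuous_oppR.
Qed.

Lemma mx_continuousZ m n (f : T -> R) (F : T -> 'M[R]_(m, n)) :
  continuous f -> mx_continuous F -> mx_continuous (fun x => f x *: F x).
Proof.
move=> cf cF i j; under eq_fun do rewrite mxE.
exact: continuous_mulR.
Qed.

Lemma mx_continuousM m n k (F : T -> 'M[R]_(m, n)) (G : T -> 'M[R]_(n, k)) :
  mx_continuous F -> mx_continuous G -> mx_continuous (fun x => F x *m G x).
Proof.
move=> cF cG i j; under eq_fun do rewrite mxE.
by apply: continuous_sumR => l; exact: continuous_mulR.
Qed.

Lemma mx_continuous_tr m n (F : T -> 'M[R]_(m, n)) :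
  mx_continuous F -> mx_continuous (fun x => (F x)^T).
Proof. by move=> cF i j; under eq_fun do rewrite mxE; exact: cF. Qed.

Lemma continuous_det n (F : T -> 'M[R]_n) :
  mx_continuous F -> continuous (fun x => \det (F x)).
Proof.
move=> cF; apply: continuous_sumR => s; apply: continuous_mulR.
  exact: continuous_cstR.
by apply: continuous_prodR => i; exact: cF.
Qed.

Lemma mx_continuous_adj n (F : T -> 'M[R]_n) :
  mx_continuous F -> mx_continuous (fun x => \adj (F x)).
Proof.
move=> cF i j; under eq_fun do rewrite mxE.
apply: continuous_mulR; first exact: continuous_cstR.
apply: continuous_det => k l; under eq_fun do rewrite !mxE.
exact: cF.
Qed.

Lemma continuous_cdot n (F G : T -> 'cV[R]_n) :
  mx_continuous F -> mx_continuous G -> continuous (fun x => cdot (F x) (G x)).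
Proof. by move=> cF cG; apply: continuous_sumR => i; apply: continuous_mulR. Qed.

Lemma closed_le_continuous (f h : T -> R) :
  continuous f -> continuous h -> closed [set x | f x <= h x].
Proof.
move=> cf ch.
rewrite (_ : [set x | _] = (fun x => h x + (- f x)) @^-1` [set x | 0 <= x]).
  apply: preimage_closed; last exact: closed_ge.
  by move=> x _; apply: continuous_addR => //; exact: continuous_oppR.
by apply/seteqP; split => x /=; rewrite subr_ge0.
Qed.

End GoodEventBorel.

Lemma mx_continuous_fst (R : realType) (n p : nat) (S : topologicalType) :
  mx_continuous (fun x : 'M[R]_(n, p) * S => x.1).
Proof.
move=> i j x; apply: (@continuous_comp _ _ _ fst (fun M : 'M[R]_(n, p) => M i j)).
  exact: cvg_fst.
exact: coord_continuous.
Qed.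

Lemma mx_continuous_snd (R : realType) (n p : nat) (S : topologicalType) :
  mx_continuous (fun x : S * 'M[R]_(n, p) => x.2).
Proof.
move=> i j x; apply: (@continuous_comp _ _ _ snd (fun M : 'M[R]_(n, p) => M i j)).
  exact: cvg_snd.
exact: coord_continuous.
Qed.

(** With determinants in place of inverses, both sides of every condition are continuous in the
    entries, also where the Gram matrix degenerates. *)
Lemma closed_good_event (R : realType) n p (mu : 'cV[R]_n) (c0 an : R) :
  closed (@good_event R n p mu c0 an).
Proof.
pose T : topologicalType := ('M[R]_(n, p) * 'cV[R]_n)%type.
have cX : mx_continuous (fun x : T => x.1) by exact: mx_continuous_fst.
have cz : mx_continuous (fun x : T => x.2) by exact: mx_continuous_snd.
have cst m k (M : 'M[R]_(m, k)) : mx_continuous (fun _ : T => M).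
  exact: mx_continuous_cst.
have cG (A : {set 'I_p}) : mx_continuous (fun x : T => gram x.1 A).
  apply: mx_continuousD => //.
  by do 3![apply: mx_continuousM => //]; exact: mx_continuous_tr.
have cdet (A : {set 'I_p}) : continuous (fun x : T => \det (gram x.1 A)).
  exact: continuous_det.
have cadj (A : {set 'I_p}) : mx_continuous (fun x : T => \adj (gram x.1 A)).
  exact: mx_continuous_adj.
have ca g : mx_continuous (fun x : T => sign_direction x.1 g).
  by do 3![apply: mx_continuousM => //].
have cb (A : {set 'I_p}) : mx_continuous (fun x : T => residual_direction x.1 mu A).
  apply: mx_continuousD.
    by apply: mx_continuousZ => //; exact: continuous_mulR.
  apply: mx_continuousN; apply: mx_continuousZ => //.
  do 4![apply: mx_continuousM => //].
  by apply: mx_continuousM => //; exact: mx_continuous_tr.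
rewrite (_ : good_event _ _ _ = \bigcap_(g : signed_subset p)
   ([set x : T | \det (gram x.1 (ssupp g)) = 0] `|`
    [set x : T | good_noise x.1 mu x.2 (threshold p c0 an #|ssupp g|) g])); last first.
  apply/seteqP; split => x /=; first by move=> h g _; exact: h.
  by move=> h g; exact: h.
apply: closed_bigI => g _; apply: closedU.
  rewrite [X in closed X](_ : _ = [set x : T | \det (gram x.1 (ssupp g)) <= 0] `&`
    [set x : T | 0 <= \det (gram x.1 (ssupp g))]).
    by apply: closedI; apply: closed_le_continuous => //; exact: continuous_cstR.
  apply/seteqP; split => x /=; first by move=> ->.
  by move=> [h1 h2]; apply/le_anti; rewrite h1.
set t := threshold _ _ _ _.
have caz := continuous_cdot (ca g) cz.
have cbz := continuous_cdot (cb (ssupp g)) cz.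
have caa := continuous_cdot (ca g) (ca g).
have cbb := continuous_cdot (cb (ssupp g)) (cb (ssupp g)).
case: (boolP (ssign g == 0 :> 'cV[R]_p)) => sg.
  rewrite [X in closed X](_ : _ =
    [set x : T | - cdot (residual_direction x.1 mu (ssupp g)) x.2 <=
      Num.sqrt t * Num.sqrt (cdot (residual_direction x.1 mu (ssupp g))
        (residual_direction x.1 mu (ssupp g)))]); last first.
    by apply/seteqP; split => x /=; rewrite /good_noise sg.
  apply: closed_le_continuous; first exact: continuous_oppR.
  apply: continuous_mulR; first exact: continuous_cstR.
  by move=> x; apply: continuous_comp; [exact: cbb|exact: sqrt_continuous].
rewrite [X in closed X](_ : _ =
  [set x : T | cdot (sign_direction x.1 g) x.2 ^+ 2 *
      cdot (residual_direction x.1 mu (ssupp g)) (residual_direction x.1 mu (ssupp g))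
    + cdot (residual_direction x.1 mu (ssupp g)) x.2 ^+ 2 *
      cdot (sign_direction x.1 g) (sign_direction x.1 g) <=
    t * cdot (sign_direction x.1 g) (sign_direction x.1 g) *
      cdot (residual_direction x.1 mu (ssupp g)) (residual_direction x.1 mu (ssupp g))]
  `&` [set x : T | cdot (sign_direction x.1 g) x.2 ^+ 2 <=
     t * cdot (sign_direction x.1 g) (sign_direction x.1 g)]
  `&` [set x : T | cdot (residual_direction x.1 mu (ssupp g)) x.2 ^+ 2 <=
     t * cdot (residual_direction x.1 mu (ssupp g)) (residual_direction x.1 mu (ssupp g))]).
  have ct : continuous (fun _ : T => t) by exact: continuous_cstR.
  apply: closedI; first apply: closedI; apply: closed_le_continuous.
  - by apply: continuous_addR; do 2![apply: continuous_mulR => //].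
  - by do 2![apply: continuous_mulR => //].
  - exact: continuous_mulR.
  - exact: continuous_mulR.
  - exact: continuous_mulR.
  - exact: continuous_mulR.
by apply/seteqP; split => x /=; rewrite /good_noise (negbTE sg);
  [move=> [h1 h2 h3]|move=> [[h1 h2] h3]].
Qed.

Lemma borel_closed (T : topologicalType) (A : set T) : closed A -> borel A.
Proof.
move=> cA; rewrite /borel -[A]setCK -setTD.
apply: sigma_algebraCD; apply: sub_sigma_algebra; exact: closed_openC.
Qed.

Section GoodNoiseBound.
Context {R : realType} {n p : nat}.
Variables (X : 'M[R]_(n, p)).
Implicit Types (A : {set 'I_p}) (c s : 'cV[R]_p) (g : signed_subset p).

Lemma gram_normal_equation A c s : supported A c -> supported A s ->
  (forall j, j \in A -> (X^T *m (X *m c)) j 0 = s j 0) -> gram X A *m c = s.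
Proof.
move=> cA sA cE; have rc : restrict A c = c.
  apply/matrixP => i j; rewrite ord1 mxE; case: ifPn => // /cA ->//.
rewrite gramE rc subrr addr0; apply/matrixP => i j; rewrite ord1 mxE.
by case: ifPn => [/cE //|/sA ->].
Qed.

Lemma adj_gram_normal_equation A c s : supported A c -> supported A s ->
  (forall j, j \in A -> (X^T *m (X *m c)) j 0 = s j 0) ->
  maskmx A *m (\adj (gram X A) *m s) = \det (gram X A) *: c.
Proof.
move=> cA sA cE; rewrite -(gram_normal_equation cA sA cE) [X in _ *m X]mulmxA mul_adj_mx.
rewrite mul_scalar_mx maskmxE; apply/matrixP => i j; rewrite ord1 !mxE.
by case: ifPn => // /cA ->; rewrite mulr0.
Qed.

(** The defect of the Cauchy-Schwarz inequality used here is a square; [h2] and [h3] settle the case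
    of a vanishing direction. The weights [al] and [ta] are free, so one event serves all penalty
    levels. *)
Lemma two_dim_bound (t al ta : R) (a b z : 'cV[R]_n) : 0 <= t ->
  cdot a z ^+ 2 * cdot b b + cdot b z ^+ 2 * cdot a a <=
    t * cdot a a * cdot b b ->
  cdot a z ^+ 2 <= t * cdot a a -> cdot b z ^+ 2 <= t * cdot b b ->
  al * cdot a z + ta * cdot b z <=
  Num.sqrt t * Num.sqrt (al ^+ 2 * cdot a a + ta ^+ 2 * cdot b b).
Proof.
move=> t0 h1 h2 h3; have aa0 := cdot_ge0 a; have bb0 := cdot_ge0 b.
move: (cdot a z) (cdot b z) (cdot a a) (cdot b b) aa0 bb0 h1 h2 h3 => u v A B.
move=> A0 B0 h1 h2 h3.
have S0 : 0 <= al ^+ 2 * A + ta ^+ 2 * B by rewrite addr_ge0// mulr_ge0 ?sqr_ge0.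
rewrite (le_trans (ler_norm _))// -sqrtr_sqr -sqrtrM// ler_wsqrtr//.
have [A00|An] := eqVneq A 0.
  have u0 : u = 0.
    apply/eqP; rewrite -sqrf_eq0; apply/eqP/le_anti.
    by rewrite sqr_ge0 andbT (le_trans h2)// A00 mulr0.
  rewrite u0 A00 !mulr0 !add0r exprMn [leRHS]mulrCA ler_wpM2l ?sqr_ge0//.
have [B00|Bn] := eqVneq B 0.
  have v0 : v = 0.
    apply/eqP; rewrite -sqrf_eq0; apply/eqP/le_anti.
    by rewrite sqr_ge0 andbT (le_trans h3)// B00 mulr0.
  rewrite v0 B00 !mulr0 !addr0 exprMn [leRHS]mulrCA ler_wpM2l ?sqr_ge0//.
have Ap : 0 < A by rewrite lt0r An.
have Bp : 0 < B by rewrite lt0r Bn.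
rewrite -(ler_pM2r (mulr_gt0 Ap Bp)).
have cs : (al * u + ta * v) ^+ 2 * (A * B) <=
    (al ^+ 2 * A + ta ^+ 2 * B) * (u ^+ 2 * B + v ^+ 2 * A).
  rewrite -subr_ge0.
  have -> : (al ^+ 2 * A + ta ^+ 2 * B) * (u ^+ 2 * B + v ^+ 2 * A)
     - (al * u + ta * v) ^+ 2 * (A * B) = (al * v * A - ta * u * B) ^+ 2 by ring.
  exact: sqr_ge0.
rewrite (le_trans cs)//.
have -> : t * (al ^+ 2 * A + ta ^+ 2 * B) * (A * B) =
  (al ^+ 2 * A + ta ^+ 2 * B) * (t * A * B) by ring.
by rewrite ler_wpM2l.
Qed.

Variables (beta : 'cV[R]_p) (sigma c0 an cu lam : R) (z : 'cV[R]_n).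
Hypotheses (sigma0 : 0 < sigma) (c00 : 0 <= c0) (cu0 : 0 < cu).
Hypotheses (n0 : 0 < n%:R :> R) (p1 : (1 <= p)%N) (lam0 : 0 < lam).
Hypothesis Xz : good_event (X *m beta) c0 an (X, z).
Hypothesis lamE : lambda_np n p sigma c0 an cu <= lam.

Let L0 : 0 <= ln (Num.max p%:R an).
Proof. by rewrite ln_ge0// le_max ler1n p1. Qed.

Lemma good_event_noise_ok A : injective_on X A ->
  noise_ok X beta (sigma *: z) lam cu A.
Proof.
move=> inj s c w cw sv sA cA cwA cE worth wE.
pose code (x : R) : option bool :=
  if x == 0 then None else Some (x == -1).
pose g : signed_subset p :=
  [ffun j => if j \in A then Some (code (s j 0)) else None].
have gA : ssupp g = A.
  by apply/setP => j; rewrite inE ffunE; case: (j \in A).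
have gs : ssign g = s.
  apply/matrixP => i j; rewrite ord1 mxE ffunE.
  case: ifPn => [_|/sA -> //].
  rewrite /code; have [-> | -> | ->] := sv i.
  - by rewrite eqxx.
  - by rewrite oner_eq0 -addr_eq0 -mulr2n pnatr_eq0.
  - by rewrite oppr_eq0 oner_eq0 eqxx.
set dG := \det (gram X A).
have d0 : dG != 0 by have := gram_unit inj; rewrite unitmxE unitfE.
have aE : sign_direction X g = dG *: (X *m c).
  rewrite /sign_direction gA gs (adj_gram_normal_equation cA sA cE).
  by rewrite -scalemxAr.
have bE : residual_direction X (X *m beta) (ssupp g) = (dG ^+ 2) *: w.
  rewrite /residual_direction gA (maskmxE A (X^T *m _)).
  rewrite (adj_gram_normal_equation (c := cw) cwA); last 2 first.
  - exact: restrict_supported.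
  - move=> j jA; rewrite [RHS]mxE jA; have := worth j jA.
    by rewrite wE mulmxBr mxE [X in _ + X]mxE => /eqP; rewrite subr_eq0 => /eqP.
  by rewrite -scalemxAr scalerA -expr2 -scalerBr -wE.
have := Xz g; rewrite /= gA => -[/eqP|]; first by rewrite (negbTE d0).
set t := threshold p c0 an #|A|.
have t0 : 0 <= t by rewrite !mulr_ge0 ?addr_ge0.
set m := (maxn #|A| 1)%:R : R.
have m0 : 0 <= m by exact: ler0n.
(* An equality at [lam = lambda_np]: this fixes the constant in [lambda_np]. *)
have noiset : sigma * Num.sqrt t <= lam / 2 * Num.sqrt (m / (cu * n%:R)).
  apply: (@le_trans _ _ (lambda_np n p sigma c0 an cu / 2 *
    Num.sqrt (m / (cu * n%:R)))); last first.
    by rewrite ler_wpM2r ?sqrtr_ge0// ler_wpM2r// invr_ge0.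
  rewrite /lambda_np; set LL := 2 * (1 + c0) * cu * _ * _.
  have LL0 : 0 <= LL by rewrite !mulr_ge0 ?addr_ge0// ltW.
  rewrite le_eqVlt; apply/orP; left; apply/eqP.
  have -> : 2 * sigma * Num.sqrt LL / 2 * Num.sqrt (m / (cu * n%:R)) =
    sigma * (Num.sqrt LL * Num.sqrt (m / (cu * n%:R))) by field.
  rewrite -sqrtrM//; congr (_ * Num.sqrt _).
  rewrite /LL /t /threshold -/m; field.
  by rewrite !gt_eqF.
move=> gn; suff H : cdot (lam *: (X *m c) - w) z <=
    Num.sqrt t * Num.sqrt (lam ^+ 2 * cdot (X *m c) (X *m c) + cdot w w).
  rewrite cdotZr; apply: le_trans (ler_wpM2l (ltW sigma0) H) _.
  by rewrite mulrA mulrC ler_wpM2l ?sqrtr_ge0.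
move: gn; rewrite /good_noise gs aE bE; case: eqP => [s0|_].
  have c_0 : c = 0.
    have := gram_normal_equation cA sA cE; rewrite s0 => h.
    by rewrite -(mulKmx (gram_unit inj) c) h mulmx0.
  have -> : X *m c = 0 by rewrite c_0 mulmx0.
  have -> : cdot (0 : 'cV[R]_n) 0 = 0 by apply/eqP; rewrite cdot_eq0.
  have bb : cdot (dG ^+ 2 *: w) (dG ^+ 2 *: w) = (dG ^+ 2) ^+ 2 * cdot w w.
    by rewrite cdotZl cdotZr mulrA -expr2.
  rewrite scaler0 sub0r cdotNl mulr0 add0r bb cdotZl.
  (* [residual_direction] carries the square of the determinant so that the one-sided inequality
     survives division. *)
  have d2 : 0 < dG ^+ 2 by rewrite exprn_even_gt0.
  rewrite (@sqrtrM _ ((dG ^+ 2) ^+ 2)) ?sqr_ge0// sqrtr_sqr gtr0_norm// [leRHS]mulrCA -mulrN.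
  by rewrite ler_pM2l.
move=> [h1 h2 h3].
(* These weights undo the determinants in the two directions and restore [lam] and the sign of
   [w]. *)
have := two_dim_bound (lam / dG) (- (dG ^+ 2)^-1) t0 h1 h2 h3.
rewrite !cdotZl !cdotZr cdotBl cdotZl.
have -> : lam / dG * (dG * cdot (X *m c) z) + - (dG ^+ 2)^-1 * (dG ^+ 2 * cdot w z)
  = lam * cdot (X *m c) z - cdot w z by field.
have -> // : (lam / dG) ^+ 2 * (dG * (dG * cdot (X *m c) (X *m c))) +
   (- (dG ^+ 2)^-1) ^+ 2 * (dG ^+ 2 * (dG ^+ 2 * cdot w w)) =
   lam ^+ 2 * cdot (X *m c) (X *m c) + cdot w w by field.
Qed.

End GoodNoiseBound.

(** * Union bound over signed subsets *)

Section SignedSubsetCount.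
Context {R : realType} {p : nat}.
Implicit Types g : signed_subset p.

Definition sneg g : signed_subset p :=
  [ffun j => omap (omap negb) (g j)].

Lemma snegK : involutive sneg.
Proof.
by move=> g; apply/ffunP => j; rewrite !ffunE; case: (g j) => [[[]|]|].
Qed.

Lemma ssupp_neg g : ssupp (sneg g) = ssupp g.
Proof. by apply/setP => j; rewrite !inE !ffunE; case: (g j). Qed.

Lemma ssign_neg g : ssign (sneg g) = - ssign g :> 'cV[R]_p.
Proof.
apply/matrixP => i j; rewrite !mxE !ffunE.
by case: (g i) => [[[]|]|] /=; rewrite ?opprK ?oppr0.
Qed.

Lemma ssign_neg_eq0 g : (ssign (sneg g) == 0 :> 'cV[R]_p) = (ssign g == 0 :> 'cV[R]_p).
Proof. by rewrite ssign_neg oppr_eq0. Qed.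

Lemma sneg_neq g : ssign g != 0 :> 'cV[R]_p -> sneg g != g.
Proof.
apply: contraNneq => h; apply/eqP/matrixP => i j; rewrite !mxE.
by have /ffunP/(_ i) := h; rewrite !ffunE; case: (g i) => [[[]|]|].
Qed.

(** Each index is left out with weight 1 or taken with one of three signs, with weight [k] each. *)
Lemma sum_signed_subsets (k : R) :
  \sum_(g : signed_subset p) k ^+ #|ssupp g| = (1 + 3 * k) ^+ p.
Proof.
pose F (i : 'I_p) (x : option (option bool)) : R := if x == None then 1 else k.
have -> : (1 + 3 * k) ^+ p = \prod_(i < p) \sum_x F i x.
  rewrite -[in LHS](card_ord p) -prodr_const; apply: eq_bigr => i _.
  rewrite (bigD1 None)//=; congr (_ + _).
  rewrite (eq_bigr (fun=> k)); last by move=> x /negbTE; rewrite /F => ->.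
  by rewrite sumr_const cardC1 !card_option card_bool mulr_natl.
rewrite bigA_distr_bigA; apply: eq_bigr => g _.
rewrite /F -prodr_const big_mkcond; apply: eq_bigr => i _.
by rewrite inE; case: (g i == None).
Qed.

(** The maximum concerns only the empty signed subset, whose term changes from 1 to [k]. *)
Lemma sum_signed_subsets_max1 (k : R) :
  \sum_(g : signed_subset p) k ^+ (maxn #|ssupp g| 1) = (1 + 3 * k) ^+ p - 1 + k.
Proof.
pose g0 : signed_subset p := [ffun => None].
have s0 : #|ssupp g0| = 0%N.
  by apply: eq_card0 => j; rewrite inE ffunE.
rewrite -sum_signed_subsets (bigD1 g0)//= [in RHS](bigD1 g0)//= s0 expr0 expr1.
rewrite [RHS]addrC addrAC subrr add0r; congr (_ + _).
apply: eq_bigr => g gg0; congr (_ ^+ _); apply/maxn_idPl.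
rewrite lt0n; apply: contraNneq gg0 => /eqP; rewrite cards_eq0 => /eqP/setP h.
apply/eqP/ffunP => j; rewrite ffunE.
by have := h j; rewrite !inE; case: (g j).
Qed.

(* Opposite sign vectors span the same plane, so only one of each pair enters
   the union bound; this halves the count [3 ^ #|A|] of sign vectors in
   {-1, 0, 1}, which alone would exceed the claimed failure probability. *)
Definition half_signed : {set signed_subset p} :=
  [set g | (ssign g == 0 :> 'cV[R]_p) || (enum_rank g < enum_rank (sneg g))%N].

(** The one-sided tail halves the terms with zero sign, the choice of one in each opposite pair
    halves the others; together they give exactly half of the full sum. *)
Lemma sum_half_signed (w : signed_subset p -> R) :
  (forall g, w (sneg g) = w g) ->
  \sum_(g in half_signed) (if ssign g == 0 :> 'cV[R]_p then w g / 2 else w g) =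
  (\sum_(g : signed_subset p) w g) / 2.
Proof.
move=> wneg; pose z g := ssign g == 0 :> 'cV[R]_p.
have split2 (F : signed_subset p -> R) :
    \sum_(g : signed_subset p) F g = \sum_(g | z g) F g
     + \sum_(g | ~~ z g && (enum_rank g < enum_rank (sneg g))%N) F g
     + \sum_(g | ~~ z g && (enum_rank (sneg g) < enum_rank g)%N) F g.
  rewrite (bigID z)/= -addrA; congr (_ + _).
  rewrite (bigID (fun g => (enum_rank g < enum_rank (sneg g))%N))/=; congr (_ + _).
  apply: eq_bigl => g; apply: andb_id2l => zg.
  rewrite -leqNgt leq_eqVlt -[X in X || _]/(enum_rank (sneg g) == enum_rank g).
  by rewrite (inj_eq enum_rank_inj) (negbTE (sneg_neq zg)).
have flip : \sum_(g | ~~ z g && (enum_rank (sneg g) < enum_rank g)%N) w g =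
    \sum_(g | ~~ z g && (enum_rank g < enum_rank (sneg g))%N) w g.
  rewrite (reindex_inj (inv_inj snegK)); apply: eq_big => g.
    by rewrite /z ssign_neg_eq0 snegK.
  by rewrite wneg.
rewrite [in RHS]split2 flip [LHS](bigID z)/=.
rewrite (eq_bigl z); last by move=> g; rewrite inE -/(z g) andb_idl// => ->.
rewrite (eq_bigr (fun g => w g / 2)); last by move=> g; rewrite -/(z g) => ->.
rewrite -mulr_suml [X in _ + X](eq_bigl (fun g =>
  ~~ z g && (enum_rank g < enum_rank (sneg g))%N)); last first.
  by move=> g; rewrite inE -/(z g) andbC; case: (z g).
rewrite [X in _ + X](eq_bigr w); last by move=> g /andP[/negbTE + _]; rewrite -/(z g) => ->.
by field.
Qed.

End SignedSubsetCount.

Lemma fin_union_bound d (T : measurableType d) (R : realType)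
    (P : probability T R) (I : finType) (S : {set I}) (B : I -> set T) (f : I -> R) :
  (forall i, measurable (B i)) -> (forall i, i \in S -> P (B i) <= (f i)%:E)%E ->
  measurable (\big[setU/set0]_(i in S) B i) /\
  (P (\big[setU/set0]_(i in S) B i) <= (\sum_(i in S) f i)%:E)%E.
Proof.
move=> mB Bf.
elim/big_ind2 : _ => [|A x C y [mA Ax] [mC Cy]|i iS].
- by split; [exact: measurable0|rewrite measure0].
- split; first exact: measurableU.
  by rewrite (le_trans (measureU2 _ mA mC))// EFinD leeD.
- by split; [exact: mB|exact: Bf].
Qed.

Section GoodEventProbability.
Context {R : realType} {n p : nat} {d : measure_display} {T : measurableType d}.
Variables (P : probability T R) (sigma c0 an : R) (eps : T -> 'cV[R]_n).
Variables (X : 'M[R]_(n, p)) (mu : 'cV[R]_n).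
Hypotheses (sigma0 : 0 < sigma) (noise : gaussian_noise P sigma eps).
Hypotheses (p1 : (1 <= p)%N) (c00 : 0 <= c0).
Implicit Types (g : signed_subset p) (A : {set 'I_p}).

Let Z (i : 'I_n) (w : T) : R := eps w i 0.
Let gZ : gauss_family P sigma Z. Proof. exact: noise. Qed.
Let sn0 : sigma != 0. Proof. by rewrite gt_eqF. Qed.
Let z (w : T) : 'cV[R]_n := sigma^-1 *: eps w.

Let mcdot (a : 'cV[R]_n) : measurable_fun setT (fun w => cdot a (eps w)).
Proof. exact: (measurable_dotf _ gZ). Qed.

Let M : R := Num.max p%:R an.
Let M1_ge : 1 <= M. Proof. by rewrite le_max ler1n p1. Qed.
Let k : R := expR (- ((1 + c0) * ln M)).
Let thr A := threshold p c0 an #|A|.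

Let thr_ge0 A : 0 <= thr A.
Proof. by rewrite !mulr_ge0 ?addr_ge0// ln_ge0. Qed.

Let tailE A (r : R) : r = sigma ^+ 2 * thr A ->
  expR (- (r / (sigma ^+ 2 *+ 2))) = k ^+ (maxn #|A| 1).
Proof.
move=> ->; rewrite /k -expRM_natl; congr expR; rewrite /thr /threshold -/M.
rewrite -mulr_natr.
by field.
Qed.

Let injective_det A : \det (gram X A) != 0 -> injective_on X A.
Proof.
move=> d0 c cA Xc; have gU : gram X A \in unitmx by rewrite unitmxE unitfE.
have rc : restrict A c = c.
  by apply/matrixP => i j; rewrite ord1 mxE; case: ifPn => // /cA ->.
rewrite -(mulKmx gU c) gramE rc subrr Xc mulmx0 addr0.
suff -> : restrict A (0 : 'cV[R]_p) = 0 by rewrite mulmx0.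
by apply/matrixP => i j; rewrite !mxE; case: ifP.
Qed.

Let directions_orthogonal g : \det (gram X (ssupp g)) != 0 ->
  cdot (sign_direction X g) (residual_direction X mu (ssupp g)) = 0.
Proof.
set A := ssupp g => d0; have inj := injective_det d0.
have sA : supported A (ssign g : 'cV[R]_p).
  by move=> j; rewrite inE negbK mxE => /eqP ->.
have [c cA cE] := normal_equation_solution (ssign g) inj.
have [cw cwA cwE] := normal_equation_solution (restrict A (X^T *m mu)) inj.
rewrite /sign_direction -/A (adj_gram_normal_equation cA sA cE).
rewrite /residual_direction (maskmxE A (X^T *m _)).
rewrite (adj_gram_normal_equation cwA _ cwE); last exact: restrict_supported.
rewrite -!scalemxAr scalerA -expr2 -scalerBr cdotZl cdotZr.
suff -> : cdot (X *m c) (mu - X *m cw) = 0 by rewrite !mulr0.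
rewrite cdot_mulmx (cdot_supported _ cA) big1// => j jA.
rewrite mulmxBr [X in _ * X]mxE [X in _ + X]mxE cwE// [X in _ - X]mxE jA subrr mulr0.
by [].
Qed.

Definition bad_noise g : set T :=
  [set w | \det (gram X (ssupp g)) != 0 /\ ~ good_noise X mu (z w) (thr (ssupp g)) g].

Let measurable_lt_fun (f h : T -> R) : measurable_fun setT f ->
  measurable_fun setT h -> measurable [set w | f w < h w].
Proof.
move=> mf mh; rewrite [X in measurable X](_ : _ = setT `&` (fun w => h w - f w) @^-1` `]0, +oo[).
  by apply: measurable_funB.
by apply/seteqP; split => w /=; rewrite in_itv/= andbT subr_gt0; [split|case].
Qed.

Let bad_noiseE_zero g : \det (gram X (ssupp g)) != 0 -> ssign g == 0 :> 'cV[R]_p ->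
  let b := residual_direction X mu (ssupp g) in
  bad_noise g = [set w | sigma * Num.sqrt (thr (ssupp g)) * Num.sqrt (cdot (- b) (- b))
     < cdot (- b) (eps w)].
Proof.
move=> d0 s0 b; rewrite /bad_noise d0 /good_noise s0 -/b.
apply/seteqP; split => w /=.
  move=> [_ /negP]; rewrite -ltNge /z cdotZr !cdotNl cdotNr opprK => h.
  by rewrite -mulrA -ltr_pdivlMl// mulrN.
rewrite !cdotNl cdotNr opprK -mulrA -ltr_pdivlMl// mulrN => h; split => //.
by apply/negP; rewrite -ltNge /z cdotZr.
Qed.

Let bad_noiseE_sign g : \det (gram X (ssupp g)) != 0 -> ssign g != 0 :> 'cV[R]_p ->
  let a := sign_direction X g in
  let b := residual_direction X mu (ssupp g) in
  let t := sigma ^+ 2 * thr (ssupp g) in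
  bad_noise g =
  [set w | t * cdot a a * cdot b b <
    cdot a (eps w) ^+ 2 * cdot b b + cdot b (eps w) ^+ 2 * cdot a a]
  `|` [set w | t * cdot a a < cdot a (eps w) ^+ 2]
  `|` [set w | t * cdot b b < cdot b (eps w) ^+ 2].
Proof.
move=> d0 s0 a b t; rewrite /bad_noise d0 /good_noise (negbTE s0) -/a -/b.
have sc (x y : R) : (sigma^-1 ^+ 2 * x <= y) = (x <= sigma ^+ 2 * y).
  by rewrite -(ler_pM2l (exprn_gt0 2 sigma0)) mulrA -exprMn divff// expr1n mul1r.
have e1 w : (cdot a (z w) ^+ 2 * cdot b b + cdot b (z w) ^+ 2 * cdot a a <=
    thr (ssupp g) * cdot a a * cdot b b) =
  (cdot a (eps w) ^+ 2 * cdot b b + cdot b (eps w) ^+ 2 * cdot a a <= t * cdot a a * cdot b b).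
  rewrite /z !cdotZr.
  have -> : (sigma^-1 * cdot a (eps w)) ^+ 2 * cdot b b +
      (sigma^-1 * cdot b (eps w)) ^+ 2 * cdot a a =
    sigma^-1 ^+ 2 * (cdot a (eps w) ^+ 2 * cdot b b + cdot b (eps w) ^+ 2 * cdot a a).
    by ring.
  by rewrite sc /t !mulrA.
have e2 w (v : 'cV[R]_n) : (cdot v (z w) ^+ 2 <= thr (ssupp g) * cdot v v) =
   (cdot v (eps w) ^+ 2 <= t * cdot v v).
  by rewrite /z cdotZr exprMn sc mulrA.
apply/seteqP; split => w /=.
  move=> [_ h]; apply: contrapT => /not_orP[/not_orP[h1 h2] h3]; apply: h.
  by rewrite e1 !e2; split; rewrite leNgt; exact/negP.
move=> h; split => //; rewrite e1 !e2 => -[h1 h2 h3].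
by case: h => [[]|]; rewrite ltNge ?h1 ?h2 ?h3.
Qed.

Lemma measurable_bad_noise g : measurable (bad_noise g).
Proof.
have [d0|d0] := eqVneq (\det (gram X (ssupp g))) 0.
  rewrite [X in measurable X](_ : _ = set0); first exact: measurable0.
  by apply/seteqP; split => w //= []; rewrite d0 eqxx.
have msq (a : 'cV[R]_n) (v : R) : measurable_fun setT (fun w => cdot a (eps w) ^+ 2 * v).
  by apply: measurable_funM => //; apply: measurable_funX.
have [s0|s0] := boolP (ssign g == 0 :> 'cV[R]_p).
  rewrite (bad_noiseE_zero d0 s0).
  by apply: measurable_lt_fun; [exact: measurable_cst|exact: mcdot].
rewrite (bad_noiseE_sign d0 s0); apply: measurableU; first apply: measurableU.
- apply: measurable_lt_fun; first exact: measurable_cst.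
  by apply: measurable_funD; exact: msq.
- by apply: measurable_lt_fun; [exact: measurable_cst|apply: measurable_funX].
- by apply: measurable_lt_fun; [exact: measurable_cst|apply: measurable_funX].
Qed.

Lemma bad_noise_prob g :
  (P (bad_noise g) <= (if ssign g == 0 :> 'cV[R]_p then k ^+ (maxn #|ssupp g| 1) / 2
                       else k ^+ (maxn #|ssupp g| 1))%:E)%E.
Proof.
have k0 : 0 <= k ^+ (maxn #|ssupp g| 1) by rewrite exprn_ge0// expR_ge0.
have [d0|d0] := eqVneq (\det (gram X (ssupp g))) 0.
  rewrite (_ : bad_noise g = set0); last first.
    by apply/seteqP; split => w //= []; rewrite d0 eqxx.
  by rewrite measure0 lee_fin; case: ifP => _ //; rewrite divr_ge0.
have st0 : 0 <= sigma ^+ 2 * thr (ssupp g) by rewrite mulr_ge0 ?sqr_ge0.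
have [s0|s0] := boolP (ssign g == 0 :> 'cV[R]_p).
  rewrite (bad_noiseE_zero d0 s0); set b := - residual_direction _ _ _.
  have [b0|b0] := eqVneq (cdot b b) 0.
    rewrite (_ : [set w | _] = set0) ?measure0 ?lee_fin ?divr_ge0//.
    apply/seteqP; split => w //=; rewrite b0 sqrtr0 mulr0.
    move/eqP: b0; rewrite cdot_eq0 => /eqP ->.
    by rewrite /cdot big1 ?ltxx// => i _; rewrite mxE mul0r.
  have bb : 0 < cdot b b by rewrite lt0r b0 cdot_ge0.
  rewrite -(tailE (r := (sigma * Num.sqrt (thr (ssupp g))) ^+ 2)); last first.
    by rewrite exprMn sqr_sqrtr.
  apply: (gauss_linear_onesided_tail sn0 (a := fun i => b i 0) gZ) => //.
  by rewrite mulr_ge0 ?sqrtr_ge0// ltW.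
rewrite (bad_noiseE_sign d0 s0) -(tailE erefl).
set a := sign_direction X g; set b := residual_direction X mu (ssupp g).
set t := sigma ^+ 2 * thr (ssupp g).
have ab : cdot a b = 0 by exact: directions_orthogonal.
have zero (v : 'cV[R]_n) w : cdot v v = 0 -> cdot v (eps w) = 0.
  move=> /eqP; rewrite cdot_eq0 => /eqP ->.
  by rewrite /cdot big1// => i _; rewrite mxE mul0r.
(* If a direction vanishes the planar bound is void and only the bound for the other direction
   remains. *)
have [a0|a0] := eqVneq (cdot a a) 0.
  have [b0|b0] := eqVneq (cdot b b) 0.
    rewrite (_ : _ `|` _ = set0) ?measure0 ?lee_fin ?expR_ge0//.
    apply/seteqP; split => w //=.
    by rewrite (zero a)// (zero b)// a0 b0 expr0n !mulr0 addr0 ltxx; case => [[]|].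
  have bb : 0 < cdot b b by rewrite lt0r b0 cdot_ge0.
  rewrite [X in P X](_ : _ = [set w | t * cdot b b < cdot b (eps w) ^+ 2]).
    exact: (gauss_linear_tail sn0 (a := fun i => b i 0) gZ).
  apply/seteqP; split => w //=; last by right.
  by rewrite (zero a)// a0 expr0n !(mulr0, mul0r, addr0) ltxx; case => [[]|].
have aa : 0 < cdot a a by rewrite lt0r a0 cdot_ge0.
have [b0|b0] := eqVneq (cdot b b) 0.
  rewrite [X in P X](_ : _ = [set w | t * cdot a a < cdot a (eps w) ^+ 2]).
    exact: (gauss_linear_tail sn0 (a := fun i => a i 0) gZ).
  apply/seteqP; split => w //=; last by left; right.
  by rewrite (zero b)// b0 expr0n !(mulr0, mul0r, addr0) ltxx; case => [[]|].
have bb : 0 < cdot b b by rewrite lt0r b0 cdot_ge0.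
(* Violating the bound for one direction already violates the planar bound, so the planar tail
   covers all three events. *)
rewrite [X in P X](_ : _ = [set w | t * cdot a a * cdot b b <
   cdot a (eps w) ^+ 2 * cdot b b + cdot b (eps w) ^+ 2 * cdot a a]).
  exact: (gauss_orthogonal_tail sn0 (a := fun i => a i 0) (b := fun i => b i 0) gZ).
apply/seteqP; split => w //=; last by left; left.
case => [[//|h]|h].
  rewrite (@lt_le_trans _ _ (cdot a (eps w) ^+ 2 * cdot b b))//.
    by rewrite ltr_pM2r.
  by rewrite lerDl mulr_ge0 ?sqr_ge0 ?cdot_ge0.
rewrite (@lt_le_trans _ _ (cdot b (eps w) ^+ 2 * cdot a a))//.
  by rewrite mulrAC ltr_pM2r.
by rewrite lerDr mulr_ge0 ?sqr_ge0 ?cdot_ge0.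
Qed.

Let bad_noise_neg g : ssign g != 0 :> 'cV[R]_p -> bad_noise (sneg g) = bad_noise g.
Proof.
move=> s0; have s0' : ssign (sneg g) != 0 :> 'cV[R]_p by rewrite ssign_neg_eq0.
have aE : sign_direction X (sneg g) = - sign_direction X g.
  by rewrite /sign_direction ssupp_neg ssign_neg !mulmxN.
rewrite /bad_noise /good_noise ssupp_neg (negbTE s0) (negbTE s0') aE.
by apply/seteqP; split => w /=; rewrite !cdotNl !cdotNr !opprK !sqrrN.
Qed.

Let good_event_union_bound : ((1 - ((1 + 3 * k) ^+ p - 1 + k) / 2)%:E <=
  P [set w | good_event mu c0 an (X, z w)])%E.
Proof.
pose wt g : R := k ^+ (maxn #|ssupp g| 1).
pose f g := if ssign g == 0 :> 'cV[R]_p then wt g / 2 else wt g.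
have [mU PU] := fin_union_bound (S := half_signed (R := R)) (f := f)
  measurable_bad_noise (fun g _ => bad_noise_prob g).
have UE : [set w | good_event mu c0 an (X, z w)] =
    ~` \big[setU/set0]_(g in half_signed (R := R)) bad_noise g.
  rewrite -bigcup_seq_cond; apply/seteqP; split => w /=.
    by move=> h [g _ [d0 ng]]; case: (h g) => [/eqP|//]; rewrite (negbTE d0).
  move=> h g; have [->|d0] := eqVneq (\det (gram X (ssupp g))) 0; first by left.
  right; apply: contrapT => ng; apply: h.
  have gb : bad_noise g w by [].
  have [gh|gh] := boolP (g \in half_signed (R := R)).
    by exists g => //=; rewrite mem_index_enum.
  (* The opposite of a signed subset outside [half_signed] lies inside and has the same bad
     event. *)
  move: gh; rewrite inE negb_or => /andP[s0 lt].
  exists (sneg g); last by rewrite bad_noise_neg.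
  rewrite /= mem_index_enum/= inE snegK; apply/orP; right.
  rewrite ltn_neqAle leqNgt lt andbT.
  rewrite -[_ == _ :> nat]/(enum_rank (sneg g) == enum_rank g).
  by rewrite (inj_eq enum_rank_inj) (sneg_neq s0).
rewrite UE probability_setC// EFinB leeB//.
apply: (le_trans PU); rewrite lee_fin sum_half_signed.
  by rewrite sum_signed_subsets_max1.
by move=> g; rewrite /wt ssupp_neg.
Qed.

Lemma good_event_prob :
  ((prob_lower p c0 an)%:E <= P [set w | good_event mu c0 an (X, z w)])%E.
Proof.
have k0 : 0 <= k by exact: expR_ge0.
have M0 : 0 < M by apply: lt_le_trans M1_ge.
have MK : M `^ (1 + c0) = k^-1.
  by rewrite /powR gt_eqF// /k expRN invrK.
have lowE : prob_lower p c0 an = 2 - expR (2 * p%:R * k) - 2 * k.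
  by rewrite /prob_lower -/M MK invrK.
(* Beyond 2 the claimed lower bound is negative; otherwise [v ^+ 2 <= 2] is available for the final
   estimate. *)
have [big|small] := ltP 2 (expR (2 * p%:R * k)).
  apply: (@le_trans _ _ 0%E); last exact: measure_ge0.
  rewrite lowE lee_fin; lra.
apply: le_trans good_event_union_bound; rewrite lowE lee_fin.
set v := expR (p%:R * k).
have v2 : expR (2 * p%:R * k) = v ^+ 2 by rewrite -mulrA expRM_natl.
have v1 : 1 <= v by rewrite -expR0 ler_expR mulr_ge0.
have v3 : (1 + 3 * k) ^+ p <= v ^+ 3.
  rewrite /v -expRM_natl mulrCA expRM_natl.
  have h0 : 0 <= 1 + 3 * k by rewrite addr_ge0// mulr_ge0.
  by rewrite lerXn2r ?nnegrE ?expR_ge0// expR_ge1Dx.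
rewrite v2 in small *.
(* With v^3 bounding (1 + 3 k)^p, the claim follows from v^3 + 1 <= 2 v^2. *)
have : 0 <= (v - 1) * (v + 1 - v ^+ 2) by rewrite mulr_ge0//; lra.
have -> : (v - 1) * (v + 1 - v ^+ 2) = 2 * v ^+ 2 - v ^+ 3 - 1 by ring.
lra.
Qed.

End GoodEventProbability.

Lemma prob_lower_cvg1 (R : realType) (c0 : R) (p_ : nat -> nat) (a_ : nat -> R) :
  0 <= c0 -> (forall k, (1 <= p_ k)%N) ->
  (fun k => (p_ k)%:R / (Num.max (p_ k)%:R (a_ k)) `^ (1 + c0)) @ \oo --> (0 : R) ->
  (fun k => prob_lower (p_ k) c0 (a_ k)) @ \oo --> (1 : R).
Proof.
move=> c00 p1 cv; set x := fun k => _ / _ in cv.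
have Kpos k : 0 < (Num.max (p_ k)%:R (a_ k)) `^ (1 + c0).
  by apply: powR_gt0; rewrite lt_max ltr0n p1.
pose y k : R := 2 / (Num.max (p_ k)%:R (a_ k)) `^ (1 + c0).
have cx2 : (fun k => 2 * x k) @ \oo --> (0 : R).
  by rewrite -[X in _ --> X](mulr0 2); apply: cvgM => //; exact: cvg_cst.
have cy : y @ \oo --> (0 : R).
  apply: (@squeeze_cvgr _ _ _ _ (fun=> 0) (fun k => 2 * x k)) => //; last exact: cvg_cst.
  apply: nearW => k; rewrite /y divr_ge0 ?(ltW (Kpos k))//=.
  by rewrite ler_wpM2l// /x ler_peMl ?invr_ge0 ?(ltW (Kpos k))// ler1n.
have ce : (fun k => expR (2 * x k)) @ \oo --> (1 : R).
  have : (@expR R \o (fun k => 2 * x k)) @ \oo --> expR (0 : R).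
    by apply: continuous_cvg => //; exact: continuous_expR.
  by rewrite expR0.
have -> : (fun k => prob_lower (p_ k) c0 (a_ k)) =
    (fun k => 2 - expR (2 * x k) - y k).
  by apply/funext => k; rewrite /prob_lower /y /x mulrA.
rewrite -[X in _ --> X](_ : 2 - 1 - 0 = 1 :> R); last by ring.
apply: cvgB => //; apply: cvgB => //; exact: cvg_cst.
Qed.

Theorem theorem1 (R : realType) :
  (forall n p : nat,
     exists Omega0 : 'cV[R]_n -> R -> R -> set ('M[R]_(n, p) * 'cV[R]_n)%type,
     forall (X : 'M[R]_(n, p)) (beta : 'cV[R]_p) (sigma : R)
            (d : measure_display) (T : measurableType d) (P : probability T R)
            (eps : T -> 'cV[R]_n)
            (A0 : {set 'I_p}) (q : nat) (eta1 : R)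
            (qs : nat) (cl cu : R) (c0 an : R),
       0 < sigma ->
       gaussian_noise P sigma eps ->
       (1 <= q)%N ->
       #|[set j | j \notin A0]%SET| = q ->
       \sum_(j in A0) `|beta j 0| <= eta1 ->
       (1 <= qs <= p)%N ->
       0 < cl -> cl < cu ->
       sparse_riesz X qs cl cu ->
       0 <= c0 -> 0 <= an ->
       let eta2 := eta2_of X beta A0 in
       let Omega := Omega0 (X *m beta) c0 an in
       [/\ borel Omega,
           ((prob_lower p c0 an)%:E
              <= P [set w | Omega (X, sigma^-1 *: eps w)])%E &
           forall w : T, Omega (X, sigma^-1 *: eps w) ->
           forall (lambda : R), 0 < lambda ->
             (maxe (lambda_star n q eta1 eta2 cl cu qs)
                   (lambda_np n p sigma c0 an cu)%:E <= lambda%:E)%E ->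
           forall betahat : 'cV[R]_p,
             lasso_sol X (X *m beta + eps w) lambda betahat ->
             [/\ (qhat betahat <= qtilde A0 betahat)%N /\
                 (qtilde A0 betahat)%:R <= M1 n q eta1 eta2 cl cu lambda * q%:R,
                 Btilde X beta betahat ^+ 2
                   <= M2 n q eta1 eta2 cl cu lambda
                        * (q%:R * lambda ^+ 2 / (cu * n%:R)) &
                 zeta2 A0 beta betahat ^+ 2
                   <= M3 n q eta1 eta2 cl cu lambda
                        * (q%:R * lambda ^+ 2 / (cu * cl * n%:R ^+ 2))]])
  /\
  (forall (c0 : R) (p_ : nat -> nat) (a_ : nat -> R),
     0 <= c0 -> (forall k, (1 <= p_ k)%N) -> (forall k, 0 <= a_ k) ->
     (fun k => (p_ k)%:R / (Num.max (p_ k)%:R (a_ k)) `^ (1 + c0))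
       @ \oo --> (0 : R) ->
     (fun k => prob_lower (p_ k) c0 (a_ k)) @ \oo --> (1 : R)).
Proof.
split; last by move=> c0 p_ a_ c00 p1 _; exact: prob_lower_cvg1.
move=> n p; exists (fun mu c0 an => good_event mu c0 an).
move=> X beta sigma d T P eps A0 q eta1 qs cl cu c0 an sigma0 noise q_gt0 qE0 eta1E
  /andP[qs1 qsp] cl0 clu SR c00 an0 eta2 Omega.
have qE : #|~: A0| = q by rewrite -qE0; apply: eq_card => j; rewrite !inE.
have cu0 : 0 < cu by exact: lt_trans clu.
have p1 : (1 <= p)%N by exact: leq_trans qsp.
have n0 := sparse_riesz_n_gt0 qs1 qsp cl0 SR.
have eta10 : 0 <= eta1 by rewrite (le_trans _ eta1E)// sumr_ge0.
split; first by apply: borel_closed; exact: closed_good_event.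
  exact: good_event_prob.
move=> w Xz lam lam0; rewrite ge_max lee_fin => /andP[lstar lnp] betahat sol.
have epsE : eps w = sigma *: (sigma^-1 *: eps w).
  by rewrite scalerA divff ?scale1r// gt_eqF.
have M1q : M1 n q eta1 eta2 cl cu lam * q%:R + 1 <= qs%:R.
  apply: (lambda_star_M1 cu0 cl0 eta10 q_gt0 lam0 _ qs1 lstar).
  exact: eta2_of_ge0.
apply: (lasso_selection_bounds qs1 qsp cl0 clu SR q_gt0 qE lam0 eta1E _ M1q sol).
(* The path argument uses the noise bound at every level [mu >= lam]; the event itself does not
   involve the level. *)
move=> mu A lm Aq; rewrite epsE.
apply: (good_event_noise_ok sigma0 c00 cu0 n0 p1 Xz (le_trans lnp lm)).
exact: (injective_on_sparse qs1 qsp cl0 SR).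
Qed.
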